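(* Let $(P_n)_{n\ge 0}$ be a sequence of polynomials in $\mathbb{C}[z]$ with $\deg P_n=n$ for all $n\ge 0$ and $P_0\equiv 1$. Then the following statements (i)–(iv) are equivalent: (i) $(P_n)$ satisfies a restricted recurrence and is an orthonormal basis in $L^2_\mu$ for some measure $\mu$ on $\mathbb{C}$. (ii) $(P_n)$ satisfies a 3-term recurrence of the kind $$zP_n(z)=a\,\overline{c}_{n-1}P_{n-1}(z)+(b+a d_n)P_n(z)+a c_nP_{n+1}(z)\qquad (n\ge 0)$$ with $a,b,c_n\in\mathbb{C}$, $c_n\neq 0$, $|a|=1$, $d_n\in\mathbb{R}$, and $P_{-1}:=0$. (iii) For some $a,b\in\mathbb{C}$ with $|a|=1$, the polynomials $\tilde P_n(z):=P_n(b+az)$, $n\ge 0$, satisfy a symmetric 3-term recurrence $$z\tilde P_n(z)=\overline{c}_{n-1}\tilde P_{n-1}(z)+d_n\tilde P_n(z)+c_n\tilde P_{n+1}(z)\qquad (n\ge 0)$$ with $c_n\in\mathbb{C}$, $c_n\ne 0$, $d_n\in\mathbb{R}$, $\tilde P_{-1}:=0$ (and hence form an orthonormal basis in $L^2_\nu$ for some measure $\nu$ on the real line). (iv) $(P_n)$ is orthonormal in $L^2_\mu$ for some measure $\mu$ on a line $b+a\mathbb{R}$ with $a,b\in\mathbb{C}$, $|a|=1$. Moreover, the values of $a,b$ in (ii)–(iv) are the same (i.e. for a given pair $(a,b)$ with $|a|=1$, (ii) holds with $(a,b)$ iff (iii) holds with $(a,b)$ iff (iv) holds with $(a,b)$).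 Every measure $\mu$ on $\mathbb{C}$ for which $(P_n)$ is orthonormal in $L^2_\mu$ is concentrated on $b+a\mathbb{R}$; it is unique if and only if $\sum_{n\ge 0}|P_n(z)|^2=\infty$ for some (and hence for every) $z\in\mathbb{C}\setminus(b+a\mathbb{R})$.
   Context: Measures are (positive) Borel measures; $L^2_\mu$ is the Hilbert space of $\mu$-square-integrable complex functions, and a statement that polynomials are orthonormal (or an orthonormal basis) in $L^2_\mu$ includes that they belong to $L^2_\mu$. A measure on a line $\ell\subset\mathbb{C}$ is regarded as a measure on $\mathbb{C}$ concentrated on $\ell$, i.e. with $\mu(\mathbb{C}\setminus \ell)=0$. Any sequence $(P_n)_{n\ge0}$ in $\mathbb{C}[z]$ with $\deg P_n=n$ and $P_0\equiv1$ satisfies unique recurrence relations $zP_n(z)=\sum_{i=0}^{n+1}d_{in}P_i(z)$, $n\ge 0$, with $d_{in}\in\mathbb{C}$ and $d_{n+1,n}\neq 0$. These form a restricted recurrence if there are $r_n\in\{0,\dots,n+1\}$ such that $zP_n(z)=\sum_{i=r_n}^{n+1}d_{in}P_i(z)$ for all $n\ge0$ and $r_n\to\infty$ as $n\to\infty$. In (ii) and (iii) the value of $c_{-1}$ is irrelevant since it multiplies $P_{-1}=0$, respectively $\tilde P_{-1}=0$. *)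

(* Defs.v *)
From HB Require Import structures.
From mathcomp Require Import all_boot all_order all_algebra.
From mathcomp Require Import all_classical all_reals all_analysis.
From mathcomp Require Import complex.

Set Implicit Arguments.
Unset Strict Implicit.
Unset Printing Implicit Defensive.

Import Order.TTheory GRing.Theory Num.Theory.
Import numFieldNormedType.Exports.

Local Open Scope classical_set_scope.
Local Open Scope ring_scope.
Local Open Scope complex_scope.

(* The modulus as a function [R[i] -> R] ([`|z|] has type [R[i]]). *)
Notation cmod := ComplexField.Normc.normc.

(* The complex plane with its Borel sigma-algebra; the topology of [R[i]^o] is
   the one given by the modulus. *)
Notation borelC R := (g_sigma_algebraType (@open (R[i]^o))).

Section L2.
Variables (R : realType) (mu : {measure set (borelC R) -> \bar R}).
Local Notation C := (R[i]).

Definition sqnorm2 (f : C -> C) : \bar R :=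
  (\int[mu]_z ((cmod (f z)) ^+ 2)%:E)%E.

Definition inL2 (f : C -> C) : Prop :=
  measurable_fun [set: borelC R] (f : borelC R -> borelC R) /\
  (sqnorm2 f < +oo)%E.

(* Meaningful for f and g in L^2, in which case f * conj g is integrable. *)
Definition inner2 (f g : C -> C) : C :=
  Rintegral mu [set: borelC R] (fun z => complex.Re (f z * (g z)^*)) +i*
  Rintegral mu [set: borelC R] (fun z => complex.Im (f z * (g z)^*)).

Definition orthonormal2 (P : nat -> {poly C}) : Prop :=
  (forall n, inL2 (horner (P n))) /\
  (forall m n, inner2 (horner (P m)) (horner (P n)) = (m == n)%:R).

Definition orthonormal_basis2 (P : nat -> {poly C}) : Prop :=
  orthonormal2 P /\
  forall f, inL2 f -> forall e : R, 0 < e ->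
    exists N (k : nat -> C),
      (sqnorm2 (fun z => f z - (\sum_(i < N) k i *: P i).[z])%R < e%:E)%E.

Definition concentrated_on (A : set C) : Prop := mu (~` A) = 0%E.

End L2.

Section Recurrences.
Variable R : realType.
Local Notation C := (R[i]).
Implicit Types (P : nat -> {poly C}) (a b : C).

Definition line a b : set C := range (fun t : R => b + a * t%:C).

Definition real_line : set C := range (fun t : R => t%:C).

Definition restricted_recurrence P : Prop :=
  exists (r : nat -> nat) (d : nat -> nat -> C),
    [/\ forall n, (r n <= n.+1)%N,
        forall n, 'X * P n = \sum_(r n <= i < n.+2) d i n *: P i
      & r n @[n --> \oo] --> \oo].

(* [shift_prev u n] is u_(n-1), with u_(-1) = 0. *)
Definition shift_prev (V : nmodType) (u : nat -> V) (n : nat) : V :=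
  if n is m.+1 then u m else 0.

Definition three_term P a b : Prop :=
  exists (c : nat -> C) (d : nat -> R),
    (forall n, c n != 0) /\
    forall n, 'X * P n =
      (a * (shift_prev c n)^*) *: shift_prev P n
      + (b + a * (d n)%:C) *: P n + (a * c n) *: P n.+1.

Definition symmetric_three_term P : Prop :=
  exists (c : nat -> C) (d : nat -> R),
    (forall n, c n != 0) /\
    forall n, 'X * P n =
      (shift_prev c n)^* *: shift_prev P n
      + (d n)%:C *: P n + c n *: P n.+1.

Definition affine_subst P a b : nat -> {poly C} :=
  fun n => P n \Po (b%:P + a *: 'X).

Definition orthonormal_on_line P a b : Prop :=
  exists mu : {measure set (borelC R) -> \bar R},
    concentrated_on mu (line a b) /\ orthonormal2 mu P.

(* A measure is only determined by its values on measurable sets: outside them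
   the underlying function on sets is arbitrary. *)
Definition unique_orthonormality_measure P : Prop :=
  exists mu : {measure set (borelC R) -> \bar R},
    orthonormal2 mu P /\
    forall nu : {measure set (borelC R) -> \bar R}, orthonormal2 nu P ->
      forall A : set (borelC R), measurable A -> nu A = mu A.

Definition sum_sq P (z : C) : \bar R :=
  (\sum_(0 <= n <oo) ((cmod (P n).[z]) ^+ 2)%:E)%E.

End Recurrences.

(* Main.v *)
Require Import Defs.
From HB Require Import structures.
From mathcomp Require Import all_boot all_order all_algebra.
From mathcomp Require Import all_classical all_reals all_analysis.
From mathcomp Require Import complex.
From mathcomp Require Import measurable_realfun archimedean.
From mathcomp Require Import ring lra.

(** Write [z = b + a t]. Composing with this affine map turns the three-term recurrence
    into the symmetric one and measures on the line into measures on the real axis, so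
    that most of the work takes place on the real axis, with the polynomials [p n]
    obtained from [P n] and a Hermitian Jacobi matrix.

    From orthogonality to recurrences. On the axis, multiplication by the variable is
    symmetric; its matrix in the basis [p n] is Hermitian and has a single subdiagonal,
    hence is tridiagonal ([solution_symmetric]). For a basis with a restricted
    recurrence, the function [conj z] is orthogonal to all but finitely many [P n], because
    its coefficients are the conjugates of those of [P 0] in [z P n]; hence [conj z = q(z)]
    almost everywhere for a polynomial [q]. Conjugating once more, [z] is the value at [z]
    of the composite of [q] and its conjugate, so that [q] has degree one, and such an
    equation describes a line ([basis_on_line]). Conversely, with [w = (z - b) / a] the three-term
    recurrence gives [int |w|^2 = int w^2] for every orthonormalizing measure, so that [w] is real
    almost everywhere ([orthonormal_concentrated]).

    From recurrences to orthogonality. Diagonalizing the finite Jacobi matrices gives Gauss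
    quadratures, discrete laws for which finitely many [p n] are orthonormal
    ([quadrature_exists]). Their moments are bounded, and Helly's selection theorem, proved here with
    quantile functions on the unit interval, yields a limit law that keeps all moments
    ([helly_moments]); all [p n] are orthonormal for it.

    Density and uniqueness are both read off the Cauchy kernel [1 / (x - z)] for one nonreal
    [z]. If the kernel is in the closure of the polynomials, then so is the indicator of each
    half-line, and hence every square integrable function ([clos_L2]). The sum [S] of
    the [|p_k(z)|^2] decides. If [S] diverges, the kernel is a limit of polynomials
    that can be chosen independently of the measure ([unbounded_cauchy]); applied to the sum of two
    solutions, this shows that they agree ([solution_unique]). If [S] converges, the
    kernel is still in the closure for limits of Gauss quadratures, because Parseval's identity holds
    exactly for the latter and passes to the limit ([gauss_limit_cauchy]); this gives a basis in all
    cases ([dense_solution]). On the other hand, the Gauss quadratures of order [n] form a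
    family with one real parameter, the shift of the last diagonal entry of the Jacobi matrix, and
    the Wronskian and Christoffel-Darboux identities show that it moves the
    integral of the kernel by an amount comparable with [1 / S] ([two_gauss]). In the limit there are two
    different solutions ([solution_nonunique]). As uniqueness does not mention [z], divergence at one
    point off the line implies divergence at all of them. *)

Set Implicit Arguments.
Unset Strict Implicit.
Unset Printing Implicit Defensive.

Import Order.TTheory GRing.Theory Num.Theory.
Import numFieldNormedType.Exports.

Local Open Scope classical_set_scope.
Local Open Scope complex_scope.
Local Open Scope ring_scope.

(** * Complex square integrable functions *)

Section ComplexArith.
Variable R : realType.
Local Notation C := R[i].
Implicit Types (x y z : C).

Definition sqn z : R := cmod z ^+ 2.

Lemma conjE z : z^* = conjc z. Proof. by []. Qed.

Lemma sqnE z : sqn z = complex.Re z ^+ 2 + complex.Im z ^+ 2.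
Proof. by rewrite /sqn; case: z => a b /=; rewrite sqr_sqrtr// addr_ge0 ?sqr_ge0. Qed.

Lemma sqn_ge0 z : 0 <= sqn z. Proof. exact: sqr_ge0. Qed.

Lemma sqn0 : sqn 0 = 0. Proof. by rewrite sqnE /= expr0n/= addr0. Qed.

Lemma sqn1 : sqn 1 = 1. Proof. by rewrite sqnE /= expr0n/= addr0 expr1n. Qed.

Lemma sqnM x y : sqn (x * y) = sqn x * sqn y.
Proof. by rewrite ?conjE !sqnE; case: x => a b; case: y => c d /=; ring. Qed.

Lemma sqn_eq0 z : (sqn z == 0) = (z == 0).
Proof.
rewrite sqnE paddr_eq0 ?sqr_ge0// !sqrf_eq0 eq_complex /=.
by case: z.
Qed.

Lemma sqnV z : sqn z^-1 = (sqn z)^-1.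
Proof.
have [->|z0] := eqVneq z 0; first by rewrite invr0 sqn0 invr0.
apply: (mulIf (x := sqn z)); first by rewrite sqn_eq0.
by rewrite mulVf ?sqn_eq0// -sqnM mulVf// sqn1.
Qed.

Lemma sqn_conj z : sqn z^* = sqn z.
Proof. by rewrite conjE !sqnE; case: z => a b /=; ring. Qed.

Lemma sqnN z : sqn (- z) = sqn z.
Proof. by rewrite !sqnE; case: z => a b /=; ring. Qed.

Lemma sqnB x y : sqn (x - y) = sqn (y - x).
Proof. by rewrite -sqnN opprB. Qed.

Lemma sqn_real (t : R) : sqn t%:C = t ^+ 2.
Proof. by rewrite sqnE /= expr0n addr0. Qed.

Lemma mul_conj z : z * z^* = (sqn z)%:C.
Proof.
rewrite conjE sqnE; case: z => a b; apply/eqP; rewrite eq_complex /=.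
by apply/andP; split; apply/eqP; ring.
Qed.

Lemma sqnD_le x y : sqn (x + y) <= 2 * sqn x + 2 * sqn y.
Proof.
rewrite !sqnE; case: x => a b; case: y => c d /=.
rewrite -subr_ge0 (_ : _ - _ = (a - c) ^+ 2 + (b - d) ^+ 2); last by ring.
by rewrite addr_ge0 ?sqr_ge0.
Qed.

Lemma sqnD_eq x y : sqn (x + y) = sqn x + 2 * complex.Re (y^* * x) + sqn y.
Proof. by rewrite ?conjE !sqnE; case: x => a b; case: y => c d /=; ring. Qed.

Lemma ReD x y : complex.Re (x + y) = complex.Re x + complex.Re y.
Proof. by case: x => ? ?; case: y. Qed.
Lemma ImD x y : complex.Im (x + y) = complex.Im x + complex.Im y.
Proof. by case: x => ? ?; case: y. Qed.
Lemma ReM x y : complex.Re (x * y) =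
  complex.Re x * complex.Re y - complex.Im x * complex.Im y.
Proof. by case: x => ? ?; case: y. Qed.
Lemma ImM x y : complex.Im (x * y) =
  complex.Re x * complex.Im y + complex.Im x * complex.Re y.
Proof. by case: x => ? ?; case: y. Qed.
Lemma Re_conj z : complex.Re z^* = complex.Re z. Proof. by rewrite conjE; case: z. Qed.
Lemma Im_conj z : complex.Im z^* = - complex.Im z. Proof. by rewrite conjE; case: z. Qed.

Lemma conjM x y : (x * y)^* = x^* * y^*.
Proof. exact: rmorphM. Qed.
Lemma conjD x y : (x + y)^* = x^* + y^*.
Proof. exact: rmorphD. Qed.

Lemma ReV z : complex.Re z^-1 = complex.Re z / sqn z.
Proof. by rewrite sqnE; case: z. Qed.
Lemma ImV z : complex.Im z^-1 = - complex.Im z / sqn z.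
Proof. by rewrite sqnE; case: z => a b; rewrite mulNr. Qed.

Lemma complexP x y : complex.Re x = complex.Re y ->
  complex.Im x = complex.Im y -> x = y.
Proof. by case: x => ? ?; case: y => ? ? /= -> ->. Qed.

Lemma norm1_sqn z : `|z| = 1 -> sqn z = 1.
Proof. by move=> /complexI; rewrite /sqn => h; rewrite -[cmod z]/(ComplexField.Normc.normc z) h expr1n. Qed.

Lemma norm1_mul_conj z : `|z| = 1 -> z * z^* = 1.
Proof. by move=> /norm1_sqn h; rewrite mul_conj h. Qed.

Lemma norm1_neq0 z : `|z| = 1 -> z != 0.
Proof. by move=> h; rewrite -normr_eq0 h oner_eq0. Qed.

End ComplexArith.

Section ComplexIntegral.
Context d (T : measurableType d) (R : realType).
Variable mu : {measure set T -> \bar R}.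
Local Notation C := R[i].
Implicit Types (f g : T -> C) (k : C).

(** Measurability, like integrability and the integral below, is imposed on the two
    components, so that no sigma-algebra on the complex numbers is involved and the
    real theory applies on an arbitrary measurable space. *)
Definition cmeas f := measurable_fun [set: T] (fun x => complex.Re (f x)) /\
  measurable_fun [set: T] (fun x => complex.Im (f x)).

Definition cintegrable f :=
  mu.-integrable [set: T] (fun x => (complex.Re (f x))%:E) /\
  mu.-integrable [set: T] (fun x => (complex.Im (f x))%:E).

Definition cint f : C :=
  Rintegral mu [set: T] (fun x => complex.Re (f x)) +i*
  Rintegral mu [set: T] (fun x => complex.Im (f x)).

Lemma cmeasD f g : cmeas f -> cmeas g -> cmeas (fun x => f x + g x).
Proof.
move=> [f1 f2] [g1 g2]; split.
  by under eq_fun do rewrite ReD; exact: measurable_funD.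
by under eq_fun do rewrite ImD; exact: measurable_funD.
Qed.

Lemma cmeasM f g : cmeas f -> cmeas g -> cmeas (fun x => f x * g x).
Proof.
move=> [f1 f2] [g1 g2]; split.
  by under eq_fun do rewrite ReM; apply: measurable_funB; apply: measurable_funM.
by under eq_fun do rewrite ImM; apply: measurable_funD; apply: measurable_funM.
Qed.

Lemma cmeas_cst k : cmeas (fun=> k). Proof. by split; exact: measurable_cst. Qed.

Lemma cmeasZ k f : cmeas f -> cmeas (fun x => k * f x).
Proof. by apply: cmeasM; exact: cmeas_cst. Qed.

Lemma cmeasN f : cmeas f -> cmeas (fun x => - f x).
Proof. by move=> mf; under [X in cmeas X]eq_fun do rewrite -mulN1r; exact: cmeasZ. Qed.

Lemma cmeasB f g : cmeas f -> cmeas g -> cmeas (fun x => f x - g x).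
Proof. by move=> mf mg; apply: cmeasD => //; exact: cmeasN. Qed.

Lemma cmeas_conj f : cmeas f -> cmeas (fun x => (f x)^*).
Proof.
move=> [f1 f2]; split; first by under eq_fun do rewrite Re_conj.
by under eq_fun do rewrite Im_conj; exact: measurableT_comp.
Qed.

Lemma cmeas_real (f : T -> R) : measurable_fun [set: T] f -> cmeas (fun x => (f x)%:C).
Proof. by move=> mf; split => //=; exact: measurable_cst. Qed.

Lemma cmeas_sqn f : cmeas f -> measurable_fun [set: T] (fun x => sqn (f x)).
Proof.
move=> [f1 f2]; under eq_fun do rewrite sqnE.
by apply: measurable_funD; apply: measurable_funX.
Qed.

Lemma cintegrableD f g : cintegrable f -> cintegrable g ->
  cintegrable (fun x => f x + g x).
Proof.
move=> [f1 f2] [g1 g2]; split.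
  by under eq_fun do rewrite ReD EFinD; exact: integrableD.
by under eq_fun do rewrite ImD EFinD; exact: integrableD.
Qed.

Lemma cintegrableZ k f : cintegrable f -> cintegrable (fun x => k * f x).
Proof.
move=> [f1 f2]; split.
  under eq_fun do rewrite ReM EFinB 2!EFinM.
  by apply: integrableB => //; apply: integrableZl.
under eq_fun do rewrite ImM EFinD 2!EFinM.
by apply: integrableD => //; apply: integrableZl.
Qed.

Lemma cintegrable_conj f : cintegrable f -> cintegrable (fun x => (f x)^*).
Proof.
move=> [f1 f2]; split; first by under eq_fun do rewrite Re_conj.
under eq_fun do rewrite Im_conj EFinN.
exact: integrableN.
Qed.

Lemma cintD f g : cintegrable f -> cintegrable g ->
  cint (fun x => f x + g x) = cint f + cint g.
Proof.
move=> [f1 f2] [g1 g2]; rewrite /cint; apply: complexP => /=.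
  by under eq_Rintegral do rewrite ReD; rewrite RintegralD.
by under eq_Rintegral do rewrite ImD; rewrite RintegralD.
Qed.

Lemma cintZ k f : cintegrable f -> cint (fun x => k * f x) = k * cint f.
Proof.
have aux (c : R) (u : T -> R) : mu.-integrable setT (EFin \o u) ->
    mu.-integrable setT (EFin \o (fun x => c * u x)).
  by move=> mu_u; have := integrableZl measurableT c mu_u.
move=> [f1 f2]; rewrite /cint; apply: complexP; rewrite ?ReM ?ImM /=.
  under eq_Rintegral do rewrite ReM.
  by rewrite RintegralB//; [rewrite !RintegralZl|exact: aux|exact: aux].
under eq_Rintegral do rewrite ImM.
by rewrite RintegralD//; [rewrite !RintegralZl|exact: aux|exact: aux].
Qed.

Lemma cint_conj f : cintegrable f -> cint (fun x => (f x)^*) = (cint f)^*.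
Proof.
move=> [f1 f2]; rewrite /cint; apply: complexP => /=.
  by under eq_Rintegral do rewrite Re_conj.
under eq_Rintegral do rewrite Im_conj -mulN1r.
by rewrite RintegralZl// mulN1r.
Qed.

Lemma eq_cint f g : f =1 g -> cint f = cint g.
Proof. by move=> /funext->. Qed.

Definition L2 f := cmeas f /\ mu.-integrable [set: T] (fun x => (sqn (f x))%:E).

Definition norm2 f : R := Rintegral mu [set: T] (fun x => sqn (f x)).

Definition ip f g : C := cint (fun x => f x * (g x)^*).

Lemma le_integrableR (u v : T -> R) : measurable_fun [set: T] u ->
  (forall x, `|u x| <= v x) ->
  mu.-integrable [set: T] (fun x => (v x)%:E) ->
  mu.-integrable [set: T] (fun x => (u x)%:E).
Proof.
move=> mfu uv; apply: le_integrable => //; first exact/measurable_EFinP.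
by move=> x _ /=; rewrite lee_fin (le_trans (uv x))// ler_norm.
Qed.

Lemma integrableRD (u v : T -> R) :
  mu.-integrable [set: T] (fun x => (u x)%:E) ->
  mu.-integrable [set: T] (fun x => (v x)%:E) ->
  mu.-integrable [set: T] (fun x => (u x + v x)%:E).
Proof. by move=> iu iv; under eq_fun do rewrite EFinD; exact: integrableD. Qed.

Lemma integrableRZ (c : R) (u : T -> R) :
  mu.-integrable [set: T] (fun x => (u x)%:E) ->
  mu.-integrable [set: T] (fun x => (c * u x)%:E).
Proof. by move=> iu; under eq_fun do rewrite EFinM; exact: (integrableZl measurableT c iu). Qed.

Lemma L2D f g : L2 f -> L2 g -> L2 (fun x => f x + g x).
Proof.
move=> [mf f2] [mg g2]; split; first exact: cmeasD.
apply: (@le_integrableR _ (fun x => 2 * sqn (f x) + 2 * sqn (g x))).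
- by apply: cmeas_sqn; exact: cmeasD.
- by move=> x; rewrite ger0_norm ?sqn_ge0// sqnD_le.
- by apply: integrableRD; exact: integrableRZ.
Qed.

Lemma L2_bounded (m : T -> C) (M : R) f : cmeas m -> (forall x, sqn (m x) <= M) ->
  L2 f -> L2 (fun x => m x * f x).
Proof.
move=> mm mM [mf f2]; split; first exact: cmeasM.
apply: (@le_integrableR _ (fun x => M * sqn (f x))).
- by apply: cmeas_sqn; exact: cmeasM.
- by move=> x; rewrite ger0_norm ?sqn_ge0// sqnM ler_wpM2r// sqn_ge0.
- exact: integrableRZ.
Qed.

Lemma L2Z k f : L2 f -> L2 (fun x => k * f x).
Proof. by apply: (@L2_bounded _ (sqn k)) => //; exact: cmeas_cst. Qed.

Lemma L2N f : L2 f -> L2 (fun x => - f x).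
Proof. by move=> fL; under [X in L2 X]eq_fun do rewrite -mulN1r; exact: L2Z. Qed.

Lemma L2B f g : L2 f -> L2 g -> L2 (fun x => f x - g x).
Proof. by move=> fL gL; apply: L2D => //; exact: L2N. Qed.

Lemma L2_0 : L2 (fun=> 0).
Proof.
split; first exact: cmeas_cst.
by under eq_fun do rewrite sqn0; exact: integrable0.
Qed.

Lemma L2_sum N (F : nat -> T -> C) : (forall n, (n < N)%N -> L2 (F n)) ->
  L2 (fun x => \sum_(n < N) F n x).
Proof.
elim: N => [|N ih] FL.
  by under [X in L2 X]eq_fun do rewrite big_ord0; exact: L2_0.
under [X in L2 X]eq_fun do rewrite big_ord_recr.
by apply: L2D; [apply: ih => n nN; apply: FL; exact: ltnW|exact: FL].
Qed.

Lemma L2_ip_integrable f g : L2 f -> L2 g -> cintegrable (fun x => f x * (g x)^*).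
Proof.
move=> [mf f2] [mg g2].
have mfg : cmeas (fun x => f x * (g x)^*) by apply: cmeasM => //; exact: cmeas_conj.
(* Both components of [u * conj v] are bounded by [|u|^2 + |v|^2]; the squares below are the
     certificates. *)
have bound x : `|complex.Re (f x * (g x)^*)| <= sqn (f x) + sqn (g x) /\
    `|complex.Im (f x * (g x)^*)| <= sqn (f x) + sqn (g x).
  rewrite conjE !sqnE; case: (f x) => a b; case: (g x) => c e /=.
  have := (sqr_ge0 (a - c), sqr_ge0 (a + c), sqr_ge0 (b - e), sqr_ge0 (b + e),
    (sqr_ge0 (a - e), sqr_ge0 (a + e), sqr_ge0 (b - c), sqr_ge0 (b + c)),
    (sqr_ge0 a, sqr_ge0 b, sqr_ge0 c, sqr_ge0 e)).
  move=> [[[[[h1 h2] h3] h4] [[[h5 h6] h7] h8]] [[[h9 h10] h11] h12]].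
  by split; rewrite ler_norml; apply/andP; split; lra.
split; (apply: (@le_integrableR _ (fun x => sqn (f x) + sqn (g x)));
  [by case: mfg|by move=> x; case: (bound x)|
   exact: integrableRD]).
Qed.

Lemma ipDl f g h : L2 f -> L2 g -> L2 h ->
  ip (fun x => f x + g x) h = ip f h + ip g h.
Proof.
move=> fL gL hL; rewrite /ip -cintD; try exact: L2_ip_integrable.
by apply: eq_cint => x; rewrite mulrDl.
Qed.

Lemma ipZl k f g : L2 f -> L2 g -> ip (fun x => k * f x) g = k * ip f g.
Proof.
move=> fL gL; rewrite /ip -cintZ; last exact: L2_ip_integrable.
by apply: eq_cint => x; rewrite mulrA.
Qed.

Lemma ip_conj f g : L2 f -> L2 g -> ip g f = (ip f g)^*.
Proof.
move=> fL gL; rewrite /ip -cint_conj; last exact: L2_ip_integrable.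
by apply: eq_cint => x; rewrite conjM conjCK mulrC.
Qed.

Lemma ip_sum N (a : nat -> C) (F : nat -> T -> C) g :
  (forall n, (n < N)%N -> L2 (F n)) -> L2 g ->
  ip (fun x => \sum_(n < N) a n * F n x) g = \sum_(n < N) a n * ip (F n) g.
Proof.
move=> + gL; elim: N => [|N ih] FL.
  rewrite big_ord0 /ip; under eq_cint do rewrite big_ord0 mul0r.
  by rewrite /cint /Rintegral integral0.
rewrite [RHS]big_ord_recr/= -ih; last by move=> n nN; apply: FL; exact: ltnW.
rewrite -ipZl//; last exact: FL.
rewrite -ipDl//; last 2 first.
- by apply: (@L2_sum N (fun n x => a n * F n x)) => n nN; apply/L2Z/FL/ltnW.
- exact/L2Z/FL.
by congr ip; apply/funext => x; rewrite big_ord_recr.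
Qed.

Lemma norm2_ge0 f : 0 <= norm2 f.
Proof. by apply: Rintegral_ge0 => x _; exact: sqn_ge0. Qed.

Lemma ipff f : L2 f -> ip f f = (norm2 f)%:C.
Proof.
move=> [mf f2]; rewrite /ip; under eq_cint do rewrite mul_conj.
by apply: complexP => //=; rewrite /Rintegral integral0.
Qed.

Lemma norm2E f : L2 f -> (norm2 f)%:E = (\int[mu]_x (sqn (f x))%:E)%E.
Proof. by move=> [mf f2]; rewrite /norm2 /Rintegral fineK//; exact: integrable_fin_num. Qed.

Lemma norm2D_eq f g : L2 f -> L2 g ->
  norm2 (fun x => f x + g x) = norm2 f + 2 * complex.Re (ip f g) + norm2 g.
Proof.
move=> fL gL; have [fgL _] := L2_ip_integrable fL gL; rewrite /norm2.
case: (fL) => _ f2; case: (gL) => _ g2.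
under eq_Rintegral do rewrite sqnD_eq [_^* * _]mulrC.
rewrite RintegralD//; last by apply: integrableRD => //; exact: integrableRZ.
rewrite RintegralD//; last exact: integrableRZ.
by rewrite RintegralZl.
Qed.

Lemma norm2Z k f : L2 f -> norm2 (fun x => k * f x) = sqn k * norm2 f.
Proof.
by move=> [_ f2]; rewrite /norm2; under eq_Rintegral do rewrite sqnM; rewrite RintegralZl.
Qed.

Lemma norm2D_le f g : L2 f -> L2 g ->
  norm2 (fun x => f x + g x) <= 2 * norm2 f + 2 * norm2 g.
Proof.
move=> fL gL; case: (L2D fL gL) => _ fg2.
case: (fL) => _ f2; case: (gL) => _ g2.
rewrite /norm2 -!RintegralZl// -RintegralD//; try exact: integrableRZ.
apply: le_Rintegral => //; last by move=> x _; exact: sqnD_le.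
by apply: integrableRD; exact: integrableRZ.
Qed.

Lemma norm2_mulB f (m : T -> C) (M : R) : cmeas m -> (forall x, sqn (m x) <= M) ->
  L2 f -> norm2 (fun x => m x * f x) <= M * norm2 f.
Proof.
move=> mm mM fL; have [_ mf2] := L2_bounded mm mM fL.
case: fL => _ f2; rewrite /norm2 -RintegralZl//.
apply: le_Rintegral => //; first exact: integrableRZ.
by move=> x _; rewrite sqnM ler_wpM2r// sqn_ge0.
Qed.

Lemma norm2_eq0 f : L2 f -> norm2 f = 0 -> {ae mu, forall x, f x = 0}.
Proof.
move=> fL f0; have := norm2E fL; rewrite f0; case: fL => mf _.
have -> : (\int[mu]_x (sqn (f x))%:E = \int[mu]_x `|(sqn (f x))%:E|)%E.
  by apply: eq_integral => x _; rewrite gee0_abs// lee_fin sqn_ge0.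
move=> /esym/ae_eq_integral_abs h.
have {}h := h measurableT (proj2 (measurable_EFinP _ _) (cmeas_sqn mf)).
apply: filterS h => x /(_ I) [] /eqP; rewrite sqn_eq0 => /eqP//.
Qed.

(** The least-squares identity behind all approximation arguments: Bessel's inequality
    and the optimality of Fourier coefficients are its two special cases. *)
Lemma norm2_sub_orthonormal (e : nat -> T -> C) f N (a : nat -> C) :
  (forall n, (n < N)%N -> L2 (e n)) ->
  (forall m n, (m < N)%N -> (n < N)%N -> ip (e m) (e n) = (m == n)%:R) -> L2 f ->
  norm2 (fun x => f x - \sum_(n < N) a n * e n x) =
  norm2 f - \sum_(n < N) sqn (ip f (e n)) + \sum_(n < N) sqn (ip f (e n) - a n).
Proof.
move=> + + fL; elim: N => [|N ih] eL eO.
  rewrite !big_ord0 subr0 addr0; congr norm2; apply/funext => x.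
  by rewrite big_ord0 subr0.
have eN : L2 (e N) by exact: eL.
have eL' n : (n < N)%N -> L2 (e n) by move=> nN; apply: eL; exact: ltnW.
have sL : L2 (fun x => \sum_(n < N) a n * e n x).
  by apply: (@L2_sum N (fun n x => a n * e n x)) => n nN; exact/L2Z/eL'.
rewrite (_ : (fun x => _) = fun x => (f x - \sum_(n < N) a n * e n x) + (- a N) * e N x); last first.
  by apply/funext => x; rewrite big_ord_recr/= opprD addrA mulNr.
rewrite norm2D_eq; [|exact: L2B|exact: L2Z].
rewrite ih//; last by move=> m n mN nN; apply: eO; exact: ltnW.
have -> : ip (fun x => f x - \sum_(n < N) a n * e n x) (fun x => - a N * e N x) =
    (- a N)^* * ip f (e N).
  rewrite ip_conj; [|exact: L2Z|exact: L2B].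
  rewrite ipZl//; last exact: L2B.
  rewrite conjM -ip_conj//; last exact: L2B.
  congr (_ * _).
  rewrite (_ : (fun x => _) = fun x => f x + (-1) * \sum_(n < N) a n * e n x); last first.
    by apply/funext => x; rewrite mulN1r.
  rewrite ipDl ?ipZl//; last exact: L2Z.
  rewrite ip_sum// big1 ?mulr0 ?addr0// => i _.
  by rewrite eO ?ltnS// ?(ltnW (ltn_ord i))// (ltn_eqF (ltn_ord i)) mulr0.
rewrite norm2Z//.
have -> : norm2 (e N) = 1 by apply: complexI; rewrite -ipff// eO// eqxx.
rewrite !big_ord_recr/= sqnN mulr1 [sqn (ip f (e N) - _)]sqnD_eq sqnN.
by ring.
Qed.

End ComplexIntegral.

(** * Quantile functions and Helly selection *)

(** The canonical measure structure on [pushforward mu f], with the measurability proof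
    as an explicit argument. *)
Definition pushm d1 d2 (T1 : measurableType d1) (T2 : measurableType d2)
    (R : realType) (mu : {measure set T1 -> \bar R}) (f : T1 -> T2)
    (mf : measurable_fun [set: T1] f) : {measure set T2 -> \bar R} :=
  measure_function_pushforward__canonical__measure_function_Measure mu mf.

Section Quantile.
Context {R : realType} (P : probability (measurableTypeR R) R).
Local Open Scope measure_display_scope.

Let idTR : measurableTypeR R -> R := idfun.

#[local] HB.instance Definition _ :=
  @isMeasurableFun.Build _ _ _ _ idTR (@measurable_id _ _ setT).

Definition dfun (x : R) : R := fine (cdf (idTR : {RV P >-> R}) x).

Lemma dfunE x : (dfun x)%:E = P `]-oo, x]%classic.
Proof. by rewrite /dfun fineK ?fin_num_measure. Qed.

Lemma dfun_nd : nondecreasing dfun.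
Proof. by move=> x y xy; rewrite fine_le ?fin_num_measure// cdf_nondecreasing. Qed.

Lemma dfun_rc : right_continuous dfun.
Proof.
move=> a; apply: fine_cvg.
by rewrite fineK ?fin_num_measure//; exact: cdf_right_continuous.
Qed.

Lemma dfun_Ny : dfun @ -oo --> (0:R).
Proof. exact/fine_cvg/cvg_cdfNy0. Qed.

Lemma dfun_y : dfun @ +oo --> (1:R).
Proof. exact/fine_cvg/cvg_cdfy1. Qed.

(** Galois inverse of the distribution function on the open unit interval; outside of it
    the value is irrelevant. *)
Definition quantile (t : R) : R := inf [set x | t <= dfun x].

(** The infimum is attained because the distribution function is right continuous. *)
Lemma quantile_le t x : 0 < t < 1 -> (quantile t <= x) = (t <= dfun x).
Proof.
move=> /andP[t0 t1].
have [y yt] : exists y, dfun y < t.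
  have /cvgr_lt/(_ _ t0) := dfun_Ny.
  by move=> /= [M [Mr h]]; exists (M - 1); apply: h; rewrite ltrBlDr ltrDl.
have [z tz] : exists z, t < dfun z.
  have /cvgr_gt/(_ _ t1) := dfun_y.
  by move=> /= [M [Mr h]]; exists (M + 1); apply: h; rewrite ltrDl.
have hl : has_lbound [set x | t <= dfun x].
  exists y => u /= tu; rewrite leNgt; apply/negP => uy.
  by have := lt_le_trans yt (le_trans tu (dfun_nd (ltW uy))); rewrite ltxx.
have hi : has_inf [set x | t <= dfun x] by split => //; exists z => /=; exact: ltW.
apply/idP/idP => [qx|tx]; last exact: ge_inf.
apply: le_trans (dfun_nd qx).
have := @dfun_rc (quantile t) => /(@cvgr_to_ge _ _ _ _ _ _ t); apply.
near=> u.
have qu : quantile t < u by near: u; exact: nbhs_right_gt.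
have [v /= tv vu] := inf_lt (proj1 hi) qu.
exact: le_trans tv (dfun_nd (ltW vu)).
Unshelve. all: by end_near. Qed.

Lemma quantile_nd s t : 0 < s < 1 -> 0 < t < 1 -> s <= t ->
  quantile s <= quantile t.
Proof.
move=> s01 t01 st; rewrite quantile_le// (le_trans st)//.
by rewrite -quantile_le.
Qed.

End Quantile.

Section UnitInterval.
Context {R : realType}.
Local Notation leb := (@lebesgue_measure R).
Local Notation U01 := (mrestr leb (measurable_itv `]0, 1[)).

Lemma mono01_measurable (f : R -> R) :
  (forall s t, 0 < s < 1 -> 0 < t < 1 -> s <= t -> f s <= f t) ->
  measurable_fun [set: measurableTypeR R] (f \_ `]0, 1[ : measurableTypeR R -> R).
Proof.
move=> ndf; apply/(measurable_restrictT f (measurable_itv `]0, 1[)).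
apply: (measurability (@RGenCInfty.G R)) => [|/= _ [_] [r] -> <-].
  exact: RGenCInfty.measurableE.
apply: is_interval_measurable => s t/=.
rewrite !in_itv/= !andbT => -[s01 fs] [t01 ft] u /andP[su ut].
have u01 : 0 < u < 1.
  by case/andP: s01 => s0 _; case/andP: t01 => _ t1; rewrite (lt_le_trans s0)//= (le_lt_trans ut).
by split => //; rewrite in_itv/= andbT (le_trans fs)// ndf.
Qed.

Lemma U01_setT : U01 [set: R] = 1%E.
Proof. by rewrite /mrestr setTI lebesgue_measure_itv/= lte_fin ltr01 sube0. Qed.

(** The image of the uniform law under the quantile function agrees with [P] on the rays
    [`]x, +oo[], which generate the Borel sets and are stable under intersection. *)
Lemma quantile_law (P : probability (measurableTypeR R) R)
    (A : set (measurableTypeR R)) : measurable A ->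
  U01 ((quantile P \_ `]0, 1[) @^-1` A) = P A.
Proof.
have mq := mono01_measurable (@quantile_nd R P).
set Q := (quantile P \_ _) in mq *.
move=> mA.
pose V : {measure set (measurableTypeR R) -> \bar R} := @pushm _ _
  (measurableTypeR R) (measurableTypeR R) R U01 Q mq.
change (V A = P A).
have ray x : P `]x, +oo[%classic = (1 - dfun P x)%:E.
  rewrite EFinB dfunE -(probability_setT P) -setCitvl -setTD measureD ?setTI//.
  by rewrite (le_lt_trans (probability_le1 P measurableT)) ?ltry.
have dfun01 x : 0 <= dfun P x <= 1.
  by rewrite -!lee_fin dfunE measure_ge0 probability_le1.
have sP : P [set: measurableTypeR R] = 1%E by exact: probability_setT.
apply: (@measure_unique _ R (measurableTypeR R) (@RGenOInfty.G R)
  (fun n => `]- n%:R, +oo[%classic) _ _ _ _ V P) => //.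
- exact: RGenOInfty.measurableE.
- move=> _ _ [x ->] [y ->]; exists (Num.max x y); apply/seteqP; split => z /=.
    by rewrite !in_itv/= !andbT gt_max => -[-> ->].
  by rewrite !in_itv/= !andbT gt_max => /andP.
- by move=> i; eexists; reflexivity.
- rewrite -subTset => x _; exists (Num.truncn (- x)).+1 => //=.
  by rewrite in_itv/= andbT ltrNl truncnS_gt.
- move=> _ [x ->]; transitivity (1 - dfun P x)%:E; last exact/esym/ray.
  rewrite /V /pushm/= /pushforward/= /mrestr.
  have /andP[F0 F1] := dfun01 x.
  rewrite (_ : _ `&` _ = `]dfun P x, 1[%classic); last first.
    apply/seteqP; split => t /=; rewrite !in_itv/= andbT.
      move=> [+ /andP[t0 t1]]; rewrite /Q patchE mem_set /= ?in_itv/= ?t0//.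
      by rewrite ltNge quantile_le ?t0// -ltNge t1 => ->.
    move=> /andP[xt t1].
    have t0 : 0 < t by exact: le_lt_trans xt.
    split; last by rewrite t0.
    rewrite /Q patchE mem_set /= ?in_itv/= ?t0//.
    by rewrite ltNge quantile_le ?t0// -ltNge.
  rewrite lebesgue_measure_itv/= lte_fin; case: ltP => // F1'.
  by congr (_%:E); apply/eqP; rewrite eq_sym subr_eq0 eq_le F1'.
- move=> k; apply: le_lt_trans (_ : V setT < +oo)%E.
    by apply: le_measure; rewrite ?inE.
  by rewrite /V /pushm/= /pushforward/= preimage_setT U01_setT ltry.
Qed.

(** Bounded real sequences converge along an ultrafilter: a cluster point exists
    by compactness, and an ultrafilter decides each neighbourhood of it. *)
Lemma ultra_bounded_cvg (G : set_system nat) (u : nat -> R) (y : R) :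
  UltraFilter G -> G [set k | `|u k| <= y] -> exists l : R, u k @[k --> G] --> l.
Proof.
move=> GU Gy.
have yb : (u @ G) `[- y, y]%classic.
  by apply: filterS Gy => k uk; rewrite /= in_itv/= -ler_norml; exact: uk.
have [l [_ cl]] := @segment_compact R (- y) y (u @ G) _ yb.
exists l => B Bl; rewrite /= /fmap /=.
have [//|GnB] := in_ultra_setVsetC (u @^-1` B) GU.
by have [v []] := cl (~` B) B GnB Bl.
Qed.

(** Helly's selection theorem in terms of monotone functions. An ultrafilter provides a
    pointwise limit [X] at once; a subsequence is then needed only on the countably many
    rationals, and monotonicity transfers convergence from the rationals to the points of
    continuity of [X], that is, to all but countably many points. *)
Lemma monotone_selection (q : nat -> R -> R) :
  (forall k s t, 0 < s < 1 -> 0 < t < 1 -> s <= t -> q k s <= q k t) ->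
  (forall t, 0 < t < 1 -> exists y, \forall k \near \oo, `|q k t| <= y) ->
  exists (phi : nat -> nat) (X : R -> R) (N : set R),
    [/\ forall k, (k <= phi k)%N,
        forall s t, 0 < s < 1 -> 0 < t < 1 -> s <= t -> X s <= X t,
        countable N
      & forall t, 0 < t < 1 -> ~ N t -> q (phi k) t @[k --> \oo] --> X t].
Proof.
move=> q_nd q_bd.
have [G [GU ooG]] := ultraFilterLemma (eventually_filter : ProperFilter \oo).
have [X HX] : exists X : R -> R, forall t, 0 < t < 1 -> q k t @[k --> G] --> X t.
  have H t : exists l : R, 0 < t < 1 -> q k t @[k --> G] --> l.
    have [t01|] := boolP (0 < t < 1); last by exists 0.
    have [y /ooG Gy] := q_bd t t01.
    by have [l hl] := ultra_bounded_cvg GU Gy; exists l.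
  by exists (fun t => projT1 (cid (H t))) => t; apply: projT2 (cid (H t)).
have X_nd s t : 0 < s < 1 -> 0 < t < 1 -> s <= t -> X s <= X t.
  move=> s01 t01 st; apply: (ler_cvg_to (HX s s01) (HX t t01)).
  by apply: nearW => k; exact: q_nd.
(* [good k n] asks closeness at the first [k] rationals only, a finite intersection of sets of
   the ultrafilter. *)
pose good (k n : nat) := forall i, (i < k)%N -> forall r : rat, unpickle i = Some r ->
  0 < (ratr r : R) < 1 -> `|X (ratr r) - q n (ratr r)| < k.+1%:R^-1.
have Ggood k : G [set n | (k <= n)%N /\ good k n].
  apply: filterI; first by apply: ooG; exact: nbhs_infty_ge.
  have H j : G [set n | forall i, (i < j)%N -> forall r : rat, unpickle i = Some r ->
      0 < (ratr r : R) < 1 -> `|X (ratr r) - q n (ratr r)| < k.+1%:R^-1].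
    elim: j => [|j ih]; first by apply: filterS filterT.
    have [[r [er r01]]|none] := pselect (exists r : rat, unpickle j = Some r /\ 0 < (ratr r : R) < 1); last first.
      apply: filterS ih => n hn i; rewrite ltnS leq_eqVlt => /predU1P[->|/hn//] r er r01.
      by exfalso; apply: none; exists r.
    have h : G [set n | `|X (ratr r) - q n (ratr r)| < k.+1%:R^-1].
      by have /cvgrPdist_lt := HX (ratr r) r01; apply; rewrite invr_gt0.
    apply: filterS (filterI h ih).
    move=> n [h1 h2] i; rewrite ltnS leq_eqVlt => /predU1P[->|/h2//] r' er' _.
    by move: er'; rewrite er => -[<-].
  exact: H.
have [phi Hphi] : exists phi : nat -> nat, forall k, (k <= phi k)%N /\ good k (phi k).
  have H k : exists n, (k <= n)%N /\ good k n by exact: filter_ex (Ggood k).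
  by exists (fun k => projT1 (cid (H k))) => k; apply: projT2 (cid (H k)).
have Xrat (r : rat) : 0 < (ratr r : R) < 1 -> q (phi k) (ratr r) @[k --> \oo] --> X (ratr r).
  move=> r01; apply/cvgrPdist_lt => e e0.
  near=> k.
  have [_ /(_ (pickle r))] := Hphi k.
  move=> /(_ _ r (pickleK _) r01) h; apply: lt_trans (h _) _; first by near: k; exact: nbhs_infty_gt.
  by near: k; apply: (near_infty_natSinv_lt (PosNum e0)).
pose a_ n : R := n.+2%:R^-1.
(* Discontinuities are counted on compact subintervals of the open unit interval, on which
   [X] is monotone up to the endpoints. *)
pose N := \bigcup_n [set x | x \in (`](a_ n), (1 - a_ n)[) /\ discontinuity X x].
have a0 n : 0 < a_ n by rewrite invr_gt0.
have Nnd n : {in `[(a_ n), (1 - a_ n)] &, nondecreasing_fun X}.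
  move=> s t; rewrite !in_itv/= => /andP[s0 s1] /andP[t0 t1] st.
  apply: X_nd => //.
    by rewrite (lt_le_trans (a0 n) s0) (le_lt_trans s1)// gtrBl.
  by rewrite (lt_le_trans (a0 n) t0) (le_lt_trans t1)// gtrBl.
exists phi, X, N; split => //; first by move=> k; case: (Hphi k).
  by apply: bigcup_countable => // n _; exact: discontinuity_countable.
move=> t t01 Nt.
have [t0 t1] := andP t01.
have t1' : 0 < 1 - t by rewrite subr_gt0.
have [n /andP[nt tn]] : exists n, a_ n < t < 1 - a_ n.
  near \oo => n; exists n; rewrite ltrBrDr -ltrBrDl; apply/andP; split.
    rewrite /a_ (@lt_trans _ _ n.+1%:R^-1) ?ltf_pV2 ?posrE ?ltr_nat//.
    by near: n; apply: (near_infty_natSinv_lt (PosNum t0)).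
  rewrite /a_ (@lt_trans _ _ n.+1%:R^-1) ?ltf_pV2 ?posrE ?ltr_nat//.
  by near: n; apply: (near_infty_natSinv_lt (PosNum t1')).
have tI : t \in `](a_ n), (1 - a_ n)[ by rewrite in_itv/= nt.
have cl : cvg (X x @[x --> t^'-]).
  apply: nondecreasing_at_left_is_cvgr; near=> s.
    move=> x y; rewrite !in_itv/= => /andP[sx xt] /andP[sy yt].
    have s0 : 0 < s by near: s; exact: nbhs_left_gt.
    by apply: X_nd; rewrite (lt_trans s0)//= (lt_trans _ t1).
  exists (X t) => y [x /=]; rewrite in_itv/= => /andP[sx xt] <-.
  have s0 : 0 < s by near: s; exact: nbhs_left_gt.
  by apply: X_nd => //; [rewrite (lt_trans s0)//= (lt_trans _ t1)|exact: ltW].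
have cr : cvg (X x @[x --> t^'+]).
  apply: nondecreasing_at_right_is_cvgr; near=> s.
    move=> x y; rewrite !in_itv/= => /andP[tx xs] /andP[ty ys].
    have s1 : s < 1 by near: s; exact: nbhs_right_lt.
    by apply: X_nd; rewrite (lt_trans t0)//= (lt_trans _ s1).
  exists (X t) => y [x /=]; rewrite in_itv/= => /andP[tx xs] <-.
  have s1 : s < 1 by near: s; exact: nbhs_right_lt.
  by apply: X_nd => //; [rewrite (lt_trans t0)//= (lt_trans _ s1)|exact: ltW].
have elr : lim (X x @[x --> t^'-]) = lim (X x @[x --> t^'+]).
  apply/eqP/negP => /negP h; apply: Nt; exists n => //; split => //.
have lX : lim (X x @[x --> t^'-]) <= X t.
  apply: limr_le => //; near=> x; apply: X_nd => //.
  by apply/andP; split; [near: x; exact: nbhs_left_gt|rewrite (lt_trans _ t1)].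
have Xr : X t <= lim (X x @[x --> t^'+]).
  apply: limr_ge => //; near=> x; apply: X_nd => //.
  by apply/andP; split; [rewrite (lt_trans t0)|near: x; exact: nbhs_right_lt].
have El : lim (X x @[x --> t^'-]) = X t by apply/eqP; rewrite eq_le lX elr Xr.
have Er : lim (X x @[x --> t^'+]) = X t by rewrite -elr.
apply/cvgrPdist_le => e e0; have e2 : 0 < e / 2 by rewrite divr_gt0.
have [s [s0 st Xs]] : exists s, [/\ 0 < s, s < t & X t - X s <= e / 2].
  near t^'- => s; exists s; split; [by near: s; exact: nbhs_left_gt|by near: s; exact: nbhs_left_lt|].
  apply: le_trans (ler_norm _) _; near: s; rewrite -El.
  by move/cvgrPdist_le : cl; exact.
have [u [u1 tu Xu]] : exists u, [/\ u < 1, t < u & X u - X t <= e / 2].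
  near t^'+ => u; exists u; split; [by near: u; exact: nbhs_right_lt|by near: u; exact: nbhs_right_gt|].
  apply: le_trans (ler_norm _) _; rewrite distrC; near: u; rewrite -Er.
  by move/cvgrPdist_le : cr; exact.
have [r1 /[!in_itv]/= /andP[sr1 r1t]] := rat_in_itvoo st.
have [r2 /[!in_itv]/= /andP[tr2 r2u]] := rat_in_itvoo tu.
have r101 : 0 < (ratr r1 : R) < 1 by rewrite (lt_trans s0)//= (lt_trans r1t).
have r201 : 0 < (ratr r2 : R) < 1 by rewrite (lt_trans t0)//= (lt_trans r2u).
have Xs' : X s <= X (ratr r1) by apply: X_nd => //; [rewrite s0 (lt_trans st t1)|exact: ltW].
have Xu' : X (ratr r2) <= X u by apply: X_nd => //; [rewrite u1 (lt_trans t0 tu)|exact: ltW].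
near=> k.
have h1 : `|X (ratr r1) - q (phi k) (ratr r1)| <= e / 2.
  by near: k; move/cvgrPdist_le : (Xrat _ r101); exact.
have h2 : `|X (ratr r2) - q (phi k) (ratr r2)| <= e / 2.
  by near: k; move/cvgrPdist_le : (Xrat _ r201); exact.
have q1 : q (phi k) (ratr r1) <= q (phi k) t by apply: q_nd => //; exact: ltW.
have q2 : q (phi k) t <= q (phi k) (ratr r2) by apply: q_nd => //; exact: ltW.
move: h1 h2; rewrite !ler_distl => /andP[h1 h1'] /andP[h2 h2'].
apply/andP; split; lra.
Unshelve. all: by end_near. Qed.

End UnitInterval.

(** * Convergence of laws together with their moments *)

Section Truncation.
Context {R : realType}.

(** Truncation at height [M], used to reduce convergence of unbounded means to dominated
    convergence. *)
Definition clip (M x : R) : R := Num.max (- M) (Num.min x M).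

Lemma clip_le (M x : R) : 0 <= M -> `|clip M x| <= M.
Proof.
move=> M0; rewrite /clip ler_norml le_max lexx/= ge_max ge_min lexx orbT andbT.
by rewrite (le_trans _ M0)// oppr_le0.
Qed.

Lemma clip_err (M x : R) : 0 < M -> `|x - clip M x| <= x ^+ 2 / M.
Proof.
move=> M0; rewrite ler_pdivlMr// /clip.
have [xM|Mx] := leP x M.
  have [hx|hx] := leP (- M) x; first by rewrite subrr normr0 mul0r sqr_ge0.
  by rewrite opprK ler0_norm; nra.
have [hx|hx] := leP (- M) M; last lra.
by rewrite gtr0_norm ?subr_gt0//; nra.
Qed.

Lemma clip_continuous (M : R) (f : R -> R) : continuous f ->
  continuous (fun x => clip M (f x)).
Proof.
move=> cf x; rewrite /clip.
apply: (@continuous_max _ _ (fun=> - M) (fun x => Num.min (f x) M)); first exact: cvg_cst.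
by apply: (@continuous_min _ _ f (fun=> M)); [exact: cf|exact: cvg_cst].
Qed.

Lemma min_cst_continuous (M : R) (f : R -> R) : continuous f ->
  continuous (fun x => Num.min (f x) M).
Proof.
move=> cf x.
by apply: (@continuous_min _ _ f (fun=> M)); [exact: cf|exact: cvg_cst].
Qed.

Context d (T : measurableType d) (nu : {measure set T -> \bar R}).
Hypothesis nu1 : nu [set: T] = 1%E.

Lemma integrable_cst1 (c : R) : nu.-integrable [set: T] (fun=> c%:E).
Proof.
apply/integrableP; split; first exact: measurable_cst.
by rewrite integral_cst//= nu1 mule1 ltry.
Qed.

(** The truncation error of [g] at height [M] is pointwise at most [g ^ 2 / M]. *)
Lemma clip_mean_err (g v : T -> R) (D M : R) : measurable_fun [set: T] g ->
  measurable_fun [set: T] v ->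
  (forall x, g x ^+ 2 <= v x) -> (\int[nu]_x (v x)%:E <= D%:E)%E -> 0 < M ->
  nu.-integrable [set: T] (fun x => (g x)%:E) /\
  `|Rintegral nu [set: T] g - Rintegral nu [set: T] (fun x => clip M (g x))| <= D / M.
Proof.
move=> mg mv gv vD M0.
have v0 x : 0 <= v x by rewrite (le_trans _ (gv x))// sqr_ge0.
have iv : nu.-integrable [set: T] (fun x => (v x)%:E).
  apply/integrableP; split; first exact/measurable_EFinP.
  under eq_integral do rewrite gee0_abs ?lee_fin//.
  exact: le_lt_trans vD (ltry _).
have ig : nu.-integrable [set: T] (fun x => (g x)%:E).
  apply: (@le_integrableR _ _ _ nu _ (fun x => 1 + v x)) => //.
    by move=> x; have := gv x; rewrite ler_norml => ?; apply/andP; split; nra.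
  by apply: integrableRD => //; exact: integrable_cst1.
have mc : measurable_fun [set: T] (fun x => clip M (g x)).
  by apply: measurable_maxr => //; apply: measurable_minr.
have ic : nu.-integrable [set: T] (fun x => (clip M (g x))%:E).
  apply: (@le_integrableR _ _ _ nu _ (fun x => M)) => //; last exact: integrable_cst1.
  by move=> x; apply: clip_le; exact: ltW.
split => //; rewrite -RintegralB//.
have idf : nu.-integrable [set: T] (fun x => (g x - clip M (g x))%:E).
  by under eq_fun do rewrite EFinB; exact: integrableB.
apply: le_trans (le_normr_Rintegral _ idf) _ => //.
have iM : nu.-integrable [set: T] (fun x => (M^-1 * v x)%:E) by exact: integrableRZ.
apply: (@le_trans _ _ (Rintegral nu setT (fun x => M^-1 * v x))).
  apply: le_Rintegral => //; first exact: integrable_norm.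
  move=> x _; apply: le_trans (clip_err _ M0) _.
  by rewrite mulrC ler_wpM2l// invr_ge0 ltW.
rewrite RintegralZl// mulrC ler_wpM2r//; first by rewrite invr_ge0 ltW.
rewrite -lee_fin; apply: le_trans vD.
by rewrite /Rintegral fineK//; exact: integrable_fin_num.
Qed.

End Truncation.

Section Helly.
Context {R : realType}.
Local Notation RT := (measurableTypeR R).
Local Notation leb := (@lebesgue_measure R).

Definition unif01 : {measure set RT -> \bar R} := mrestr leb (measurable_itv `]0, 1[).

Lemma unif01T : unif01 [set: RT] = 1%E. Proof. exact: U01_setT. Qed.

Lemma unif01_ae (N : set R) (P : R -> Prop) : countable N ->
  (forall t, 0 < t < 1 -> ~ N t -> P t) -> {ae unif01, forall t, P t}.
Proof.
move=> cN HP.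
have mN : measurable (N : set RT) by apply: countable_measurable => // t; exact: measurable_set1.
have mD : measurable (`]0, 1[%classic : set RT) by exact: measurable_itv.
exists ((N : set RT) `|` ~` (`]0, 1[%classic : set RT)); split.
- by apply: measurableU => //; exact: measurableC.
- apply: (@subset_measure0 _ _ _ leb _ N) => //.
  + by apply: measurableI => //; apply: measurableU => //; exact: measurableC.
  + by move=> t /= [[//|h] h'].
  + exact: countable_lebesgue_measure0.
- move=> t /= nP; apply: contrapT => /not_orP[nN /contrapT].
  by rewrite /= in_itv/= => t01; apply: nP; exact: HP.
Qed.

(** The tightness used for selection: Chebyshev bounds every quantile by the
    second moment, uniformly in the law. *)
Lemma quantile_bound (B t : R) : 0 < t < 1 -> exists y : R,
  forall P : probability RT R, (\int[P]_x (x ^+ 2)%:E <= B%:E)%E ->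
  `|quantile P t| <= y.
Proof.
move=> /andP[t0 t1].
pose y : R := 1 + `|B| / t + `|B| / (1 - t).
have s0 : 0 < 1 - t by rewrite subr_gt0.
have y1 : 1 <= y by rewrite /y -addrA lerDl addr_ge0// divr_ge0// ltW.
have y0 : 0 < y by exact: lt_le_trans y1.
have By : B < t * y ^+ 2 /\ B < (1 - t) * y ^+ 2.
  have h1 : `|B| < t * y.
    rewrite mulrC -ltr_pdivrMr// /y addrAC ltrDr ltr_pwDl//.
    by rewrite divr_ge0// ltW.
  have h2 : `|B| < (1 - t) * y.
    rewrite mulrC -ltr_pdivrMr// /y ltrDr ltr_pwDl//.
    by rewrite divr_ge0// ltW.
  have yy : y <= y ^+ 2 by rewrite expr2 ler_peMr// ltW.
  split.
    by rewrite (le_lt_trans (ler_norm _))// (lt_le_trans h1)// ler_pM2l.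
  by rewrite (le_lt_trans (ler_norm _))// (lt_le_trans h2)// ler_pM2l.
exists y => P PB.
have y20 : 0 < y ^+ 2 by rewrite exprn_gt0.
have ysq (x : R) : (y ^+ 2 <= x ^+ 2) = (y <= `|x|).
  by rewrite -(real_normK (num_real x)) ler_pXn2r ?nnegrE// ltW.
have cheb : ((y ^+ 2)%:E * P [set x | (y <= `|x|)%R] <= B%:E)%E.
  have mf : measurable_fun [set: RT] (fun x : RT => ((x : R) ^+ 2)%:E).
    by apply/measurable_EFinP; apply: measurable_funX.
  have := @le_integral_abse _ RT R P setT measurableT _ (y ^+ 2) mf y20.
  rewrite setTI (_ : [set x | _] = [set x | (y <= `|x|)%R]); last first.
    by apply/seteqP; split => x /=; rewrite lee_fin (ger0_norm (sqr_ge0 _)) ysq.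
  move=> /le_trans; apply; apply: le_trans PB.
  by under eq_integral do rewrite gee0_abs ?lee_fin ?sqr_ge0//.
have mA : measurable ([set x | (y <= `|x|)%R] : set RT).
  rewrite (_ : [set x | _] = `]-oo, (- y)]%classic `|` `[y, +oo[%classic).
    by apply: measurableU; exact: measurable_itv.
  apply/seteqP; split => x /=; rewrite !in_itv/= andbT ler_normr lerNr.
    by move=> /orP[->|->]; [right|left].
  by move=> [->|->]; rewrite ?orbT.
have PA (A : set RT) : measurable A -> A `<=` [set x | (y <= `|x|)%R] ->
    forall s, B < s * y ^+ 2 -> (P A < s%:E)%E.
  move=> mA' AA s Bs; have Afin := fin_num_measure P _ mA'.
  rewrite -[P A]fineK// lte_fin -(ltr_pM2r y20); apply: le_lt_trans Bs.
  rewrite -lee_fin EFinM fineK// muleC; apply: le_trans cheb.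
  by rewrite lee_pmul2l// ?lte_fin// le_measure// inE.
rewrite ler_norml; apply/andP; split.
  rewrite leNgt; apply/negP => /ltW; rewrite quantile_le ?t0//.
  apply/negP; rewrite -ltNge -lte_fin dfunE; apply: PA; [exact: measurable_itv| |exact: (proj1 By)].
  by move=> x /=; rewrite in_itv/= ler_normr lerNr => ->; rewrite orbT.
rewrite quantile_le ?t0// -lee_fin dfunE.
have -> : (t%:E = 1 - (1 - t)%:E)%E by rewrite -EFinB; congr (_%:E); lra.
have h : (P `]y, +oo[%classic < (1 - t)%:E)%E.
  apply: PA; [exact: measurable_itv| |exact: (proj2 By)].
  by move=> x /=; rewrite in_itv/= andbT ler_normr => /ltW ->.
have -> : (P `]-oo, y]%classic = 1 - P `]y, +oo[%classic)%E.
  rewrite -(probability_setT P) -[`]-oo, y]%classic]setCitvr -setTD measureD ?setTI//.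
  by rewrite (le_lt_trans (probability_le1 P measurableT)) ?ltry.
by rewrite leeB// ltW.
Qed.

Definition stretch (f : R -> R) : RT -> RT := f \_ `]0, 1[.

Lemma stretchE (f : R -> R) t : 0 < t < 1 -> stretch f t = f t.
Proof. by move=> t01; rewrite /stretch patchE mem_set//= in_itv/= t01. Qed.

Lemma quantile_integral (P : probability RT R) (f : RT -> \bar R) :
  measurable_fun [set: RT] f -> (forall x, 0 <= f x)%E ->
  (\int[unif01]_t f (stretch (quantile P) t) = \int[P]_x f x)%E.
Proof.
move=> mf f0.
have mq : measurable_fun [set: RT] (stretch (quantile P)).
  exact: (mono01_measurable (@quantile_nd R P)).
rewrite -[RHS](@eq_measure_integral _ RT R setT P (pushm unif01 mq)); last first.
  by move=> A mA _; exact: quantile_law.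
by rewrite ge0_integral_pushforward.
Qed.

Lemma quantile_Rintegral (P : probability RT R) (f : RT -> R) :
  measurable_fun [set: RT] f ->
  unif01.-integrable [set: RT] (fun t => (f (stretch (quantile P) t))%:E) ->
  Rintegral unif01 [set: RT] (fun t => f (stretch (quantile P) t)) =
  Rintegral P [set: RT] f.
Proof.
move=> mf int_f.
have mq : measurable_fun [set: RT] (stretch (quantile P)).
  exact: (mono01_measurable (@quantile_nd R P)).
rewrite /Rintegral.
rewrite -[in RHS](@eq_measure_integral _ RT R setT P (pushm unif01 mq)); last first.
  by move=> A mA _; exact: quantile_law.
by rewrite integral_pushforward//; exact/measurable_EFinP.
Qed.

(** Helly selection with convergence of all moments: quantile functions turn the
    laws into functions on one probability space, where selection is pointwise
    and dominated convergence applies; the moment bounds control the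
    truncation error. *)
Theorem helly_moments (mu : nat -> probability RT R) (B : nat -> R) :
  (forall l, \forall k \near \oo, (\int[mu k]_x (x ^+ (2 * l))%:E <= (B l)%:E)%E) ->
  exists (phi : nat -> nat) (rho : {measure set RT -> \bar R}),
    (forall k, (k <= phi k)%N) /\
    forall f : R -> R, continuous f -> forall (C : R) (l : nat),
      (forall x, `|f x| <= C * (1 + x ^+ (2 * l))) ->
      rho.-integrable [set: RT] (fun x => (f x)%:E) /\
      Rintegral (mu (phi k)) [set: RT] f @[k --> \oo] --> Rintegral rho [set: RT] f.
Proof.
move=> Bmu.
have pow_ge0 (x : R) l : 0 <= x ^+ (2 * l) by rewrite exprM exprn_ge0// sqr_ge0.
have tight t : 0 < t < 1 -> exists y, \forall k \near \oo, `|quantile (mu k) t| <= y.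
  move=> t01; have [y hy] := quantile_bound (B 1%N) t01; exists y.
  by apply: filterS (Bmu 1%N) => k hk; apply: hy; move: hk; rewrite muln1.
have [phi [X [N [phik X_nd cN cvX]]]] := @monotone_selection R (fun k => quantile (mu k))
  (fun k => @quantile_nd R (mu k)) tight.
have phioo l : \forall k \near \oo,
    (\int[mu (phi k)]_x (x ^+ (2 * l))%:E <= (B l)%:E)%E.
  have [n _ hn] := Bmu l; exists n => // k /= nk; apply: hn => /=.
  exact: leq_trans nk (phik k).
pose Q k := stretch (quantile (mu (phi k))).
pose Y := stretch X.
have mQ k : measurable_fun [set: RT] (Q k).
  exact: (mono01_measurable (@quantile_nd R _)).
have mY : measurable_fun [set: RT] Y by exact: (mono01_measurable X_nd).
have QY (f : R -> R) : continuous f ->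
    {ae unif01, forall t, [set: RT] t -> (f (Q k t))%:E @[k --> \oo] --> (f (Y t))%:E}.
  move=> cf; apply: (unif01_ae cN) => t t01 nN _.
  apply: cvg_EFin; first exact: nearW.
  apply: (@cvg_comp _ _ _ (fun k => Q k t) f _ (nbhs (Y t))); last exact: cf.
  rewrite /Q /Y; under eq_fun do rewrite stretchE//.
  by rewrite stretchE//; exact: cvX.
have mc (f : R -> R) : continuous f -> measurable_fun [set: RT] (f : RT -> RT).
  by move=> cf; exact: continuous_measurable_fun.
have bdd (f : R -> R) (M : R) : continuous f -> (forall x, `|f x| <= M) ->
    Rintegral unif01 setT (fun t => f (Q k t)) @[k --> \oo] -->
    Rintegral unif01 setT (fun t => f (Y t)).
  move=> cf fM.
  have H1 k : measurable_fun [set: RT] (fun t => (f (Q k t))%:E).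
    by apply/measurable_EFinP; apply: (measurableT_comp (mc f cf)).
  have H2 : measurable_fun [set: RT] (fun t => (f (Y t))%:E).
    by apply/measurable_EFinP; apply: (measurableT_comp (mc f cf)).
  have H5 : {ae unif01, forall t k, [set: RT] t -> (`|(f (Q k t))%:E| <= M%:E)%E}.
    by apply: aeW => t k _; rewrite abse_EFin lee_fin.
  have [iY _ h] := dominated_convergence measurableT H1 H2 (QY f cf)
    (integrable_cst1 unif01T M) H5.
  apply: fine_cvg; rewrite fineK//; exact: integrable_fin_num iY.
(* Fatou for the limit, through the truncations [Num.min (Y ^ 2l) n]. *)
have momY l : (\int[unif01]_t (Y t ^+ (2 * l))%:E <= (B l)%:E)%E.
  have cpow : continuous (fun x : R => x ^+ (2 * l)) by exact: exprn_continuous.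
  have h M : 0 <= M -> (\int[unif01]_t (Num.min (Y t ^+ (2 * l)) M)%:E <= (B l)%:E)%E.
    move=> M0.
    have cm := @min_cst_continuous R M _ cpow.
    have bm x : `|Num.min (x ^+ (2 * l)) M| <= M.
      by rewrite ger0_norm ?ge_min ?lexx ?orbT// le_min pow_ge0.
    have im (Z : RT -> RT) : measurable_fun [set: RT] Z ->
        unif01.-integrable setT (fun t => (Num.min (Z t ^+ (2 * l)) M)%:E).
      move=> mZ; apply: (@le_integrableR _ _ _ unif01 _ (fun=> M)) => //.
        exact: (measurableT_comp (mc _ cm) mZ).
      exact: integrable_cst1 unif01T M.
    rewrite -[leLHS]fineK; last by apply: integrable_fin_num => //; exact: (im _ mY).
    rewrite lee_fin; apply: (cvgr_to_le (bdd _ _ cm bm)).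
    apply: filterS (phioo l) => k; rewrite -lee_fin /Rintegral fineK; last first.
      by apply: integrable_fin_num => //; exact: (im _ (mQ k)).
    apply: le_trans; rewrite -quantile_integral; last 2 first.
      by apply/measurable_EFinP; exact: mc.
      by move=> x; rewrite lee_fin.
    apply: ge0_le_integral => //.
    - by move=> t _; rewrite lee_fin le_min pow_ge0.
    - exact: (measurable_int unif01 (im _ (mQ k))).
    - by apply/measurable_EFinP; apply: (measurableT_comp (mc _ cpow) (mQ k)).
    - by move=> t _; rewrite lee_fin ge_min lexx.
  pose g n (t : RT) : \bar R := (Num.min (Y t ^+ (2 * l)) n%:R)%:E.
  have mg n : measurable_fun [set: RT] (g n).
    apply/measurable_EFinP.
    exact: (measurableT_comp (mc _ (@min_cst_continuous R n%:R _ cpow)) mY).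
  have g0 n t : [set: RT] t -> (0 <= g n t)%E by move=> _; rewrite lee_fin le_min pow_ge0/=.
  have gnd t : [set: RT] t -> {homo g^~ t : n m / (n <= m)%N >-> (n <= m)%E}.
    by move=> _ n m nm; rewrite lee_fin le_min !ge_min lexx/= ler_nat nm orbT.
  have := @cvg_monotone_convergence _ RT R unif01 setT measurableT g mg g0 gnd.
  have -> : (\int[unif01]_t limn (g^~ t) = \int[unif01]_t (Y t ^+ (2 * l))%:E)%E.
    apply: eq_integral => t _; apply/cvg_lim => //; apply: cvg_near_cst.
    near=> n; rewrite /g min_l//; near: n; exact: nbhs_infty_ger.
  move=> cvg_g; rewrite -(cvg_lim _ cvg_g)//; apply: lime_le; first by apply/cvg_ex; eexists; exact: cvg_g.
  by apply: nearW => n; exact: h.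
exists phi, (pushm unif01 mY); split => // f cf C l fC.
(* [v] dominates [f ^ 2], so that [D] bounds the second moment of [f] along the sequence and
   in the limit, as the truncation lemma requires. *)
pose K : R := 2 * C ^+ 2; pose D : R := K * (1 + B (2 * l)%N).
have C0 : 0 <= C.
  have := fC 0; have := pow_ge0 0 l; set p := 0 ^+ _ => p0.
  move=> /(le_trans (normr_ge0 _)); rewrite pmulr_lge0//; lra.
have K0 : 0 <= K by rewrite mulr_ge0// sqr_ge0.
pose v (x : R) : R := K * (1 + x ^+ (2 * (2 * l))).
have fv x : f x ^+ 2 <= v x.
  have /ler_normlP[h1 h2] := fC x; have p0 := pow_ge0 x l.
  rewrite /v /K (mulnC 2 (2 * l)%N) exprM; set p := x ^+ (2 * l) in h1 h2 p0 *.
  have : f x ^+ 2 <= (C * (1 + p)) ^+ 2 by nra.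
  move=> /le_trans; apply.
  by have := mulr_ge0 (sqr_ge0 C) (sqr_ge0 (1 - p)); lra.
have cv : continuous v.
  move=> x; apply: cvgM; first exact: cvg_cst.
  by apply: cvgD; [exact: cvg_cst|exact: exprn_continuous].
have intv (Z : RT -> RT) : measurable_fun [set: RT] Z ->
    (\int[unif01]_t (Z t ^+ (2 * (2 * l)))%:E <= (B (2 * l)%N)%:E)%E ->
    (\int[unif01]_t (v (Z t))%:E <= D%:E)%E.
  move=> mZ hZ; have mp : measurable_fun [set: RT] (fun t => (Z t ^+ (2 * (2 * l)))%:E).
    by apply/measurable_EFinP; exact: (measurableT_comp (mc _ (@exprn_continuous _ _)) mZ).
  rewrite /v; under eq_integral do rewrite (EFinM K).
  rewrite ge0_integralZl_EFin//; last 2 first.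
  - by move=> t _; rewrite lee_fin addr_ge0.
  - under eq_fun do rewrite EFinD.
    by apply: emeasurable_funD => //; exact: measurable_cst.
  rewrite /D (EFinM K) lee_wpmul2l ?lee_fin//.
  under eq_integral do rewrite EFinD.
  rewrite ge0_integralD//; last by move=> t _; rewrite lee_fin.
  by rewrite integral_cst// unif01T mule1 EFinD leeD2l.
have errQ M : 0 < M -> \forall k \near \oo,
    unif01.-integrable [set: RT] (fun t => (f (Q k t))%:E) /\
    `|Rintegral unif01 setT (fun t => f (Q k t)) -
      Rintegral unif01 setT (fun t => clip M (f (Q k t)))| <= D / M.
  move=> M0; apply: filterS (phioo (2 * l)%N) => k hk.
  apply: (clip_mean_err unif01T (v := fun t => v (Q k t))) => //.
  - exact: (measurableT_comp (mc _ cf) (mQ k)).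
  - exact: (measurableT_comp (mc _ cv) (mQ k)).
  - apply: intv => //; apply: le_trans hk.
    rewrite -quantile_integral//; last by move=> x; rewrite lee_fin.
    by apply/measurable_EFinP; apply: mc; exact: exprn_continuous.
have errY M : 0 < M ->
    unif01.-integrable [set: RT] (fun t => (f (Y t))%:E) /\
    `|Rintegral unif01 setT (fun t => f (Y t)) -
      Rintegral unif01 setT (fun t => clip M (f (Y t)))| <= D / M.
  move=> M0; apply: (clip_mean_err unif01T (v := fun t => v (Y t))) => //.
  - exact: (measurableT_comp (mc _ cf) mY).
  - exact: (measurableT_comp (mc _ cv) mY).
  - exact: intv.
have mEf : measurable_fun [set: RT] (fun x : RT => (f x)%:E).
  by apply/measurable_EFinP; exact: mc.
have intY := proj1 (errY _ ltr01).
split; first exact: integrable_pushforward.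
rewrite /Rintegral integral_pushforward// -/(Rintegral _ _ (fun t => f (Y t))).
apply/cvgrPdist_le => e e0.
have D0 : 0 <= D.
  rewrite -lee_fin; apply: le_trans (intv _ mY (momY _)).
  by apply: integral_ge0 => t _; rewrite lee_fin (le_trans _ (fv _))// sqr_ge0.
(* A height at which both truncation errors [D / M] are below [e / 3]. *)
pose M := (D + 1) / (e / 3).
have e3 : 0 < e / 3 by rewrite divr_gt0.
have M0 : 0 < M by rewrite divr_gt0// ltr_wpDl.
have DM : D / M <= e / 3.
  rewrite ler_pdivrMr// /M mulrC divfK ?gt_eqF//; lra.
have clipM := bdd _ M (@clip_continuous R M f cf) (fun x => clip_le (f x) (ltW M0)).
near=> k.
have [iQ eQ] : unif01.-integrable [set: RT] (fun t => (f (Q k t))%:E) /\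
    `|Rintegral unif01 setT (fun t => f (Q k t)) -
      Rintegral unif01 setT (fun t => clip M (f (Q k t)))| <= D / M.
  by near: k; exact: errQ.
have -> : fine (\int[mu (phi k)]_x (f x)%:E)%E =
    Rintegral unif01 setT (fun t => f (Q k t)).
  by rewrite quantile_Rintegral//; exact: mc.
have eC : `|Rintegral unif01 setT (fun t => clip M (f (Y t))) -
    Rintegral unif01 setT (fun t => clip M (f (Q k t)))| <= e / 3.
  by near: k; move/cvgrPdist_le : clipM; exact.
have [_ eY] := errY M M0.
move: eQ eC eY DM; rewrite !ler_distl; set a := D / M.
move=> /andP[? ?] /andP[? ?] /andP[? ?] ?; apply/andP; split; lra.
Unshelve. all: by end_near. Qed.

End Helly.

(** * Gauss quadrature *)

(** Parseval for the rows of a unitary matrix, with unitarity stated entrywise. *)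
Lemma parseval_rows (R : realType) N (u : 'I_N -> 'I_N -> R[i]) (x : 'I_N -> R[i]) :
  (forall i j, \sum_k u i k * (u j k)^* = (i == j)%:R) ->
  \sum_k sqn (\sum_j x j * (u j k)^*) = \sum_j sqn (x j).
Proof.
move=> uu; apply: complexI; rewrite !rmorph_sum/=.
transitivity (\sum_k \sum_j \sum_i (x j * (x i)^*) * (u i k * (u j k)^*)).
  apply: eq_bigr => k _; rewrite -mul_conj rmorph_sum/= big_distrlr/=.
  apply: eq_bigr => j _; apply: eq_bigr => i _.
  by rewrite conjM conjCK; ring.
rewrite exchange_big/=; apply: eq_bigr => j _.
rewrite exchange_big/= (bigD1 j)//= [X in _ + X]big1 ?addr0 => [|i ij].
  by rewrite -big_distrr/= uu eqxx mulr1 mul_conj.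
by rewrite -big_distrr/= uu (negbTE ij) mulr0.
Qed.

Section Quadrature.
Variable R : realType.
Local Notation C := R[i].
Variables (p : nat -> {poly C}) (c : nat -> C) (d : nat -> R).
Hypothesis p0 : p 0%N = 1.
Hypothesis c0 : forall n, c n != 0.
Hypothesis rec : forall n, 'X * p n =
  (shift_prev c n)^* *: shift_prev p n + (d n)%:C *: p n + c n *: p n.+1.

Lemma rec_horner n (z : C) : z * (p n).[z] =
  (shift_prev c n)^* * (shift_prev p n).[z] + (d n)%:C * (p n).[z] + c n * (p n.+1).[z].
Proof. by have := congr1 (horner ^~ z) (rec n); rewrite !hornerE. Qed.

(** A solution of the recurrence is determined by its value at index zero, because the
    [c n] do not vanish. Hence left eigenvectors of the Jacobi matrix are multiples of
    [(p 0, p 1, ...)] evaluated at the eigenvalue. *)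
Lemma rec_unique (u : nat -> C) (x : C) n :
  (forall k, (k < n)%N -> x * u k =
     (shift_prev c k)^* * shift_prev u k + (d k)%:C * u k + c k * u k.+1) ->
  forall k, (k <= n)%N -> u k = u 0%N * (p k).[x].
Proof.
move=> hu k; elim/ltn_ind: k => -[_ _|k ih kn]; first by rewrite p0 hornerE mulr1.
have := hu k kn; have := rec_horner k x.
have uk : u k = u 0%N * (p k).[x] by apply: ih => //; exact: ltnW.
have upk : shift_prev u k = u 0%N * (shift_prev p k).[x].
  case: k ih kn uk => [|k] ih kn uk /=; first by rewrite horner0 mulr0.
  by apply: ih; [exact: ltnW|exact: ltnW (ltnW kn)].
rewrite upk uk => e1 e2.
apply: (mulfI (c0 k)); move: e2; rewrite mulrCA e1 => e2.
apply: (addrI ((shift_prev c k)^* * (u 0%N * (shift_prev p k).[x]) + (d k)%:C * (u 0%N * (p k).[x]))).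
by rewrite -e2; ring.
Qed.

(** Nodes [lam] and weights [m] of a Gauss formula of order [n]: the matrix
    [sqrt (m j) p_k (lam j)] is unitary, which is spelled as orthonormality of its columns
    together with Parseval's identity. *)
Definition quadrature n (lam m : 'I_n.+1 -> R) :=
  [/\ forall j, 0 <= m j,
      forall k l : nat, (k <= n)%N -> (l <= n)%N ->
        \sum_j (m j)%:C * ((p k).[(lam j)%:C] * ((p l).[(lam j)%:C])^*) = (k == l)%:R
    & forall f : 'I_n.+1 -> C, \sum_j m j * sqn (f j) =
        \sum_(k < n.+1) sqn (\sum_j (m j)%:C * (f j * ((p k).[(lam j)%:C])^*))].

Let J n (tau : R) (k l : nat) : C :=
  (c k)^* * (k.+1 == l)%:R + ((d l)%:C + tau%:C * (l == n)%:R) * (k == l)%:R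
  + c l * (k == l.+1)%:R.

Let sum_delta n (f : nat -> C) m :
  \sum_(k < n.+1) f k * (k == m :> nat)%:R = if (m <= n)%N then f m else 0.
Proof.
case: leqP => mn; last first.
  by rewrite big1// => k _; rewrite ltn_eqF ?mulr0// (leq_ltn_trans _ mn)// -ltnS.
rewrite (bigD1 (Ordinal (mn : (m < n.+1)%N)))//= eqxx mulr1 big1 ?addr0// => k.
by rewrite -val_eqE/= => /negbTE ->; rewrite mulr0.
Qed.

(** The Jacobi matrix of order [n.+1], with its last diagonal entry shifted by [tau], is
    Hermitian. In an orthonormal basis of eigenvectors [u j], the entry [u j k] equals
    [u j 0 * p_k (lam j)], so the squared moduli of the [u j 0] are the weights. The last equation of
    the eigenvalue problem gives the stated condition on the nodes. *)
Lemma quadrature_exists n (tau : R) : exists lam m : 'I_n.+1 -> R,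
  quadrature lam m /\
  forall j, c n * (p n.+1).[(lam j)%:C] = tau%:C * (p n).[(lam j)%:C].
Proof.
pose A : 'M[C]_n.+1 := \matrix_(k, l) J n tau k l.
have Aherm : A \is hermsymmx.
  apply/is_hermitianmxP; rewrite expr0 scale1r; apply/matrixP => k l; rewrite !mxE /J.
  rewrite !rmorphD/= !rmorphM/= !rmorph_nat conjCK.
  rewrite (eq_sym (k : nat) (l.+1)) (eq_sym (l : nat) k.+1).
  have [kl|kl] := eqVneq (k : nat) (l : nat).
    rewrite kl /= !(gtn_eqF (ltnSn _)) !mulr0 !mulr1 !add0r !addr0 rmorphD/= rmorphM/=.
    by rewrite !rmorph_nat !conjE !conjc_real.
  by rewrite !mulr0 !addr0 addrC.
have [U [D [Uun UA Dreal]]] : exists (U : 'M[C]_n.+1) (D : 'rV[C]_n.+1),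
    [/\ U \is unitarymx, U *m A = diag_mx D *m U &
        forall j, D 0 j = (complex.Re (D 0 j))%:C].
  exists (spectralmx A), (spectral_diag A); split.
  - exact: spectral_unitarymx.
  - have /orthomx_spectralP := hermitian_normalmx Aherm.
    move: (spectralmx A) (spectral_diag A) (spectral_unit A) => V E Vu HA.
    by rewrite HA !mulmxA mulmxV ?mul1mx.
  - move=> j; have /mxOverP/(_ 0 j) := hermitian_spectral_diag_real Aherm.
    by move=> /RRe_real.
(* The eigenvectors are extended by zero to all indices, so that the last row of the
   eigenvalue equation has the form of the recurrence. *)
have [u [Uu u_out]] : exists u : 'I_n.+1 -> nat -> C,
    (forall j (k : 'I_n.+1), U j k = u j k) /\ forall j, u j n.+1 = 0.
  exists (fun j k => if (k < n.+1)%N then U j (inord k) else 0); split.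
    by move=> j k; rewrite ltn_ord inord_val.
  by move=> j; rewrite ltnn.
have eqn j l : (l <= n)%N -> D 0 j * u j l =
    (shift_prev c l)^* * shift_prev (u j) l + (d l)%:C * u j l + c l * u j l.+1
    + tau%:C * (l == n)%:R * u j l.
  move=> ln; have := congr1 (fun M : 'M[C]_(n.+1) => M j (inord l)) UA.
  rewrite mul_diag_mx !mxE -/(D 0 j) Uu inordK// => <-.
  under eq_bigr do rewrite mxE Uu inordK// /J !mulrDr !mulrA.
  rewrite !big_split/= (sum_delta n (fun k => u j k * _)) ln.
  rewrite (sum_delta n (fun k => u j k * c l)).
  have -> : \sum_(k < n.+1) u j k * (c k)^* * (k.+1 == l)%:R =
      (shift_prev c l)^* * shift_prev (u j) l.
    case: l ln => [|l] ln /=; first by rewrite mulr0 big1// => k _; rewrite mulr0.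
    under eq_bigr do rewrite eqSS.
    by rewrite (sum_delta n (fun k => u j k * (c k)^*)) ltnW// mulrC.
  have -> : (if (l < n)%N then u j l.+1 * c l else 0) = c l * u j l.+1.
    rewrite mulrC; case: ltnP => // nl; have -> : l = n by apply/eqP; rewrite eqn_leq ln.
    by rewrite u_out mulr0.
  ring.
have u_p j k : (k <= n)%N -> u j k = u j 0%N * (p k).[D 0 j].
  apply: rec_unique => {}k kn.
  by rewrite eqn ?(ltnW kn)// (ltn_eqF kn) mulr0 mul0r addr0.
have UU1 i j : \sum_(k < n.+1) u i k * (u j k)^* = (i == j)%:R.
  have /unitarymxP/matrixP/(_ i j) := Uun; rewrite !mxE => <-.
  by apply: eq_bigr => k _; rewrite !mxE !Uu.
have UU2 k l : (k <= n)%N -> (l <= n)%N -> \sum_(j < n.+1) (u j k)^* * u j l = (k == l)%:R.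
  move=> kn ln; have H := mulmx1C (unitarymxP Uun).
  have := congr1 (fun M : 'M[C]_(n.+1) =>
    M (Ordinal (kn : (k < n.+1)%N)) (Ordinal (ln : (l < n.+1)%N))) H.
  rewrite !mxE -val_eqE /= => <-; apply: eq_bigr => j _; rewrite !mxE.
  by rewrite (Uu j (Ordinal (kn : (k < n.+1)%N))) (Uu j (Ordinal (ln : (l < n.+1)%N))).
(* A zero first entry would annihilate the whole eigenvector. *)
have u0 j : u j 0%N != 0.
  apply/negP => /eqP uj0; have := UU1 j j.
  have uj k : (k < n.+1)%N -> u j k = 0 by move=> kn; rewrite (u_p j k)// uj0 mul0r.
  rewrite big1 => [e|k _]; last by rewrite (uj k (ltn_ord k)) mul0r.
  by have := oner_neq0 C; rewrite -[1]/(true%:R) -(eqxx j) -e eqxx.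
exists (fun j => complex.Re (D 0 j)), (fun j => sqn (u j 0%N)).
have mE j : (sqn (u j 0%N))%:C = u j 0%N * (u j 0%N)^* by rewrite mul_conj.
split; last first.
  move=> j; rewrite -Dreal; have := eqn j n (leqnn n).
  rewrite u_out.
  have -> : shift_prev (u j) n = u j 0%N * (shift_prev p n).[D 0 j].
    have sp k : (k <= n)%N -> shift_prev (u j) k = u j 0%N * (shift_prev p k).[D 0 j].
      by case: k => [|k] kn /=; [rewrite horner0 mulr0|exact: u_p (ltnW kn)].
    exact: sp.
  rewrite eqxx mulr0 addr0 mulr1 (u_p j n)// => e.
  have := rec_horner n (D 0 j) => e'.
  apply: (mulfI (u0 j)); move: e; rewrite mulrCA e' => e.
  apply: (addrI (u j 0%N * ((shift_prev c n)^* * (shift_prev p n).[D 0 j] + (d n)%:C * (p n).[D 0 j]))).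
  rewrite -mulrDr e; ring.
split.
- by move=> j; exact: sqn_ge0.
- move=> k l kn ln; rewrite eq_sym -UU2//; apply: eq_bigr => j _.
  rewrite mE -Dreal (u_p j k)// (u_p j l)// conjM; ring.
- move=> f.
  pose x j := u j 0%N * f j.
  have aE (k : 'I_n.+1) : \sum_j (sqn (u j 0%N))%:C * (f j * ((p k).[(complex.Re (D 0 j))%:C])^*)
      = \sum_j x j * (u j k)^*.
    apply: eq_bigr => j _; rewrite mE -Dreal (u_p j k (leq_ord k)) conjM /x; ring.
  under [RHS]eq_bigr => k _ do rewrite aE.
  rewrite (parseval_rows (u := fun i k => u i k))//.
  by apply: eq_bigr => j _; rewrite /x sqnM.
Qed.

Local Notation RT := (measurableTypeR R).

Definition evR (q : {poly C}) (t : RT) : C := q.[(t : R)%:C].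

(** A Gauss quadrature of order [n] seen as a law on the line: all functions are square
    integrable, the first [n.+1] polynomials are an orthonormal basis, and the next one
    satisfies [c n * p n.+1 = tau * p n] at the nodes, which is the last clause. *)
Definition gauss n (tau : R) (P : probability RT R) :=
  [/\ forall f, cmeas f -> L2 P f,
      forall k l, (k <= n)%N -> (l <= n)%N -> ip P (evR (p k)) (evR (p l)) = (k == l)%:R,
      forall f, cmeas f -> norm2 P f = \sum_(k < n.+1) sqn (ip P f (evR (p k)))
    & forall f, cmeas f ->
        (c n)^* * ip P f (evR (p n.+1)) = tau%:C * ip P f (evR (p n))].

Section DiscreteLaw.
Variables (n : nat) (lam m : 'I_n.+1 -> R).
Hypothesis m_ge0 : forall j, 0 <= m j.
Hypothesis m_sum : \sum_j m j = 1.

Let lam' (j : nat) : RT := lam (inord j).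
Let m' (j : nat) : {nonneg R} := NngNum (m_ge0 (inord j)).
Let atoms : nat -> {measure set RT -> \bar R} := fun j => mscale (m' j) (dirac (lam' j)).

Definition discrete_law : set RT -> \bar R := msum atoms n.+1.

HB.instance Definition _ := Measure.on discrete_law.

Let discrete_lawT : discrete_law [set: RT] = 1%E.
Proof.
transitivity (\sum_(j < n.+1) (m j)%:E)%E.
  apply: eq_bigr => j _; rewrite /atoms /= /mscale/= diracT mule1.
  by rewrite inord_val.
by rewrite sumEFin m_sum.
Qed.

HB.instance Definition _ := Measure_isProbability.Build _ _ _ discrete_law discrete_lawT.

Definition discrete_prob : probability RT R := discrete_law.

Lemma ge0_integral_discrete (f : RT -> R) : measurable_fun [set: RT] f ->
  (forall x, 0 <= f x) ->
  (\int[discrete_prob]_x (f x)%:E = (\sum_j m j * f (lam j))%:E)%E.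
Proof.
move=> mf f0; have mEf : measurable_fun [set: RT] (fun x => (f x)%:E) by exact/measurable_EFinP.
rewrite ge0_integral_measure_sum//; last by move=> x _; rewrite lee_fin.
rewrite -sumEFin; apply: eq_bigr => j _; rewrite ge0_integral_mscale//=.
  by rewrite integral_dirac// diracT mul1e /lam' /m' /= !inord_val EFinM.
by move=> x _; rewrite lee_fin.
Qed.

Lemma integrable_discrete (f : RT -> R) : measurable_fun [set: RT] f ->
  discrete_prob.-integrable [set: RT] (fun x => (f x)%:E).
Proof.
move=> mf; apply/integrableP; split; first exact/measurable_EFinP.
under eq_integral do rewrite abse_EFin.
by rewrite ge0_integral_discrete ?ltry//; exact: measurableT_comp.
Qed.

Lemma Rintegral_discrete (f : RT -> R) : measurable_fun [set: RT] f ->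
  Rintegral discrete_prob [set: RT] f = \sum_j m j * f (lam j).
Proof.
move=> mf; pose g x := Num.max (f x) 0; pose g' x := Num.max (- f x) 0.
have mg : measurable_fun [set: RT] g by exact: measurable_maxr.
have mg' : measurable_fun [set: RT] g' by apply: measurable_maxr => //; exact: measurable_funN.
have fE x : f x = g x - g' x.
  by rewrite /g /g'; have [h|h] := leP 0 (f x); have [h'|h'] := leP (- f x) 0; lra.
have -> : f = fun x => g x - g' x by apply/funext.
rewrite RintegralB//; [|exact: integrable_discrete|exact: integrable_discrete].
rewrite /Rintegral !ge0_integral_discrete//; last 2 first.
- by move=> x; rewrite /g' le_max lexx orbT.
- by move=> x; rewrite /g le_max lexx orbT.
rewrite -sumrB; apply: eq_bigr => j _; rewrite mulrBr; done.
Qed.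

Lemma cint_discrete (f : RT -> C) : cmeas f ->
  cint discrete_prob f = \sum_j (m j)%:C * f (lam j).
Proof.
move=> [mr mi]; rewrite /cint !Rintegral_discrete//; apply: complexP => /=.
  rewrite (big_morph (@complex.Re R) (id1 := 0) (op1 := +%R)) => [|x y|//]; last exact: ReD.
  by apply: eq_bigr => j _; rewrite ReM /= mul0r subr0.
rewrite (big_morph (@complex.Im R) (id1 := 0) (op1 := +%R)) => [|x y|//]; last exact: ImD.
by apply: eq_bigr => j _; rewrite ImM /= mul0r addr0.
Qed.

End DiscreteLaw.

End Quadrature.

(** * Functions of polynomial growth and the Cauchy kernel *)

Section PolynomialsOnTheLine.
Variable R : realType.
Local Notation C := R[i].
Local Notation RT := (measurableTypeR R).

(** The test functions for moment convergence; the exponent is even so that the bound is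
    nonnegative and integrates to moments. *)
Definition tempered (f : R -> R) := continuous f /\
  exists (K : R) (l : nat), forall x, `|f x| <= K * (1 + x ^+ (2 * l)).

Lemma pow2_ge0 (x : R) l : 0 <= x ^+ (2 * l).
Proof. by rewrite exprM exprn_ge0// sqr_ge0. Qed.

Lemma pow2_le (x : R) l l' : x ^+ (2 * l) <= 1 + x ^+ (2 * (l + l')).
Proof.
have [x1|x1] := leP (x ^+ 2) 1.
  have h : x ^+ (2 * l) <= 1 by rewrite exprM; apply: exprn_ile1 => //; exact: sqr_ge0.
  by rewrite (le_trans h)// lerDl pow2_ge0.
rewrite mulnDr exprD -[leLHS]add0r lerD// ler_peMr ?pow2_ge0//.
by rewrite exprM; apply: exprn_ege1; exact: ltW.
Qed.

Lemma tempered_bounded (f : R -> R) (M : R) : continuous f ->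
  (forall x, `|f x| <= M) -> tempered f.
Proof.
move=> cf fM; split => //; exists M, 0%N => x; rewrite muln0 expr0.
have M0 : 0 <= M by exact: le_trans (normr_ge0 _) (fM 0).
by rewrite (le_trans (fM x))// ler_peMr// lerDl.
Qed.

Lemma tempered_cst (a : R) : tempered (fun=> a).
Proof. by apply: (@tempered_bounded _ `|a|) => //; move=> x; exact: cvg_cst. Qed.

Lemma tempered_id : tempered id.
Proof.
split; first by move=> x; exact: cvg_id.
exists 1, 1%N => x; rewrite muln1 mul1r /=.
by have := sqr_ge0 (`|x| - 1); rewrite -(real_normK (num_real x)); have := normr_ge0 x; nra.
Qed.

Lemma temperedD f g : tempered f -> tempered g -> tempered (fun x => f x + g x).
Proof.
move=> [cf [K [l fK]]] [cg [K' [l' gK]]]; split.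
  by move=> x; apply: cvgD; [exact: cf|exact: cg].
have h a b : 1 + a ^+ (2 * l) <= 2 * (1 + a ^+ (2 * (l + b))) :> R.
  by have := pow2_le a l b; have := pow2_ge0 a (l + b); lra.
have h' a b : 1 + a ^+ (2 * l') <= 2 * (1 + a ^+ (2 * (b + l'))) :> R.
  by have := pow2_le a l' b; rewrite addnC; have := pow2_ge0 a (b + l'); lra.
exists (2 * (`|K| + `|K'|)), (l + l')%N => x.
rewrite (le_trans (ler_normD _ _))// -mulrA mulrCA mulrDl lerD//.
  rewrite (le_trans (fK x))// (le_trans (ler_norm _))// normrM.
  by rewrite [`|1 + _|]ger0_norm ?addr_ge0 ?pow2_ge0// ler_wpM2l.
rewrite (le_trans (gK x))// (le_trans (ler_norm _))// normrM.
by rewrite [`|1 + _|]ger0_norm ?addr_ge0 ?pow2_ge0// ler_wpM2l.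
Qed.

Lemma temperedM f g : tempered f -> tempered g -> tempered (fun x => f x * g x).
Proof.
move=> [cf [K [l fK]]] [cg [K' [l' gK]]]; split.
  by move=> x; apply: cvgM; [exact: cf|exact: cg].
exists (4 * (`|K| * `|K'|)), (l + l')%N => x.
rewrite normrM.
have h1 : `|f x| <= `|K| * (1 + x ^+ (2 * l)).
  by rewrite (le_trans (fK x))// ler_wpM2r ?ler_norm// addr_ge0 ?pow2_ge0.
have h2 : `|g x| <= `|K'| * (1 + x ^+ (2 * l')).
  by rewrite (le_trans (gK x))// ler_wpM2r ?ler_norm// addr_ge0 ?pow2_ge0.
rewrite (le_trans (ler_pM _ _ h1 h2))// mulrACA [leRHS]mulrAC mulrC ler_wpM2r ?mulr_ge0//.
have := pow2_le x l l'; have := pow2_le x l' l; rewrite (addnC l').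
rewrite mulnDr exprD.
have := pow2_ge0 x l'; have := pow2_ge0 x l.
by set p := x ^+ _; set q := x ^+ _; nra.
Qed.

Lemma eq_tempered f g : f =1 g -> tempered f -> tempered g.
Proof. by move=> /funext->. Qed.

Definition ctempered (f : R -> C) :=
  tempered (fun x => complex.Re (f x)) /\ tempered (fun x => complex.Im (f x)).

Lemma ctemperedD f g : ctempered f -> ctempered g -> ctempered (fun x => f x + g x).
Proof.
move=> [f1 f2] [g1 g2]; split.
  by apply: eq_tempered (temperedD f1 g1) => x; rewrite ReD.
by apply: eq_tempered (temperedD f2 g2) => x; rewrite ImD.
Qed.

Lemma ctemperedM f g : ctempered f -> ctempered g -> ctempered (fun x => f x * g x).
Proof.
move=> [f1 f2] [g1 g2]; split.
  apply: eq_tempered (temperedD (temperedM f1 g1)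
    (temperedM (temperedM (tempered_cst (-1)) f2) g2)) => x.
  by rewrite ReM; ring.
by apply: eq_tempered (temperedD (temperedM f1 g2) (temperedM f2 g1)) => x; rewrite ImM.
Qed.

Lemma ctempered_conj f : ctempered f -> ctempered (fun x => (f x)^*).
Proof.
move=> [f1 f2]; split; first by apply: eq_tempered f1 => x; rewrite Re_conj.
by apply: eq_tempered (temperedM (tempered_cst (-1)) f2) => x; rewrite Im_conj mulN1r.
Qed.

Lemma ctempered_sqn f : ctempered f -> tempered (fun x => sqn (f x)).
Proof.
move=> [f1 f2]; apply: eq_tempered (temperedD (temperedM f1 f1) (temperedM f2 f2)) => x.
by rewrite sqnE !expr2.
Qed.

Lemma ctempered_poly (q : {poly C}) : ctempered (evR q).
Proof.
elim/poly_ind: q => [|q a ih].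
  by split; apply: (@eq_tempered (fun=> 0)) (tempered_cst 0) => x; rewrite /evR horner0.
have cid : ctempered (fun x => x%:C) by split => /=; [exact: tempered_id|exact: tempered_cst].
have ca : ctempered (fun=> a) by split; exact: tempered_cst.
have := ctemperedD (ctemperedM ih cid) ca.
by congr ctempered; apply/funext => x; rewrite /evR !hornerE.
Qed.

Lemma ctempered_cmeas f : ctempered f -> cmeas (f : RT -> C).
Proof. by move=> [[c1 _] [c2 _]]; split; exact: continuous_measurable_fun. Qed.

Lemma cmeas_poly q : cmeas (@evR R q).
Proof. exact/ctempered_cmeas/ctempered_poly. Qed.

Definition cauchy (z : C) (t : RT) : C := ((t : R)%:C - z)^-1.

Lemma real_sub_neq0 z (t : R) : complex.Im z != 0 -> t%:C - z != 0.
Proof. by move=> z0; rewrite subr_eq0; apply: contra z0 => /eqP <-. Qed.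

Lemma cauchyE z (t : R) : complex.Im z != 0 -> (t%:C - z) * cauchy z t = 1.
Proof. by move=> z0; rewrite mulfV// real_sub_neq0. Qed.

Lemma sqn_cauchy_le z (t : R) : complex.Im z != 0 ->
  sqn (cauchy z t) <= (complex.Im z ^+ 2)^-1.
Proof.
move=> z0; rewrite /cauchy sqnV lef_pV2.
- by rewrite sqnE; case: z z0 => x y /= _; rewrite sub0r sqrrN lerDr sqr_ge0.
- by rewrite posrE lt0r sqn_ge0 sqn_eq0 real_sub_neq0.
- by rewrite posrE exprn_even_gt0.
Qed.

Lemma ctempered_cauchy z : complex.Im z != 0 -> ctempered (cauchy z).
Proof.
case: z => x y /= y0.
have Dpos (t : R) : 0 < (t - x) ^+ 2 + y ^+ 2.
  by rewrite ltr_wpDl ?sqr_ge0// exprn_even_gt0.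
have cD : continuous (fun t : R => ((t - x) ^+ 2 + y ^+ 2)^-1).
  move=> t; apply: cvgV; first by rewrite gt_eqF.
  apply: cvgD; last exact: cvg_cst.
  rewrite expr2; apply: cvgM; apply: cvgD; try exact: cvg_cst; exact: cvg_id.
have tD : tempered (fun t : R => ((t - x) ^+ 2 + y ^+ 2)^-1).
  apply: (@tempered_bounded _ (y ^+ 2)^-1) => // t.
  rewrite ger0_norm ?invr_ge0 ?(ltW (Dpos t))//.
  by rewrite lef_pV2 ?posrE ?Dpos ?exprn_even_gt0// lerDr sqr_ge0.
have sE (t : R) : sqn (t%:C - (x +i* y)) = (t - x) ^+ 2 + y ^+ 2.
  by rewrite sqnE /= sub0r sqrrN.
split.
  apply: eq_tempered (temperedM (temperedD tempered_id (tempered_cst (- x))) tD) => t.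
  by rewrite /cauchy ReV sE.
apply: eq_tempered (temperedM (tempered_cst y) tD) => t.
by rewrite /cauchy ImV sE /= sub0r opprK.
Qed.

End PolynomialsOnTheLine.

(** * Limits of Gauss quadratures *)

Lemma norm2_orthonormal_sum d (T : measurableType d) (R : realType)
    (mu : {measure set T -> \bar R}) (e : nat -> T -> R[i]) N (a : nat -> R[i]) :
  (forall n, (n < N)%N -> L2 mu (e n)) ->
  (forall m n, (m < N)%N -> (n < N)%N -> ip mu (e m) (e n) = (m == n)%:R) ->
  norm2 mu (fun x => \sum_(n < N) a n * e n x) = \sum_(n < N) sqn (a n).
Proof.
move=> eL eO; have := norm2_sub_orthonormal (fun n => - a n) eL eO (L2_0 mu).
have -> : norm2 mu (fun=> 0) = 0.
  by rewrite /norm2; under eq_Rintegral do rewrite sqn0; rewrite /Rintegral integral0.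
have ip0 n : ip mu (fun=> 0) (e n) = 0.
  rewrite /ip /cint; apply: complexP => /=; rewrite -[RHS](Rintegral_set0 mu (fun=> 0));
  by rewrite Rintegral_set0 /Rintegral; under eq_integral do rewrite mul0r /=; rewrite integral0.
under [X in _ = _ - X + _]eq_bigr do rewrite ip0 sqn0.
rewrite big1// subr0 add0r => h.
transitivity (norm2 mu (fun x => 0 - \sum_(n < N) - a n * e n x)).
  congr norm2; apply/funext => x; rewrite sub0r -sumrN.
  by apply: eq_bigr => n _; rewrite mulNr opprK.
by rewrite h; apply: eq_bigr => n _; rewrite ip0 sub0r opprK.
Qed.

Section Solutions.
Variable R : realType.
Local Notation C := R[i].
Local Notation RT := (measurableTypeR R).
Variables (p : nat -> {poly C}) (c : nat -> C) (d : nat -> R).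
Hypothesis sizep : forall n, size (p n) = n.+1.
Hypothesis p0 : p 0%N = 1.
Hypothesis c0 : forall n, c n != 0.
Hypothesis rec : forall n, 'X * p n =
  (shift_prev c n)^* *: shift_prev p n + (d n)%:C *: p n + c n *: p n.+1.
Local Notation e := (fun n => evR (p n)).

Lemma poly_span N (q : {poly C}) : (size q <= N)%N ->
  exists a : nat -> C, q = \sum_(i < N) a i *: p i.
Proof.
elim: N q => [|N ih] q qN.
  by exists (fun=> 0); rewrite big_ord0; apply/eqP; rewrite -size_poly_leq0.
have lc : lead_coef (p N) != 0 by rewrite lead_coef_eq0 -size_poly_eq0 sizep.
have lcE : lead_coef (p N) = (p N)`_N by rewrite lead_coefE sizep.
pose b := q`_N / lead_coef (p N).
have [|a ha] := ih (q - b *: p N).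
  apply/leq_sizeP => j; rewrite leq_eqVlt => /predU1P[<-|Nj].
    by rewrite coefB coefZ /b -lcE divfK ?subrr.
  rewrite coefB coefZ !nth_default ?mulr0 ?subr0// ?sizep//.
  exact: leq_trans qN Nj.
exists (fun i => if i == N then b else a i).
rewrite big_ord_recr/= eqxx -[LHS](subrK (b *: p N)); congr (_ + _).
rewrite ha; apply: eq_bigr => i _.
by rewrite (ltn_eqF (ltn_ord i)).
Qed.

Lemma gauss_exists n tau : exists P : probability RT R, gauss p c n tau P.
Proof.
have [lam [m [[m0 mO mP] mtau]]] := quadrature_exists p0 c0 rec n tau.
have m1 : \sum_j m j = 1.
  apply: complexI; rewrite rmorph_sum/= -[RHS](mO 0%N 0%N)//; apply: eq_bigr => j _.
  by rewrite p0 -polyC1 !hornerC rmorph1 !mulr1.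
have ec n' : cmeas (e n') by exact: cmeas_poly.
have cM (f g : RT -> C) : cmeas f -> cmeas g -> cmeas (fun x => f x * (g x)^*).
  by move=> mf mg; apply: cmeasM => //; exact: cmeas_conj.
have ipE (f : RT -> C) k : cmeas f -> ip (discrete_prob lam m0 m1) f (e k) =
    \sum_j (m j)%:C * (f (lam j) * ((p k).[(lam j)%:C])^*).
  by move=> mf; rewrite /ip cint_discrete//; exact: cM.
exists (discrete_prob lam m0 m1); split.
- by move=> f mf; split => //; apply: integrable_discrete; exact: cmeas_sqn.
- by move=> k l kn ln; rewrite ipE// mO.
- move=> f mf; rewrite /norm2 Rintegral_discrete; last exact: cmeas_sqn.
  by rewrite (mP (fun j => f (lam j))); apply: eq_bigr => k _; rewrite ipE.
- move=> f mf; rewrite !ipE// !big_distrr/=; apply: eq_bigr => j _.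
  have : (c n)^* * ((p n.+1).[(lam j)%:C])^* = tau%:C * ((p n).[(lam j)%:C])^*.
    by rewrite -conjM mtau conjM conjE conjc_real.
  by move=> h; rewrite mulrCA [X in _ * X]mulrCA h; ring.
Qed.

(** The coordinates of ['X^l] in the orthonormal polynomials do not depend on the measure,
    and neither does its norm as soon as the measure integrates them correctly. *)
Lemma gauss_moment l : exists B : R, forall n tau P, (l <= n)%N -> gauss p c n tau P ->
  (\int[P]_x (x ^+ (2 * l))%:E <= B%:E)%E.
Proof.
have [|a ha] := @poly_span l.+1 'X^l; first by rewrite size_polyXn.
exists (\sum_(i < l.+1) sqn (a i)) => n tau P ln [PL PO _ _].
have eL k : L2 P (e k) by apply: PL; exact: cmeas_poly.
have -> : (\int[P]_x (x ^+ (2 * l))%:E = \int[P]_x (sqn (\sum_(i < l.+1) a i * e i x))%:E)%E.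
  apply: eq_integral => x _; congr (_%:E).
  have -> : \sum_(i < l.+1) a i * e i x = (evR 'X^l x : C).
    by rewrite ha /evR horner_sum; apply: eq_bigr => i _; rewrite hornerZ.
  by rewrite /evR hornerXn -rmorphXn/= sqn_real -exprM mulnC.
rewrite -norm2E; last by apply: (@L2_sum _ _ _ P l.+1 (fun n x => a n * e n x)) => i _; exact/L2Z/eL.
rewrite (@norm2_orthonormal_sum _ _ _ P e l.+1 a)// => i j il jl; apply: PO.
  by rewrite (leq_trans _ ln)// -ltnS.
by rewrite (leq_trans _ ln)// -ltnS.
Qed.

(** In classical terms, [rho] solves the Hamburger moment problem that has [p] as its
    orthonormal polynomials. *)
Definition solution (rho : {measure set RT -> \bar R}) :=
  (forall n, L2 rho (e n)) /\ forall m n, ip rho (e m) (e n) = (m == n)%:R.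

Definition moment_cvg (P : nat -> probability RT R) (rho : {measure set RT -> \bar R}) :=
  forall f : R -> R, tempered f -> rho.-integrable [set: RT] (fun x => (f x)%:E) /\
    Rintegral (P k) [set: RT] f @[k --> \oo] --> Rintegral rho [set: RT] f.

Lemma moment_cvg_subseq P rho (phi : nat -> nat) : (forall k, (k <= phi k)%N) ->
  moment_cvg P rho -> moment_cvg (P \o phi) rho.
Proof.
move=> phik h f /h[fi fc]; split => //.
apply: (cvg_comp phi (fun k => Rintegral (P k) [set: RT] f)) fc.
by move=> A [n _ nA]; exists n => // k /= nk; apply: nA => /=; exact: leq_trans (phik k).
Qed.

Lemma gauss_subseq_cvg (n_ : nat -> nat) (tau : nat -> R) (P : nat -> probability RT R) :
  (forall k, (k <= n_ k)%N) -> (forall k, gauss p c (n_ k) (tau k) (P k)) ->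
  exists (phi : nat -> nat) (rho : {measure set RT -> \bar R}),
    (forall k, (k <= phi k)%N) /\ moment_cvg (P \o phi) rho.
Proof.
move=> n_k gP.
have [B HB] : exists B : nat -> R, forall l n tau P, (l <= n)%N -> gauss p c n tau P ->
    (\int[P]_x (x ^+ (2 * l))%:E <= (B l)%:E)%E.
  exists (fun l => projT1 (cid (gauss_moment l))) => l.
  exact: projT2 (cid (gauss_moment l)).
have [l|phi [rho [phik H]]] := @helly_moments R P B.
  exists l => // k /= lk; apply: HB (gP k).
  exact: leq_trans lk (n_k k).
exists phi, rho; split => // f [cf [K [l fK]]].
exact: H cf K l fK.
Qed.

Lemma moment_cvg_cint P rho f : moment_cvg P rho -> ctempered f ->
  cintegrable rho (f : RT -> C) /\
  (complex.Re (cint (P k) f) @[k --> \oo] --> complex.Re (cint rho f)) /\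
  (complex.Im (cint (P k) f) @[k --> \oo] --> complex.Im (cint rho f)).
Proof. by move=> h [/h[i1 c1] /h[i2 c2]]. Qed.

(** Each orthonormality relation holds exactly from some index on, and polynomials are
    admissible test functions. *)
Lemma gauss_limit_solution (n_ : nat -> nat) (tau : nat -> R) P rho :
  (forall k, (k <= n_ k)%N) -> (forall k, gauss p c (n_ k) (tau k) (P k)) ->
  moment_cvg P rho -> solution rho.
Proof.
move=> n_k gP cP.
have eT n : ctempered (e n) by exact: ctempered_poly.
split=> [n|m n].
  split; first exact: cmeas_poly.
  by have [] := cP _ (ctempered_sqn (eT n)).
have [_ [cr ci]] := moment_cvg_cint cP (ctemperedM (eT m) (ctempered_conj (eT n))).
have ev_cst : \forall k \near \oo, cint (P k) (fun x => e m x * (e n x)^*) = (m == n)%:R.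
  exists (maxn m n) => // k /=; rewrite geq_max => /andP[mk nk].
  have [_ PO _ _] := gP k.
  exact: PO (leq_trans mk (n_k k)) (leq_trans nk (n_k k)).
apply: complexP.
  apply: (cvg_unique _ cr) => //; apply: cvg_near_cst.
  by apply: filterS ev_cst => k ->.
apply: (cvg_unique _ ci) => //; apply: cvg_near_cst.
by apply: filterS ev_cst => k ->.
Qed.

(** The Fourier coefficients of the Cauchy kernel satisfy the recurrence of the
    polynomials, with an inhomogeneous term at index zero that depends only on
    the total mass. *)
Lemma cauchy_rec (nu : {measure set RT -> \bar R}) z n : complex.Im z != 0 ->
  (forall k, (k <= n.+1)%N -> L2 nu (e k)) -> ip nu (e 0%N) (e n) = (n == 0)%:R ->
  (n == 0)%:R + z * ip nu (cauchy z) (e n) =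
  shift_prev c n * shift_prev (fun k => ip nu (cauchy z) (e k)) n
  + (d n)%:C * ip nu (cauchy z) (e n) + (c n)^* * ip nu (cauchy z) (e n.+1).
Proof.
move=> z0 eL e0n.
have L2e0 : L2 nu (e 0%N) by exact: eL.
have hm : cmeas (cauchy z) by apply: ctempered_cmeas; exact: ctempered_cauchy.
have hL : L2 nu (cauchy z).
  have := L2_bounded hm (fun x => sqn_cauchy_le x z0) L2e0.
  by congr L2; apply/funext => x; rewrite p0 /evR -polyC1 hornerC mulr1.
have eLn := eL n (leqnSn n).
have xe (x : RT) : (x : R)%:C * (e n x)^* =
    shift_prev c n * (evR (shift_prev p n) x)^* + (d n)%:C * (e n x)^* + (c n)^* * (e n.+1 x)^*.
  have := congr1 (@Num.conj _) (rec_horner rec n x%:C).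
  by rewrite !rmorphD/= !rmorphM/= conjCK !conjE !conjc_real.
have spL : L2 nu (evR (shift_prev p n)).
  case: n eL {e0n eLn xe} => [|n] eL /=; last by apply: eL; rewrite ltnW// ltnW.
  have := L2_0 nu; congr L2; apply/funext => x; by rewrite /evR horner0.
have -> : shift_prev c n * shift_prev (fun k => ip nu (cauchy z) (e k)) n =
    shift_prev c n * ip nu (cauchy z) (evR (shift_prev p n)).
  by case: n {eL e0n eLn xe spL} => [|n] //=; rewrite !mul0r.
rewrite -e0n /ip.
have i1 := L2_ip_integrable hL spL; have i2 := L2_ip_integrable hL eLn.
have i3 := L2_ip_integrable hL (eL n.+1 (leqnn _)).
have i0 := L2_ip_integrable L2e0 eLn.
rewrite -!cintZ// -!cintD//; try (by do ?apply: cintegrableD; exact: cintegrableZ).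
apply: eq_cint => x; rewrite p0 {1}/evR -polyC1 hornerC mul1r.
have E : (e n x)^* = ((x : R)%:C - z) * cauchy z x * (e n x)^* by rewrite cauchyE// mul1r.
transitivity (cauchy z x * ((x : R)%:C * (e n x)^*)); first by rewrite {1}E; ring.
rewrite xe; ring.
Qed.

End Solutions.

(** * Fourier coefficients of the Cauchy kernel *)

Section CauchyCoefficients.
Variable R : realType.
Local Notation C := R[i].
Local Notation RT := (measurableTypeR R).
Variables (p : nat -> {poly C}) (c : nat -> C) (d : nat -> R).
Hypothesis sizep : forall n, size (p n) = n.+1.
Hypothesis p0 : p 0%N = 1.
Hypothesis c0 : forall n, c n != 0.
Hypothesis rec : forall n, 'X * p n =
  (shift_prev c n)^* *: shift_prev p n + (d n)%:C *: p n + c n *: p n.+1.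
Local Notation e := (fun n => evR (p n)).
Variable z : C.
Hypothesis z0 : complex.Im z != 0.
Local Notation A nu n := (ip nu (cauchy z) (evR (p n))).
(* The polynomials with conjugate coefficients, at [z]. *)
Local Notation pi_ n := ((p n).[z^*])^*.

Lemma pi_rec n : z * pi_ n =
  shift_prev c n * ((shift_prev p n).[z^*])^* + (d n)%:C * pi_ n + (c n)^* * pi_ n.+1.
Proof.
have := congr1 (@Num.conj _) (rec_horner rec n z^*).
by rewrite !rmorphD/= !rmorphM/= !conjCK [(_%:C)^*]conjE conjc_real.
Qed.

Lemma pi_0 : pi_ 0 = 1. Proof. by rewrite p0 -polyC1 hornerC rmorph1. Qed.

(** The hypotheses on a measure under which its Cauchy coefficients satisfy the recurrence
    up to index [N]; Gaussian measures and solutions share them. *)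
Definition adm (nu : {measure set RT -> \bar R}) N :=
  (forall k, (k <= N)%N -> L2 nu (e k)) /\
  forall k, (k < N)%N -> ip nu (e 0%N) (e k) = (k == 0)%:R.

Lemma gauss_adm n tau P : gauss p c n tau P -> adm P n.+1.
Proof.
move=> [PL PO _ _]; split=> [k _|k kn]; first by apply: PL; exact: cmeas_poly.
by rewrite PO// eq_sym.
Qed.

Lemma solution_adm rho N : solution p rho -> adm rho N.
Proof. by move=> [sL sO]; split=> [k _|k _] //; rewrite sO eq_sym. Qed.

(** The inhomogeneous terms of the two recurrences cancel in the difference, which is
    therefore a multiple of the solution [pi_] of the homogeneous recurrence. *)
Lemma coef_diff (nu nu' : {measure set RT -> \bar R}) N : adm nu N -> adm nu' N ->
  forall k, (k <= N)%N -> A nu k - A nu' k = (A nu 0%N - A nu' 0%N) * pi_ k.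
Proof.
move=> [nL nO] [nL' nO'].
have crec (mu : {measure set RT -> \bar R}) k : (forall k, (k <= N)%N -> L2 mu (e k)) ->
    (forall k, (k < N)%N -> ip mu (e 0%N) (e k) = (k == 0)%:R) -> (k < N)%N ->
    (k == 0)%:R + z * A mu k = shift_prev c k * shift_prev (fun k => A mu k) k
      + (d k)%:C * A mu k + (c k)^* * A mu k.+1.
  move=> mL mO kN; apply: (cauchy_rec p0 rec z0); last exact: mO.
  by move=> j jk; apply: mL; exact: leq_trans kN.
pose b k := (A nu k - A nu' k)^*.
have hb k : (k < N)%N -> z^* * b k =
    (shift_prev c k)^* * shift_prev b k + (d k)%:C * b k + c k * b k.+1.
  move=> kN; have := crec nu k nL nO kN; have := crec nu' k nL' nO' kN => e1 e2.
  have -> : shift_prev b k =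
      (shift_prev (fun k => A nu k) k - shift_prev (fun k => A nu' k) k)^*.
    by case: k {kN e1 e2} => [|k] //=; rewrite subr0 rmorph0.
  rewrite /b -[c k]conjCK -[(d k)%:C]conjc_real -!conjE -!conjM -!conjD; congr (_^*).
  rewrite -[A nu k]add0r.
  transitivity (((k == 0)%:R + z * A nu k) - ((k == 0)%:R + z * A nu' k)); first by ring.
  by rewrite e1 e2; ring.
move=> k kN.
have := rec_unique p0 c0 rec hb kN; rewrite /b => /(congr1 (@Num.conj _)).
by rewrite conjCK rmorphM/= conjCK.
Qed.

Lemma sqn_cauchy_coef_le (rho : {measure set RT -> \bar R}) N : solution p rho ->
  \sum_(k < N) sqn (A rho k) <= norm2 rho (cauchy z).
Proof.
move=> [sL sO].
have hm : cmeas (@cauchy R z) by apply: ctempered_cmeas; exact: ctempered_cauchy.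
have hL : L2 rho (cauchy z).
  have := L2_bounded hm (fun x => sqn_cauchy_le x z0) (sL 0%N).
  by congr L2; apply/funext => x; rewrite p0 /evR -polyC1 hornerC mulr1.
have := @norm2_sub_orthonormal _ _ _ rho e _ N (fun k => A rho k)
  (fun k _ => sL k) (fun m n _ _ => sO m n) hL.
rewrite [X in _ + X]big1 ?addr0 => [h|k _]; last by rewrite subrr sqn0.
by rewrite -subr_ge0 -h norm2_ge0.
Qed.

Lemma cauchy_approx (rho : {measure set RT -> \bar R}) N : solution p rho ->
  norm2 rho (fun x => cauchy z x - \sum_(k < N) A rho k * e k x) =
  norm2 rho (cauchy z) - \sum_(k < N) sqn (A rho k).
Proof.
move=> [sL sO].
have hm : cmeas (@cauchy R z) by apply: ctempered_cmeas; exact: ctempered_cauchy.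
have hL : L2 rho (cauchy z).
  have := L2_bounded hm (fun x => sqn_cauchy_le x z0) (sL 0%N).
  by congr L2; apply/funext => x; rewrite p0 /evR -polyC1 hornerC mulr1.
rewrite (@norm2_sub_orthonormal _ _ _ rho e _ N (fun k => A rho k)
  (fun k _ => sL k) (fun m n _ _ => sO m n) hL).
by rewrite [X in _ + X]big1 ?addr0// => k _; rewrite subrr sqn0.
Qed.

Lemma cauchy_weight (nu : {measure set RT -> \bar R}) : A nu 0%N = cint nu (cauchy z).
Proof.
rewrite /ip; apply: eq_cint => x.
by rewrite p0 /evR -polyC1 hornerC rmorph1 mulr1.
Qed.

(** The cross term is absorbed with a weight [eta], so that the coefficient of [sqn a] is
    arbitrarily close to one. *)
Lemma sqnD_young (a b : C) (eta : R) : 0 < eta ->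
  sqn (a + b) <= (1 + eta) * sqn a + (1 + eta^-1) * sqn b.
Proof.
move=> eta0; rewrite !sqnE; case: a => a1 a2; case: b => b1 b2 /=.
rewrite -subr_ge0.
have -> : (1 + eta) * (a1 ^+ 2 + a2 ^+ 2) + (1 + eta^-1) * (b1 ^+ 2 + b2 ^+ 2) -
   ((a1 + b1) ^+ 2 + (a2 + b2) ^+ 2) =
   eta * (a1 - eta^-1 * b1) ^+ 2 + eta * (a2 - eta^-1 * b2) ^+ 2.
  by field; rewrite gt_eqF.
by rewrite addr_ge0// mulr_ge0 ?sqr_ge0// ltW.
Qed.

(** If [sum |p_k (conj z)|^2] converges, a limit of Gaussian measures has the
    Cauchy kernel in the closure of the polynomials: for a Gaussian measure the
    Parseval identity is exact, and its coefficients differ from those of the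
    limit by a vanishing multiple of a square summable sequence. *)
Lemma gauss_limit_cauchy (n_ : nat -> nat) (tau : nat -> R) P rho (S : R) :
  (forall k, (k <= n_ k)%N) -> (forall k, gauss p c (n_ k) (tau k) (P k)) ->
  moment_cvg P rho -> (forall N, \sum_(k < N) sqn (p k).[z^*] <= S) ->
  forall eps : R, 0 < eps -> exists N (a : nat -> C),
    norm2 rho (fun x => cauchy z x - \sum_(k < N) a k * e k x) < eps.
Proof.
move=> n_k gP cP pS eps eps0.
have srho := gauss_limit_solution n_k gP cP.
pose H := norm2 rho (cauchy z).
have H0 : 0 <= H by exact: norm2_ge0.
have S0 : 0 <= S by have := pS 0%N; rewrite big_ord0.
(* [eta] makes the factor [1 + eta] cost at most [eps / 4]; the remaining constant [K] is
   then beaten by the convergence of the Cauchy transforms. *)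
pose eta := (eps / 4) / (H + 1).
have eta0 : 0 < eta by rewrite !divr_gt0// ltr_wpDl.
pose K := (1 + eta^-1) * S + 1.
have K0 : 0 < K by rewrite ltr_wpDl// mulr_ge0// addr_ge0// invr_ge0 ltW.
have tc := ctempered_cauchy z0.
have [_ [cr ci]] := moment_cvg_cint cP tc.
have [_ cn] := cP _ (ctempered_sqn tc).
pose dlt k := A (P k) 0%N - A rho 0%N.
have [k [hk1 hk2]] : exists k, `|H - norm2 (P k) (cauchy z)| <= eps / 4 /\
    K * sqn (dlt k) <= eps / 4.
  pose s := Num.min 1 (eps / 4 / K / 2).
  have s0 : 0 < s by rewrite lt_min ltr01/= !divr_gt0.
  near \oo => k; exists k; split.
    by near: k; move/cvgrPdist_le : cn; apply; rewrite divr_gt0.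
  have h1 : `|complex.Re (cint rho (cauchy z)) - complex.Re (cint (P k) (cauchy z))| <= s.
    by near: k; move/cvgrPdist_le : cr; apply.
  have h2 : `|complex.Im (cint rho (cauchy z)) - complex.Im (cint (P k) (cauchy z))| <= s.
    by near: k; move/cvgrPdist_le : ci; apply.
  have s1 : s <= 1 by rewrite ge_min lexx.
  have s2 : s <= eps / 4 / K / 2 by rewrite ge_min lexx orbT.
  have : sqn (dlt k) <= eps / 4 / K.
    rewrite /dlt !cauchy_weight sqnB sqnE.
    move: (cint rho _) (cint (P k) _) h1 h2 => [x1 y1] [x2 y2] /=.
    rewrite !ler_norml => /andP[? ?] /andP[? ?].
    have hx : (x1 - x2) ^+ 2 <= s by nra.
    have hy : (y1 - y2) ^+ 2 <= s by nra.
    lra.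
  by rewrite ler_pdivlMr// mulrC.
exists (n_ k).+1, (fun j => A rho j); rewrite cauchy_approx//.
have [_ _ par _] := gP k.
have := par _ (ctempered_cmeas tc) => {}par.
have bes := sqn_cauchy_coef_le (n_ k).+1 srho.
have : \sum_(j < (n_ k).+1) sqn (A (P k) j) <=
    (1 + eta) * \sum_(j < (n_ k).+1) sqn (A rho j) +
    (1 + eta^-1) * sqn (dlt k) * \sum_(j < (n_ k).+1) sqn (p j).[z^*].
  rewrite !big_distrr -big_split/=; apply: ler_sum => j _.
  have -> : A (P k) j = A rho j + dlt k * pi_ j.
    rewrite -(coef_diff (gauss_adm (gP k)) (solution_adm _ srho))//; last exact: ltnW.
    by rewrite addrC subrK.
  apply: le_trans (sqnD_young _ _ eta0) _.
  have -> : sqn (dlt k * pi_ j) = sqn (dlt k) * sqn (p j).[z^*] by rewrite sqnM sqn_conj.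
  by rewrite (mulrA (1 + eta^-1)).
rewrite -par -/H in bes *.
set Sa := \sum_(j < _) sqn (A rho j) in bes *.
set Sp := \sum_(j < _) sqn _; have SpS : Sp <= S by exact: pS.
have Sp0 : 0 <= Sp by apply: sumr_ge0 => j _; exact: sqn_ge0.
have d0 := sqn_ge0 (dlt k).
have ei0 : 0 < eta^-1 by rewrite invr_gt0.
have etaH : eta * Sa <= eps / 4.
  have e4 : 0 <= eps / 4 by rewrite divr_ge0// ltW.
  rewrite /eta -[leLHS]mulrA; apply: ler_piMr => //.
  have H1 : 0 < H + 1 by rewrite ltr_wpDl.
  by rewrite mulrC ler_pdivrMr// mul1r (le_trans bes)// lerDl.
have KS : (1 + eta^-1) * sqn (dlt k) * Sp <= eps / 4.
  apply: le_trans hk2.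
  have h : (1 + eta^-1) * Sp <= (1 + eta^-1) * S by rewrite ler_wpM2l// addr_ge0// ltW.
  have : 0 <= ((1 + eta^-1) * S - (1 + eta^-1) * Sp + 1) * sqn (dlt k).
    by rewrite mulr_ge0// addr_ge0// subr_ge0.
  by rewrite /K; lra.
move: hk1; rewrite ler_norml => /andP[? ?] ?; lra.
Unshelve. all: by end_near. Qed.

Section TwoGauss.
Variables (n : nat) (P : probability RT R).
Hypothesis gP : gauss p c n 0 P.
Local Notation a := (fun k => A P k).

(** Liouville: the Wronskian of the inhomogeneous solution [a] and the
    homogeneous one [pi_] has constant modulus. *)
Lemma wronskian k : (k <= n)%N ->
  sqn (a k * ((c k)^* * pi_ k.+1) - ((c k)^* * a k.+1) * pi_ k) = 1.
Proof.
have [PL PO] := gauss_adm gP.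
have crec j : (j <= n)%N -> (j == 0)%:R + z * a j = shift_prev c j * shift_prev a j
      + (d j)%:C * a j + (c j)^* * a j.+1.
  move=> jn; apply: (cauchy_rec p0 rec z0); last exact: PO.
  by move=> i ij; apply: PL; rewrite (leq_trans ij).
elim: k => [|k ih] kn.
  have := pi_rec 0; have := crec 0%N kn; rewrite /= !(mul0r, mulr0, add0r).
  move=> e1 e2.
  rewrite -[X in sqn X]opprK sqnN -[RHS](sqn1 R); congr sqn; rewrite -[RHS]pi_0.
  have -> : (c 0%N)^* * a 1%N = 1 + z * a 0%N - (d 0%N)%:C * a 0%N by rewrite e1; ring.
  have -> : (c 0%N)^* * pi_ 1 = z * pi_ 0 - (d 0%N)%:C * pi_ 0.
    by rewrite e2; ring.
  by ring.
have := pi_rec k.+1; have := crec k.+1 kn; rewrite /= add0r => e1 e2.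
have -> : a k.+1 * ((c k.+1)^* * pi_ k.+2) - ((c k.+1)^* * a k.+2) * pi_ k.+1 =
    c k * (a k * pi_ k.+1 - a k.+1 * pi_ k).
  have -> : (c k.+1)^* * a k.+2 = z * a k.+1 - c k * a k - (d k.+1)%:C * a k.+1.
    by rewrite e1; ring.
  have -> : (c k.+1)^* * pi_ k.+2 = z * pi_ k.+1 - c k * pi_ k - (d k.+1)%:C * pi_ k.+1.
    by rewrite e2; ring.
  by ring.
rewrite -(ih (ltnW kn)) sqnM -(sqn_conj (c k)) -sqnM; congr sqn; ring.
Qed.

(** Taking imaginary parts in the recurrence multiplied by the conjugate solution makes the
    off-diagonal terms telescope. *)
Lemma christoffel_darboux k :
  complex.Im ((pi_ k)^* * ((c k)^* * pi_ k.+1)) =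
  complex.Im z * \sum_(j < k.+1) sqn (p j).[z^*].
Proof.
have reM (x y : C) : complex.Im (x^* * y) = - complex.Im (y^* * x).
  by rewrite !conjE; case: x => x1 x2; case: y => y1 y2 /=; ring.
have key j : complex.Im ((pi_ j)^* * ((c j)^* * pi_ j.+1)) =
    complex.Im z * sqn (p j).[z^*] - complex.Im ((pi_ j)^* * (shift_prev c j * ((shift_prev p j).[z^*])^*)).
  have -> : (c j)^* * pi_ j.+1 = z * pi_ j - shift_prev c j * ((shift_prev p j).[z^*])^* - (d j)%:C * pi_ j.
    by rewrite pi_rec; ring.
  rewrite -(sqn_conj (p j).[z^*]); move: (pi_ j) (shift_prev c j * _) => x y.
  rewrite !conjE sqnE; case: x => x1 x2; case: y => y1 y2; case: (z) => z1 z2 /=.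
  by ring.
elim: k => [|k ih]; rewrite key.
  by rewrite big_ord1 /= mul0r mulr0 subr0.
rewrite big_ord_recr/= mulrDr -ih addrC; congr (_ + _).
rewrite [in RHS]reM; congr (- complex.Im _).
by rewrite !conjM !conjCK; ring.
Qed.

(** Varying the free parameter of the Gaussian measure moves its Cauchy transform
    along a circle of radius [1 / (2 |Im z| S)], so some parameter moves it by a
    distance comparable with that radius. *)
Lemma two_gauss : exists tau, forall P' : probability RT R, gauss p c n tau P' ->
  1 <= sqn (cint P' (cauchy z) - cint P (cauchy z)) *
       (2 * (complex.Im z * \sum_(j < n.+1) sqn (p j).[z^*]) ^+ 2).
Proof.
pose kap := (c n)^* * pi_ n.+1.
pose Y := complex.Im z * \sum_(j < n.+1) sqn (p j).[z^*].
have Y0 : Y != 0.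
  rewrite mulf_neq0// gt_eqF// big_ord_recl/= p0 -polyC1 hornerC sqn1 ltr_pwDl//.
  by apply: sumr_ge0 => j _; exact: sqn_ge0.
have CD : complex.Im ((pi_ n)^* * kap) = Y by exact: christoffel_darboux.
have kap0 : kap != 0.
  by apply: contra Y0 => /eqP k0; rewrite -CD k0 mulr0.
have W := wronskian (leqnn n).
have an0 : (c n)^* * a n.+1 = 0.
  have [_ _ _ ->] := gP; first by rewrite mul0r.
  by apply: ctempered_cmeas; exact: ctempered_cauchy.
rewrite an0 mul0r subr0 -/kap sqnM in W.
pose X := complex.Re ((pi_ n)^* * kap).
(* [sigma = 1 / tau] must be nonzero and bring [sigma |kap|^2] within distance [|Y|] of [X]:
   [X] itself when it is nonzero, and [|Y|] otherwise. *)
pose sigma := if X == 0 then `|Y| / sqn kap else X / sqn kap.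
have sk0 : 0 < sqn kap by rewrite lt0r sqn_ge0 sqn_eq0 kap0.
have sig0 : sigma != 0.
  rewrite /sigma; have [_|X0] := eqVneq X 0; rewrite mulf_neq0 ?invr_eq0 ?(gt_eqF sk0)//.
  by rewrite normr_eq0.
exists sigma^-1 => P' gP'.
pose dlt := A P' 0%N - A P 0%N.
rewrite -!cauchy_weight -/dlt -/Y.
have aN k : (k <= n.+1)%N -> A P' k = a k + dlt * pi_ k.
  move=> kn; rewrite -(coef_diff (gauss_adm gP') (gauss_adm gP))//.
  by rewrite addrC subrK.
have rel : dlt * kap * sigma%:C = a n + dlt * pi_ n.
  rewrite -aN//.
  have [_ _ _ /(_ (cauchy z))] := gP'.
  move=> /(_ (ctempered_cmeas (ctempered_cauchy z0))).
  rewrite aN// mulrDr an0 add0r => h.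
  have -> : dlt * kap = (c n)^* * (dlt * pi_ n.+1) by rewrite /kap; ring.
  rewrite h fmorphV mulrAC mulVf ?mul1r//.
  by rewrite fmorph_eq0.
have an : a n = dlt * (sigma%:C * kap - pi_ n).
  by move: rel => /= rel; apply: (addIr (dlt * pi_ n)); rewrite -rel; ring.
rewrite an sqnM -mulrA in W.
rewrite -[leLHS]W ler_wpM2l ?sqn_ge0//.
rewrite mulrC -(sqn_conj (_ - _)) -sqnM.
have -> : kap * (sigma%:C * kap - pi_ n)^* = (sigma * sqn kap)%:C - (pi_ n)^* * kap.
  rewrite rmorphB/= rmorphM/= conjE conjc_real [in RHS]rmorphM/= -mul_conj; ring.
have : (sigma * sqn kap - X) ^+ 2 <= Y ^+ 2.
  rewrite /sigma; have [->|_] := eqVneq X 0; rewrite divfK ?gt_eqF// ?subr0 ?subrr.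
    by rewrite real_normK ?num_real.
  by rewrite expr0n/= sqr_ge0.
move: CD; rewrite /X; move: (_ * kap) => [x y] /= -> h.
by rewrite sqnE /= sub0r sqrrN; lra.
Qed.

End TwoGauss.

End CauchyCoefficients.

(** * Density of the polynomials *)

Section DominatedNorm.
Context d (T : measurableType d) (R : realType) (mu : {measure set T -> \bar R}).
Local Notation C := R[i].

Lemma norm2_dominated (f_ : nat -> T -> C) (v : T -> R) :
  (forall k, cmeas (f_ k)) -> (forall x, sqn (f_ k x) @[k --> \oo] --> (0 : R)) ->
  (forall k x, sqn (f_ k x) <= v x) ->
  mu.-integrable [set: T] (fun x => (v x)%:E) ->
  norm2 mu (f_ k) @[k --> \oo] --> (0 : R).
Proof.
move=> mf f0 fv iv.
have H1 k : measurable_fun [set: T] (fun x => (sqn (f_ k x))%:E).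
  by apply/measurable_EFinP; exact: cmeas_sqn.
have H2 : measurable_fun [set: T] (fun=> 0 : \bar R)%E by exact: measurable_cst.
have H3 : {ae mu, forall x, [set: T] x -> (sqn (f_ k x))%:E @[k --> \oo] --> (0 : \bar R)%E}.
  by apply: aeW => x _; apply: cvg_EFin; [exact: nearW|exact: f0].
have H4 : {ae mu, forall x k, [set: T] x -> (`|(sqn (f_ k x))%:E| <= (v x)%:E)%E}.
  by apply: aeW => x k _; rewrite abse_EFin lee_fin ger0_norm ?sqn_ge0.
have [_ _ ] := dominated_convergence measurableT H1 H2 H3 iv H4.
rewrite integral0 => h.
exact: fine_cvg h.
Qed.

End DominatedNorm.

(** With [s = sqrt r], Bernoulli's inequality for [1 / s] bounds [n s^n], and the other
    factor [s^n] tends to zero. *)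
Lemma cvg_expr_natmul (R : realType) (r : R) : 0 <= r < 1 ->
  n%:R * r ^+ n @[n --> \oo] --> (0 : R).
Proof.
move=> /andP[r0 r1].
have [->|rn0] := eqVneq r 0.
  by apply: cvg_near_cst; apply: nearW => -[|n]; rewrite ?mul0r// exprS mul0r mulr0.
pose s := Num.sqrt r.
have s0 : 0 < s by rewrite sqrtr_gt0 lt0r rn0.
have sn0 : s != 0 by rewrite gt_eqF.
have s1 : s < 1 by rewrite -sqrtr1 ltr_sqrt.
have rs : r = s ^+ 2 by rewrite sqr_sqrtr.
pose K := (s^-1 - 1)^-1.
have K0 : 0 < K by rewrite invr_gt0 subr_gt0 invf_gt1.
have bern n : n%:R * s ^+ n <= K.
  have h : 1 + n%:R * (s^-1 - 1) <= s^-1 ^+ n.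
    elim: n => [|n ih]; first by rewrite mul0r addr0 expr0.
    have si : 0 < s^-1 - 1 by rewrite subr_gt0 invf_gt1.
    rewrite exprS.
    have : s^-1 * (1 + n%:R * (s^-1 - 1)) <= s^-1 * s^-1 ^+ n by rewrite ler_pM2l// invr_gt0.
    apply: le_trans; rewrite -natr1.
    have := ler0n R n; move: (n%:R : R) (s^-1) si => a t ht a0.
    have := mulr_ge0 a0 (sqr_ge0 (t - 1)); lra.
  rewrite /K -div1r ler_pdivlMr; last by rewrite subr_gt0 invf_gt1.
  rewrite mulrAC -[leRHS](mulVf (x := s ^+ n)) ?expf_neq0// ler_pM2r ?exprn_gt0//.
  rewrite -exprVn; apply: le_trans h; lra.
apply: (@squeeze_cvgr _ _ _ _ (fun=> 0) (fun n => K * s ^+ n)).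
- apply: nearW => n; rewrite mulr_ge0 ?exprn_ge0//=.
  by rewrite rs -exprM mulnC exprM expr2 mulrA ler_wpM2r// exprn_ge0// ltW.
- exact: cvg_cst.
- rewrite -[X in _ --> X](mulr0 K); apply: cvgM; first exact: cvg_cst.
  by apply: cvg_expr; rewrite ger0_norm// ltW.
Qed.

Section Density.
Variable R : realType.
Local Notation C := R[i].
Local Notation RT := (measurableTypeR R).
Variable rho : {measure set RT -> \bar R}.
Hypothesis polyL2 : forall q : {poly C}, L2 rho (evR q).

(** The L2 closure of the polynomials. *)
Definition clos (f : RT -> C) := L2 rho f /\
  forall eps : R, 0 < eps -> exists q : {poly C}, norm2 rho (fun x => f x - evR q x) < eps.

Lemma clos_lim f : L2 rho f ->
  (forall eps : R, 0 < eps -> exists g, clos g /\ norm2 rho (fun x => f x - g x) < eps) ->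
  clos f.
Proof.
move=> fL h; split => // eps eps0.
have e4 : 0 < eps / 4 by rewrite divr_gt0.
have [g [[gL gc] fg]] := h _ e4; have [q gq] := gc _ e4.
exists q; have -> : (fun x => f x - evR q x) = fun x => (f x - g x) + (g x - evR q x).
  by apply/funext => x; rewrite addrA subrK.
apply: le_lt_trans (norm2D_le (L2B fL gL) (L2B gL (polyL2 q))) _; lra.
Qed.

Lemma clos_poly q : clos (evR q).
Proof.
split => // eps eps0; exists q; under [X in norm2 _ X]eq_fun do rewrite subrr.
by rewrite /norm2; under eq_Rintegral do rewrite sqn0; rewrite /Rintegral integral0.
Qed.

Lemma closD f g : clos f -> clos g -> clos (fun x => f x + g x).
Proof.
move=> [fL fc] [gL gc]; split; first exact: L2D.
move=> eps eps0; have e4 : 0 < eps / 4 by rewrite divr_gt0.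
have [q fq] := fc _ e4; have [r gr] := gc _ e4.
exists (q + r); have -> : (fun x => f x + g x - evR (q + r) x) =
    fun x => (f x - evR q x) + (g x - evR r x).
  by apply/funext => x; rewrite /evR hornerD opprD addrACA.
apply: le_lt_trans (norm2D_le (L2B fL (polyL2 q)) (L2B gL (polyL2 r))) _; lra.
Qed.

Lemma closZ k f : clos f -> clos (fun x => k * f x).
Proof.
move=> [fL fc]; split; first exact: L2Z.
move=> eps eps0; have k1 : 0 < sqn k + 1 by rewrite ltr_wpDl// sqn_ge0.
have [|q fq] := fc (eps / (sqn k + 1)); first by rewrite divr_gt0.
exists (k *: q); have -> : (fun x => k * f x - evR (k *: q) x) =
    fun x => k * (f x - evR q x).
  by apply/funext => x; rewrite /evR hornerZ mulrBr.
rewrite norm2Z; last exact: L2B.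
have n0 := norm2_ge0 rho (fun x => f x - evR q x).
rewrite ltr_pdivlMr// in fq; have := sqn_ge0 k; nra.
Qed.

Lemma clos_sum N (F : nat -> RT -> C) : (forall n, clos (F n)) ->
  clos (fun x => \sum_(n < N) F n x).
Proof.
move=> cF; elim: N => [|N ih].
  under [X in clos X]eq_fun do rewrite big_ord0.
  have := closZ 0 (clos_poly 0); congr clos; apply/funext => x; by rewrite mul0r.
by under [X in clos X]eq_fun do rewrite big_ord_recr; exact: closD.
Qed.

Lemma clos_conj f : clos f -> clos (fun x => (f x)^*).
Proof.
have L2c g : L2 rho g -> L2 rho (fun x => (g x)^*).
  move=> [mg g2]; split; first exact: cmeas_conj.
  by under eq_fun do rewrite sqn_conj.
move=> [fL fc]; split; first exact: L2c.
move=> eps /fc [q fq]; exists (map_poly (@Num.conj _) q).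
have -> : (fun x => (f x)^* - evR (map_poly (@Num.conj _) q) x) =
    fun x => (f x - evR q x)^*.
  apply/funext => x; rewrite rmorphB/=; congr (_ - _).
  by rewrite /evR -horner_map/= [(_%:C)^*]conjE conjc_real.
rewrite /norm2; under eq_Rintegral do rewrite sqn_conj.
exact: fq.
Qed.

Lemma clos_cvg (f_ : nat -> RT -> C) f (v : RT -> R) : (forall k, clos (f_ k)) ->
  L2 rho f -> (forall x, sqn (f x - f_ k x) @[k --> \oo] --> (0 : R)) ->
  (forall k x, sqn (f x - f_ k x) <= v x) ->
  rho.-integrable [set: RT] (fun x => (v x)%:E) -> clos f.
Proof.
move=> cf fL f0 fv iv; apply: clos_lim => // eps eps0.
have mf k : cmeas (fun x => f x - f_ k x).
  by apply: cmeasB; [case: fL|case: (cf k) => -[]].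
have h := @norm2_dominated _ _ _ rho (fun k x => f x - f_ k x) v mf f0 fv iv.
near \oo => k; exists (f_ k); split => //.
rewrite -[norm2 _ _]ger0_norm ?norm2_ge0// -[X in `|X|]subr0 distrC.
by near: k; move/cvgrPdist_lt : h; apply.
Unshelve. all: by end_near. Qed.

(** Bounded functions that multiply the closure of the polynomials into itself;
    they form an algebra closed under bounded pointwise limits. *)
Definition multiplier (m : RT -> C) := [/\ cmeas m,
  exists M : R, forall x, sqn (m x) <= M &
  forall f, clos f -> clos (fun x => m x * f x)].

Lemma multiplier_cst k : multiplier (fun=> k).
Proof.
split; [exact: cmeas_cst|by exists (sqn k)|].
by move=> f; exact: closZ.
Qed.

Lemma multiplierD m m' : multiplier m -> multiplier m' -> multiplier (fun x => m x + m' x).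
Proof.
move=> [mm [M bM] hm] [mm' [M' bM'] hm']; split; first exact: cmeasD.
  exists (2 * M + 2 * M') => x; apply: le_trans (sqnD_le _ _) _.
  by have := bM x; have := bM' x; lra.
move=> f cf; under [X in clos X]eq_fun do rewrite mulrDl.
by apply: closD; [exact: hm|exact: hm'].
Qed.

Lemma multiplierM m m' : multiplier m -> multiplier m' -> multiplier (fun x => m x * m' x).
Proof.
move=> [mm [M bM] hm] [mm' [M' bM'] hm']; split; first exact: cmeasM.
  exists (M * M') => x; rewrite sqnM ler_pM ?sqn_ge0//.
move=> f cf; under [X in clos X]eq_fun do rewrite -mulrA.
by apply: hm; exact: hm'.
Qed.

Lemma multiplierX m n : multiplier m -> multiplier (fun x => m x ^+ n).
Proof.
move=> mm; elim: n => [|n ih]; first exact: multiplier_cst.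
by under [X in multiplier X]eq_fun do rewrite exprS; exact: multiplierM.
Qed.

Lemma multiplier_prod N (m : nat -> RT -> C) : (forall n, multiplier (m n)) ->
  multiplier (fun x => \prod_(n < N) m n x).
Proof.
move=> mm; elim: N => [|N ih].
  by under [X in multiplier X]eq_fun do rewrite big_ord0; exact: multiplier_cst.
by under [X in multiplier X]eq_fun do rewrite big_ord_recr; exact: multiplierM.
Qed.

Lemma multiplier_poly m (M : R) : cmeas m -> (forall x, sqn (m x) <= M) ->
  (forall q, clos (fun x => m x * evR q x)) -> multiplier m.
Proof.
move=> mm bM mq; split => //; first by exists M.
move=> f [fL fc]; apply: clos_lim; first exact: L2_bounded mm bM fL.
have M0 : 0 <= M by exact: le_trans (sqn_ge0 _) (bM 0).
move=> eps eps0; have [|q fq] := fc (eps / (M + 1)).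
  by rewrite divr_gt0// ltr_wpDl.
exists (fun x => m x * evR q x); split; first exact: mq.
under [X in norm2 _ X]eq_fun do rewrite -mulrBr.
apply: le_lt_trans (norm2_mulB mm bM (L2B fL (polyL2 q))) _ => //.
have n0 := norm2_ge0 rho (fun x => f x - evR q x).
rewrite ltr_pdivlMr ?ltr_wpDl// in fq; nra.
Qed.

Lemma multiplier_lim (m_ : nat -> RT -> C) m (M : R) : (forall k, multiplier (m_ k)) ->
  cmeas m -> (forall k x, sqn (m_ k x) <= M) -> (forall x, sqn (m x) <= M) ->
  (forall x, sqn (m x - m_ k x) @[k --> \oo] --> (0 : R)) -> multiplier m.
Proof.
move=> mm_ mm bM_ bM m0; split => //; first by exists M.
move=> f cf; have [fL _] := cf.
apply: (@clos_cvg (fun k x => m_ k x * f x) _ (fun x => 4 * M * sqn (f x))).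
- by move=> k; have [_ _] := mm_ k; apply.
- exact: L2_bounded mm bM fL.
- move=> x; under eq_fun do rewrite -mulrBl sqnM.
  have -> : 0 = 0 * sqn (f x) :> R by rewrite mul0r.
  by apply: cvgM; [exact: m0|exact: cvg_cst].
- move=> k x; rewrite -mulrBl sqnM ler_wpM2r ?sqn_ge0//.
  apply: le_trans (sqnD_le _ _) _; rewrite sqnN.
  by have := bM x; have := bM_ k x; lra.
- by case: fL => _ f2; exact: integrableRZ.
Qed.

Definition cind (A : set RT) (x : RT) : C := (\1_A x : R)%:C.

Lemma sqn_cind_le A x : sqn (cind A x) <= 1.
Proof.
by rewrite /cind sqn_real indicE; case: (_ \in _); rewrite ?expr1n ?expr0n.
Qed.

Lemma cmeas_cind A : measurable A -> cmeas (cind A).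
Proof. by move=> mA; apply: cmeas_real; exact: measurable_indic. Qed.

Section CauchyInClosure.
Variable z : C.
Hypothesis z0 : complex.Im z != 0.
Hypothesis cauchy_clos : clos (cauchy z).

(** For a polynomial [q], [(q(x) - q(z)) / (x - z)] is again a polynomial, so [q / (x - z)]
    differs from it by a multiple of the Cauchy kernel. *)
Lemma multiplier_cauchy : multiplier (cauchy z).
Proof.
apply: (@multiplier_poly _ (complex.Im z ^+ 2)^-1).
- by apply: ctempered_cmeas; exact: ctempered_cauchy.
- by move=> x; exact: sqn_cauchy_le.
move=> q; have /factor_theorem[psi hpsi] : root (q - q.[z]%:P) z.
  by rewrite /root !hornerE subrr.
have -> : (fun x => cauchy z x * evR q x) = fun x => evR psi x + q.[z] * cauchy z x.
  apply/funext => x; rewrite /evR.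
  have -> : q.[(x : R)%:C] = psi.[(x : R)%:C] * ((x : R)%:C - z) + q.[z].
    by rewrite -hornerXsubC -hornerM -hpsi hornerD hornerN hornerC subrK.
  transitivity (psi.[(x : R)%:C] * (((x : R)%:C - z) * cauchy z x) + q.[z] * cauchy z x).
    by ring.
  by rewrite cauchyE// mulr1.
by apply: closD; [exact: clos_poly|exact: closZ].
Qed.

Lemma multiplier_cauchyC : multiplier (fun x => (cauchy z x)^*).
Proof.
have [mc [M bM] hc] := multiplier_cauchy; split; first exact: cmeas_conj.
  by exists M => x; rewrite sqn_conj.
move=> f /clos_conj/hc/clos_conj; congr clos; apply/funext => x.
by rewrite rmorphM/= conjCK.
Qed.

(** The function [g = 1/2 + eps (x - al) / |x - z|^2] is a polynomial in the Cauchy kernel and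
    its conjugate; it takes values in the unit interval and compares with [1/2] as [x] does
    with [al]. The powers [(1 - g^n)^(n 2^n)] tend to one where [g < 1/2] and to zero where
    [g >= 1/2], by Bernoulli's inequality in both cases, since the number of factors times [g^n]
    is [n (2 g)^n]. *)
Lemma multiplier_ray (al : R) : multiplier (cind `]-oo, al[%classic).
Proof.
pose r (x : R) : R := (x - al) * sqn (cauchy z x).
have rE x : (r x)%:C = cauchy z x * (1 + (z^* - al%:C) * (cauchy z x)^*).
  have : ((x : R)%:C - z^*) * (cauchy z x)^* = 1.
    have := congr1 (@Num.conj _) (cauchyE x z0).
    by rewrite rmorphM/= rmorphB/= rmorph1 [(_%:C)^*]conjE conjc_real.
  move=> <-; rewrite /r rmorphM/= rmorphB/= -mul_conj; ring.
pose Y := (complex.Im z ^+ 2)^-1.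
have Y0 : 0 <= Y by rewrite invr_ge0 sqr_ge0.
pose K := Y * (2 + 2 * (sqn (z^* - al%:C) * Y)).
have rK x : r x ^+ 2 <= K.
  rewrite -sqn_real rE sqnM ler_pM ?sqn_ge0 ?sqn_cauchy_le//.
  apply: le_trans (sqnD_le _ _) _; rewrite sqn1 mulr1 lerD2l ler_pM2l//.
  by rewrite sqnM sqn_conj ler_wpM2l ?sqn_ge0// sqn_cauchy_le.
have K0 : 0 <= K by exact: le_trans (sqr_ge0 _) (rK 0).
(* Any [eps] with [eps * |r| <= 1/4] would do. *)
pose eps := (4 * (1 + K))^-1.
have eps0 : 0 < eps by rewrite invr_gt0 mulr_gt0// ltr_pwDl.
pose g (x : R) : R := 2^-1 + eps * r x.
have er x : `|eps * r x| <= 4^-1.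
  rewrite normrM gtr0_norm// /eps invfM -mulrA ler_piMr// ler_pdivrMl ?ltr_pwDl// mulr1.
  have := rK x; rewrite ler_norml => h; apply/andP; split; nra.
have g01 x : 0 <= g x <= 1.
  have := er x; rewrite /g ler_norml => /andP[? ?]; apply/andP; split; lra.
have mg : multiplier (fun x => (g x)%:C).
  have -> : (fun x : RT => (g x)%:C) = fun x => (2^-1)%:C + eps%:C *
      (cauchy z x * (1 + (z^* - al%:C) * (cauchy z x)^*)).
    by apply/funext => x; rewrite -rE /g rmorphD/= rmorphM.
  have hc := multiplier_cauchy; have hcc := multiplier_cauchyC.
  apply: multiplierD; first exact: multiplier_cst.
  apply: multiplierM; first exact: multiplier_cst.
  apply: multiplierM => //; apply: multiplierD; first exact: multiplier_cst.
  by apply: multiplierM => //; exact: multiplier_cst.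
pose s n (x : R) : R := (1 - g x ^+ n) ^+ (n * 2 ^ n).
have ms n : multiplier (fun x => (s n x)%:C).
  have -> : (fun x : RT => (s n x)%:C) =
      fun x => (1 + (-1) * (g x)%:C ^+ n) ^+ (n * 2 ^ n).
    apply/funext => x; rewrite /s rmorphXn/=; congr (_ ^+ _).
    by rewrite rmorphB/= rmorph1 rmorphXn/= mulN1r.
  apply: multiplierX; apply: multiplierD; first exact: multiplier_cst.
  by apply: multiplierM; [exact: multiplier_cst|exact: multiplierX].
have gn01 x n : 0 <= g x ^+ n <= 1.
  by case/andP: (g01 x) => h0 h1; rewrite exprn_ge0//= exprn_ile1.
have s01 n x : 0 <= s n x <= 1.
  case/andP: (gn01 x n) => h0 h1.
  by rewrite /s exprn_ge0 ?subr_ge0//= exprn_ile1 ?subr_ge0// gerBl.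
have hx x : 0 < sqn (cauchy z x).
  by rewrite /cauchy sqnV invr_gt0 lt0r sqn_ge0 sqn_eq0 real_sub_neq0.
have s_lim (x : R) : s n x @[n --> \oo] --> (\1_(`]-oo, al[%classic) x : R).
  case/andP: (g01 x) => h0 h1.
  have [xa|ax] := ltP x al.
    have -> : \1_(`]-oo, al[%classic) x = 1 :> R by rewrite indicE mem_set//= in_itv/= xa.
    have gh : 2 * g x < 1.
      have : eps * r x < 0 by rewrite pmulr_rlt0// /r pmulr_llt0// subr_lt0.
      rewrite /g; lra.
    apply: (@squeeze_cvgr _ _ _ _ (fun n => 1 - n%:R * (2 * g x) ^+ n) (fun=> 1)).
    - apply: nearW => n; have /andP[_ ->] := s01 n x; rewrite andbT.
      have bern N (t : R) : 0 <= t <= 1 -> 1 - N%:R * t <= (1 - t) ^+ N.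
        move=> /andP[t0 t1]; elim: N => [|N ih]; first by rewrite mul0r subr0 expr0.
        rewrite exprS; apply: (@le_trans _ _ ((1 - t) * (1 - N%:R * t))).
          have := ler0n R N; rewrite -natr1; move: (N%:R : R) => a a0.
          have := mulr_ge0 a0 (sqr_ge0 t); lra.
        by rewrite ler_wpM2l// subr_ge0.
      apply: le_trans (bern _ _ (gn01 x n)).
      by rewrite exprMn natrM natrX mulrA.
    - rewrite -[X in _ --> X]subr0; apply: cvgB; first exact: cvg_cst.
      by apply: cvg_expr_natmul; rewrite gh mulr_ge0.
    - exact: cvg_cst.
  have -> : \1_(`]-oo, al[%classic) x = 0 :> R.
    by rewrite indicE memNset//= in_itv/= ltNge ax.
  have gh : 1 <= 2 * g x.
    have : 0 <= eps * r x by rewrite pmulr_rge0// /r pmulr_lge0// subr_ge0.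
    rewrite /g; lra.
  apply: (@squeeze_cvgr _ _ _ _ (fun=> 0) (fun n => n.+1%:R^-1)).
  - apply: nearW => n; have /andP[-> _] := s01 n x; rewrite /=.
    have bern N (t : R) : 0 <= t <= 1 -> (1 - t) ^+ N * (1 + N%:R * t) <= 1.
      move=> /andP[t0 t1]; elim: N => [|N ih]; first by rewrite mul0r addr0 expr0 mulr1.
      apply: le_trans ih; rewrite exprS -mulrA mulrCA ler_wpM2l ?exprn_ge0 ?subr_ge0//.
      have := ler0n R N; rewrite -natr1; move: (N%:R : R) => a a0.
      have := mulr_ge0 a0 (sqr_ge0 t); nra.
    have := bern (n * 2 ^ n)%N _ (gn01 x n); rewrite -/(s n x).
    have h : n.+1%:R <= 1 + (n * 2 ^ n)%:R * g x ^+ n :> R.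
      rewrite -natr1 addrC lerD2l natrM natrX -mulrA -exprMn.
      by rewrite ler_peMr// exprn_ege1.
    move=> h'; rewrite -div1r ler_pdivlMr//.
    apply: le_trans h'; rewrite ler_wpM2l//.
    by case/andP: (s01 n x).
  - exact: cvg_cst.
  - exact: cvg_harmonic.
apply: (@multiplier_lim (fun n x => (s n x)%:C) _ 1) => //.
- by apply: cmeas_cind; exact: measurable_itv.
- move=> n x; rewrite sqn_real exprn_ile1//; [by case/andP: (s01 n x)..].
- by move=> x; exact: sqn_cind_le.
- move=> x; rewrite /cind; under eq_fun do rewrite -rmorphB/= sqn_real expr2.
  have h : \1_(`]-oo, al[%classic) x - s n x @[n --> \oo] --> (0 : R).
    have -> : 0 = \1_(`]-oo, al[%classic) x - \1_(`]-oo, al[%classic) x :> R by rewrite subrr.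
    by apply: cvgB; [exact: cvg_cst|exact: s_lim].
  have -> : 0 = 0 * 0 :> R by rewrite mul0r.
  exact: (cvgM h h).
Qed.

(** Sets whose indicator is a multiplier form a sigma-algebra: for a union, the indicator is
    the limit of [1 - \prod_(i < n) (1 - 1_(A i))]. It contains the half-lines. *)
Lemma multiplier_cind A : measurable A -> multiplier (cind A).
Proof.
suff : (@measurable _ RT) `<=` [set A | measurable (A : set RT) /\ multiplier (cind A)].
  by move=> h mA; have [] := h _ mA.
clear A; rewrite [X in X `<=` _](RGenInftyO.measurableE R); apply: smallest_sub; last first.
  move=> _ [al ->]; split; first exact: measurable_itv.
  exact: multiplier_ray.
split.
- split; first exact: measurable0.
  have := multiplier_cst 0; congr multiplier; apply/funext => x.
  by rewrite /cind indic0.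
- move=> A [mA hA]; rewrite setTD; split; first exact: measurableC.
  have := multiplierD (multiplier_cst 1) (multiplierM (multiplier_cst (-1)) hA).
  congr multiplier; apply/funext => x; rewrite /cind !indicE in_setC mulN1r.
  by case: (x \in A); rewrite /= ?subrr ?subr0.
- move=> A hA; have mA n : measurable (A n : set RT) by case: (hA n).
  have mU : measurable (\bigcup_k A k : set RT) by exact: bigcupT_measurable.
  split => //.
  pose m n (x : RT) : C := 1 + (-1) * \prod_(i < n) (1 + (-1) * cind (A i) x).
  have m01 n x : m n x = (`[< exists2 i, (i < n)%N & A i x >])%:R.
    rewrite /m; case: asboolP => [[i iN Aix]|h].
      by rewrite (bigD1 (Ordinal iN))//= {1}/cind indicE mem_set//= mulr1 subrr mul0r mulr0 addr0.
    rewrite big1 ?mulr1 ?subrr// => i _; rewrite /cind indicE memNset/= ?mulr0 ?addr0// => Aix.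
    by apply: h; exists i.
  apply: (@multiplier_lim m _ 1).
  + move=> n; apply: multiplierD; first exact: multiplier_cst.
    apply: multiplierM; first exact: multiplier_cst.
    apply: (multiplier_prod n (m := fun i x => 1 + -1 * cind (A i) x)) => i.
    apply: multiplierD; first exact: multiplier_cst.
    by apply: multiplierM; [exact: multiplier_cst|case: (hA i)].
  + exact: cmeas_cind.
  + by move=> n x; rewrite m01; case: asboolP => _; rewrite ?sqn1 ?sqn0.
  + by move=> x; exact: sqn_cind_le.
  + move=> x; apply: cvg_near_cst.
    have [[i _ Aix]|h] := pselect ((\bigcup_k A k) x).
      exists i.+1 => // n /= iN; rewrite m01 /cind indicE mem_set; last by exists i.
      have -> : `[< exists2 i, (i < n)%N & A i x >] by apply/asboolP; exists i.
      by rewrite subrr sqn0.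
    apply: nearW => n; rewrite m01 /cind indicE memNset//.
    have -> : `[< exists2 i, (i < n)%N & A i x >] = false.
      by apply/asboolPn => -[i _ Aix]; apply: h; exists i.
    by rewrite subrr sqn0.
Qed.

Lemma clos_cind A : measurable A -> clos (cind A).
Proof.
move=> /multiplier_cind[_ _ /(_ _ (clos_poly 1))]; congr clos; apply/funext => x.
by rewrite /evR hornerC mulr1.
Qed.

Import HBNNSimple.

(** Simple functions increasing to [u] converge to it in the L2 sense, with the square of [u] as a
    dominating function. *)
Lemma clos_nonneg (u : RT -> R) : measurable_fun [set: RT] u -> (forall x, 0 <= u x) ->
  L2 rho (fun x => (u x)%:C) -> clos (fun x => (u x)%:C).
Proof.
move=> mu u0 uL.
have mEu : measurable_fun [set: RT] (EFin \o u) by apply/measurable_EFinP.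
pose u_ := nnsfun_approx measurableT mEu.
have ndu : nondecreasing_seq (u_ : (RT -> R)^nat) by exact: nd_nnsfun_approx.
have u_u x : u_ n x @[n --> \oo] --> u x.
  apply: (@fine_cvg _ _ _ _ (EFin \o u_^~ x)).
  by apply: (cvg_nnsfun_approx measurableT mEu) => // y _; rewrite lee_fin.
have le_u n x : u_ n x <= u x.
  rewrite -(cvg_lim _ (u_u x))//; apply: nondecreasing_cvgn_le; last by apply/cvg_ex; exists (u x).
  by move=> a b ab; have /lefP := ndu _ _ ab; apply.
have u_0 n x : 0 <= u_ n x by [].
apply: (@clos_cvg (fun n x => (u_ n x)%:C) _ (fun x => sqn (u x)%:C)).
- move=> n.
  have [N [c uc]] : exists N (c : nat -> R), forall x,
      u_ n x = \sum_(i < N) c i * \1_(u_ n @^-1` [set c i]) x.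
    by eexists; exists (nth 0 (finmap.enum_fset (fset_set (u_ n @` setT)))); exact: fimfunEord.
  have -> : (fun x : RT => (u_ n x)%:C) = fun x =>
      \sum_(i < N) (c i)%:C * cind (u_ n @^-1` [set c i]) x.
    by apply/funext => x; rewrite uc rmorph_sum; apply: eq_bigr => i _; rewrite rmorphM.
  apply: (@clos_sum _ (fun i x => (c i)%:C * cind (u_ n @^-1` [set c i]) x)) => i.
  by apply: closZ; apply: clos_cind.
- exact: uL.
- move=> x; under eq_fun do rewrite -rmorphB/= sqn_real expr2.
  have h : u x - u_ n x @[n --> \oo] --> (0 : R).
    have -> : 0 = u x - u x :> R by rewrite subrr.
    by apply: cvgB; [exact: cvg_cst|exact: u_u].
  have -> : 0 = 0 * 0 :> R by rewrite mul0r.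
  exact: (cvgM h h).
- move=> n x; rewrite -rmorphB/= !sqn_real.
  by have := le_u n x; have := u_0 n x; have := u0 x; nra.
- by case: uL.
Qed.

Lemma clos_real (u : RT -> R) : L2 rho (fun x => (u x)%:C) -> clos (fun x => (u x)%:C).
Proof.
move=> uL; have mu : measurable_fun [set: RT] u by case: uL => -[].
have h (w : RT -> R) : measurable_fun [set: RT] w -> (forall x, 0 <= w x) ->
    (forall x, w x ^+ 2 <= u x ^+ 2) -> clos (fun x => (w x)%:C).
  move=> mw w0 wu; apply: clos_nonneg => //; split; first exact: cmeas_real.
  apply: (le_integrableR (v := fun x => sqn (u x)%:C)).
  - by apply: cmeas_sqn; exact: cmeas_real.
  - by move=> x; rewrite ger0_norm ?sqn_ge0// !sqn_real.
  - by case: uL.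
have -> : (fun x => (u x)%:C) = fun x => (Num.max (u x) 0)%:C + (-1) * (Num.max (- u x) 0)%:C.
  apply/funext => x; rewrite mulN1r -rmorphB/=; congr (_%:C).
  by have [h1|h1] := leP (u x) 0; have [h2|h2] := leP (- u x) 0; lra.
apply: closD; last apply: closZ.
- apply: h => [|x|x]; first exact: measurable_maxr.
    by rewrite le_max lexx orbT.
  by have [h1|h1] := leP (u x) 0; nra.
- apply: h => [|x|x]; first by apply: measurable_maxr => //; exact: measurableT_comp.
    by rewrite le_max lexx orbT.
  by have [h1|h1] := leP (- u x) 0; nra.
Qed.

(** A single Cauchy kernel in the closure of the polynomials suffices for density, as it
    makes all indicators multipliers, hence members of the closure. *)
Theorem clos_L2 f : L2 rho f -> clos f.
Proof.
move=> [[mR mI] f2].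
have -> : f = fun x => (complex.Re (f x))%:C + 'i%C * (complex.Im (f x))%:C.
  by apply/funext => x; rewrite -complexE.
have f2m : measurable_fun [set: RT] (fun x => sqn (f x)) by apply: cmeas_sqn; split.
apply: closD; last apply: closZ.
- apply: clos_real; split; first exact: cmeas_real.
  apply: (le_integrableR (v := fun x => sqn (f x))) => //.
  + by apply: cmeas_sqn; exact: cmeas_real.
  + move=> x; rewrite ger0_norm ?sqn_ge0// sqn_real sqnE lerDl; exact: sqr_ge0.
- apply: clos_real; split; first exact: cmeas_real.
  apply: (le_integrableR (v := fun x => sqn (f x))) => //.
  + by apply: cmeas_sqn; exact: cmeas_real.
  + move=> x; rewrite ger0_norm ?sqn_ge0// sqn_real sqnE lerDr; exact: sqr_ge0.
Qed.

End CauchyInClosure.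
End Density.

(** * Existence and uniqueness of the solution on the real line *)

Section Determinacy.
Variable R : realType.
Local Notation C := R[i].
Local Notation RT := (measurableTypeR R).

Section MeasureAdd.
Variables mu nu : {measure set RT -> \bar R}.
Local Notation sigma := (measure_add mu nu).

Lemma L2_measure_add (f : RT -> C) : L2 mu f -> L2 nu f -> L2 sigma f.
Proof.
move=> [mf /integrableP[m1 i1]] [_ /integrableP[_ i2]]; split => //.
apply/integrableP; split => //.
rewrite ge0_integral_measure_add//; last exact: measurableT_comp.
exact: lte_add_pinfty.
Qed.

Lemma norm2_measure_add (f : RT -> C) : L2 mu f -> L2 nu f ->
  norm2 sigma f = norm2 mu f + norm2 nu f.
Proof.
move=> f1 f2; have f3 := L2_measure_add f1 f2; case: (f1) => mf _.
have h : (\int[sigma]_x (sqn (f x))%:E =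
    \int[mu]_x (sqn (f x))%:E + \int[nu]_x (sqn (f x))%:E)%E.
  rewrite ge0_integral_measure_add// => [x _|]; first by rewrite lee_fin sqn_ge0.
  by apply/measurable_EFinP; exact: cmeas_sqn.
by apply: EFin_inj; rewrite EFinD !norm2E.
Qed.

Lemma L2_measure_addl (f : RT -> C) : L2 sigma f -> L2 mu f /\ L2 nu f.
Proof.
move=> [mf /integrableP[m1]].
rewrite ge0_integral_measure_add//; last exact: measurableT_comp.
move=> i12; split; split => //; apply/integrableP; split => //;
  apply: le_lt_trans i12.
  by apply: leeDl; exact: integral_ge0.
by apply: leeDr; exact: integral_ge0.
Qed.

End MeasureAdd.

Variables (p : nat -> {poly C}) (c : nat -> C) (d : nat -> R).
Hypothesis sizep : forall n, size (p n) = n.+1.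
Hypothesis p0 : p 0%N = 1.
Hypothesis c0 : forall n, c n != 0.
Hypothesis rec : forall n, 'X * p n =
  (shift_prev c n)^* *: shift_prev p n + (d n)%:C *: p n + c n *: p n.+1.
Local Notation e := (fun n => evR (p n)).

Definition bounded_at (z : C) := exists S : R, forall N, \sum_(k < N) sqn (p k).[z] <= S.

Lemma evR_sum N (a : nat -> C) x :
  evR (\sum_(i < N) a i *: p i) x = \sum_(i < N) a i * e i x.
Proof. by rewrite /evR horner_sum; apply: eq_bigr => i _; rewrite hornerZ. Qed.

Lemma solution_poly rho q : solution p rho -> L2 rho (evR q).
Proof.
move=> [sL _]; have [a ->] := poly_span sizep (leqnn (size q)).
have := @L2_sum _ _ _ rho (size q) (fun i x => a i * e i x) (fun n _ => L2Z (a n) (sL n)).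
by congr L2; apply/funext => x; rewrite evR_sum.
Qed.

Lemma solution_cauchy rho z : complex.Im z != 0 -> solution p rho -> L2 rho (cauchy z).
Proof.
move=> z0 [sL _].
have hm : cmeas (cauchy z) by apply: ctempered_cmeas; exact: ctempered_cauchy.
have := L2_bounded hm (fun x => sqn_cauchy_le x z0) (sL 0%N).
by congr L2; apply/funext => x; rewrite p0 /evR -polyC1 hornerC mulr1.
Qed.

(** When the kernel sums at [z] diverge, there are polynomials [r] with [r(z) = 1] of
    arbitrarily small norm, and then [(1 - r) / (x - z)] is a polynomial close to the
    Cauchy kernel. *)
Lemma unbounded_cauchy z : complex.Im z != 0 -> ~ bounded_at z ->
  forall eps : R, 0 < eps -> exists q, forall rho, solution p rho ->
    norm2 rho (fun x => cauchy z x - evR q x) < eps.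
Proof.
move=> z0 nb eps eps0.
pose M := (complex.Im z ^+ 2)^-1.
have M0 : 0 < M by rewrite invr_gt0 exprn_even_gt0.
have [N KN] : exists N, M / eps < \sum_(k < N) sqn (p k).[z].
  apply: contrapT => h; apply: nb; exists (M / eps) => N; rewrite leNgt; apply/negP => hN.
  by apply: h; exists N.
set K := \sum_(k < N) _ in KN.
have K0 : 0 < K by apply: lt_trans KN; rewrite divr_gt0.
(* The minimizer of the norm among combinations with value one at [z]; its squared norm is
   [1 / K]. *)
pose a k := K^-1%:C * ((p k).[z])^*.
pose r := \sum_(k < N) a k *: p k.
have rz : r.[z] = 1.
  rewrite /r horner_sum -(rmorph1 (@real_complex R)) -(mulVf (x := K)) ?gt_eqF// rmorphM/=.
  rewrite /K rmorph_sum/= mulr_sumr; apply: eq_bigr => k _.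
  by rewrite hornerZ -mul_conj /a; ring.
have /factor_theorem[psi hpsi] : root (r - 1) z by rewrite /root hornerD hornerN rz -polyC1 hornerC subrr.
exists (- psi) => rho srho; have [sL sO] := srho.
have -> : (fun x => cauchy z x - evR (- psi) x) = fun x => cauchy z x * evR r x.
  apply/funext => x; rewrite /evR hornerN opprK.
  have -> : r.[(x : R)%:C] = psi.[(x : R)%:C] * ((x : R)%:C - z) + 1.
    by rewrite -hornerXsubC -hornerM -hpsi hornerD hornerN -polyC1 hornerC subrK.
  transitivity (psi.[(x : R)%:C] * (((x : R)%:C - z) * cauchy z x) + cauchy z x); last by ring.
  by rewrite cauchyE// mulr1 addrC.
have hm : cmeas (@cauchy R z) by apply: ctempered_cmeas; exact: ctempered_cauchy.
apply: le_lt_trans (norm2_mulB hm (fun x => sqn_cauchy_le x z0) (solution_poly r srho)) _.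
have -> : norm2 rho (evR r) = K^-1.
  have := @norm2_orthonormal_sum _ _ _ rho e N a (fun n _ => sL n) (fun m n _ _ => sO m n).
  have -> : (fun x => \sum_(n < N) a n * evR (p n) x) = evR r by apply/funext => x; rewrite evR_sum.
  move=> ->; under eq_bigr do rewrite sqnM sqn_real sqn_conj.
  by rewrite -mulr_sumr -/K expr2 -mulrA mulVf ?mulr1// gt_eqF.
by rewrite ltr_pdivrMr// -ltr_pdivrMl// mulrC.
Qed.


(** The limit of the Gaussian measures with parameter zero has the Cauchy kernel of ['i] or
    of [- 'i] in the closure of the polynomials, by [gauss_limit_cauchy] or by
    [unbounded_cauchy] according to the boundedness of the kernel sums. *)
Theorem dense_solution : exists rho, solution p rho /\ forall f, L2 rho f -> clos rho f.
Proof.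
have [P gP] : exists P : nat -> probability RT R, forall n, gauss p c n 0 (P n).
  exists (fun n => projT1 (cid (gauss_exists p0 c0 rec n 0))) => n.
  exact: projT2 (cid (gauss_exists p0 c0 rec n 0)).
have [phi [rho [phik cP]]] := @gauss_subseq_cvg _ p c sizep id (fun=> 0) P (fun=> leqnn _) gP.
have gP' k : gauss p c (phi k) 0 ((P \o phi) k) by exact: gP.
have srho := @gauss_limit_solution _ p c phi (fun=> 0) _ _ phik gP' cP.
exists rho; split => // f.
pose z : C := 'i%C.
have z0 : complex.Im z != 0 by rewrite /= oner_eq0.
have z0' : complex.Im z^* != 0 by rewrite Im_conj oppr_eq0.
have pL := fun q => solution_poly q srho.
have [[S hS]|nb] := pselect (bounded_at z^*).
  apply: (clos_L2 pL z0); split; first exact: solution_cauchy.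
  move=> eps eps0.
  have [N [a h]] := @gauss_limit_cauchy _ p c d p0 c0 rec z z0 phi (fun=> 0) _ rho S
    phik gP' cP hS eps eps0.
  by exists (\sum_(k < N) a k *: p k); under [X in norm2 _ X]eq_fun do rewrite evR_sum.
apply: (clos_L2 pL z0'); split; first exact: solution_cauchy.
move=> eps eps0; have [q hq] := unbounded_cauchy z0' nb eps0.
by exists q; exact: hq.
Qed.

Lemma solution_mass rho : solution p rho -> rho [set: RT] = 1%E.
Proof.
move=> [sL sO]; have := ipff (sL 0%N); rewrite sO eqxx => h.
have := norm2E (sL 0%N).
have -> : norm2 rho (e 0%N) = 1 by apply: complexI; rewrite -h.
under eq_integral do rewrite p0 /evR -polyC1 hornerC sqn1.
by rewrite integral_cst// mul1e => <-.
Qed.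

Lemma bessel1 rho f : solution p rho -> L2 rho f -> sqn (ip rho f (e 0%N)) <= norm2 rho f.
Proof.
move=> [sL sO] fL.
have := @norm2_sub_orthonormal _ _ _ rho e f 1 (fun k => ip rho f (e k))
  (fun n _ => sL n) (fun m n _ _ => sO m n) fL.
rewrite !big_ord1 subrr sqn0 addr0 => h.
by rewrite -subr_ge0 -h norm2_ge0.
Qed.

Lemma ip_poly_solution mu nu q : solution p mu -> solution p nu ->
  ip mu (evR q) (e 0%N) = ip nu (evR q) (e 0%N).
Proof.
have [a ->] := poly_span sizep (leqnn (size q)).
suff h rho : solution p rho ->
    ip rho (evR (\sum_(i < size q) a i *: p i)) (e 0%N) = \sum_(i < size q) a i * (i == 0 :> nat)%:R.
  by move=> /h -> /h ->.
move=> [sL sO].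
have -> : evR (\sum_(i < size q) a i *: p i) = fun x => \sum_(i < size q) a i * e i x.
  by apply/funext => x; rewrite evR_sum.
rewrite (@ip_sum _ _ _ rho (size q) a e)//.
by apply: eq_bigr => i _; rewrite sO.
Qed.

(** The polynomials are dense for the sum of two solutions, so indicators are
    approximated by the same polynomial for both. *)
Theorem solution_unique z mu nu : complex.Im z != 0 -> ~ bounded_at z ->
  solution p mu -> solution p nu -> forall A, measurable A -> mu A = nu A.
Proof.
move=> z0 nb smu snu A mA.
pose sigma := measure_add mu nu.
have pL q : L2 sigma (evR q) by apply: L2_measure_add; exact: solution_poly.
have cc : clos sigma (cauchy z).
  split; first by apply: L2_measure_add; exact: solution_cauchy.
  move=> eps eps0; have e4 : 0 < eps / 4 by rewrite divr_gt0.
  have [q hq] := unbounded_cauchy z0 nb e4; exists q.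
  have h rho : solution p rho -> L2 rho (fun x => cauchy z x - evR q x).
    by move=> s; apply: L2B; [exact: solution_cauchy|exact: solution_poly].
  rewrite norm2_measure_add; [|exact: h..].
  have := hq _ smu; have := hq _ snu; lra.
have [AL Ac] := clos_cind pL z0 cc mA.
have [AL1 AL2] := L2_measure_addl AL.
have ipA rho : solution p rho -> L2 rho (cind A) ->
    rho A = (complex.Re (ip rho (cind A) (e 0%N)))%:E.
  move=> srho ALr; rewrite /ip /cint /=.
  under eq_Rintegral do rewrite p0 /evR -polyC1 hornerC rmorph1 mulr1 /cind /=.
  rewrite /Rintegral integral_indic// setIT fineK// ge0_fin_numE//.
  apply: le_lt_trans (_ : rho setT < +oo)%E; first by apply: le_measure; rewrite ?inE.
  by rewrite solution_mass// ltry.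
rewrite (ipA mu)// (ipA nu)//; congr (complex.Re _)%:E.
apply/eqP; rewrite -subr_eq0 -sqn_eq0 eq_le sqn_ge0 andbT.
apply/ler_addgt0Pr => eps eps0; rewrite add0r.
have e4 : 0 < eps / 4 by rewrite divr_gt0.
have [q hq] := Ac _ e4.
have D1 := L2B AL1 (solution_poly q smu); have D2 := L2B AL2 (solution_poly q snu).
rewrite norm2_measure_add// in hq.
have ipB rho : solution p rho -> L2 rho (cind A) ->
   ip rho (cind A) (e 0%N) = ip rho (fun x => cind A x - evR q x) (e 0%N) + ip rho (evR q) (e 0%N).
  move=> srho ALr; have [sL _] := srho.
  rewrite -ipDl//; [|by apply: L2B => //; exact: solution_poly|exact: solution_poly].
  by apply: eq_cint => x; rewrite subrK.
rewrite (ipB mu)// (ipB nu)// (ip_poly_solution q smu snu).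
rewrite opprD addrACA subrr addr0.
apply: le_trans (sqnD_le _ _) _; rewrite sqnN.
have := bessel1 smu D1; have := bessel1 snu D2.
have := norm2_ge0 mu (fun x => cind A x - evR q x).
have := norm2_ge0 nu (fun x => cind A x - evR q x).
lra.
Qed.

(** Along a common subsequence, the Gaussian measures with parameter zero and those with
    the parameter of [two_gauss] converge to two solutions. Their Cauchy transforms
    differ, since the distance in [two_gauss] stays away from zero when the kernel sums
    are bounded. *)
Theorem solution_nonunique z : complex.Im z != 0 -> bounded_at z ->
  exists mu nu, [/\ solution p mu, solution p nu &
    exists2 A, measurable A & mu A <> nu A].
Proof.
move=> z0; rewrite -[z]conjCK; set w := z^* => -[S hS].
have w0 : complex.Im w != 0 by rewrite Im_conj oppr_eq0.
have [P gP] : exists P : nat -> probability RT R, forall n, gauss p c n 0 (P n).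
  exists (fun n => projT1 (cid (gauss_exists p0 c0 rec n 0))) => n.
  exact: projT2 (cid (gauss_exists p0 c0 rec n 0)).
have [tau htau] : exists tau : nat -> R, forall n P', gauss p c n (tau n) P' ->
  1 <= sqn (cint P' (cauchy w) - cint (P n) (cauchy w)) *
       (2 * (complex.Im w * \sum_(j < n.+1) sqn (p j).[w^*]) ^+ 2).
  pose h n := two_gauss p0 c0 rec w0 (gP n).
  exists (fun n => projT1 (cid (h n))) => n.
  exact: projT2 (cid (h n)).
have [P' gP'] : exists P' : nat -> probability RT R, forall n, gauss p c n (tau n) (P' n).
  exists (fun n => projT1 (cid (gauss_exists p0 c0 rec n (tau n)))) => n.
  exact: projT2 (cid (gauss_exists p0 c0 rec n (tau n))).
have [phi [mu [phik cP]]] := @gauss_subseq_cvg _ p c sizep id (fun=> 0) P (fun=> leqnn _) gP.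
have [phi2 [nu [phi2k cP']]] := @gauss_subseq_cvg _ p c sizep phi (tau \o phi) (P' \o phi)
  phik (fun k => gP' (phi k)).
have {}cP := moment_cvg_subseq phi2k cP.
pose psi k := phi (phi2 k).
have psik k : (k <= psi k)%N by rewrite (leq_trans (phi2k k)).
have smu := @gauss_limit_solution _ p c psi (fun=> 0) _ mu psik (fun k => gP (psi k)) cP.
have snu := @gauss_limit_solution _ p c psi (tau \o psi) _ nu psik (fun k => gP' (psi k)) cP'.
exists mu, nu; split => //.
apply: contrapT => hA.
have munu A : measurable A -> mu A = nu A.
  by move=> mA; apply: contrapT => hn; apply: hA; exists A.
have tc := ctempered_cauchy w0.
have [_ [cr ci]] := moment_cvg_cint cP tc.
have [_ [cr' ci']] := moment_cvg_cint cP' tc.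
have E : cint mu (cauchy w) = cint nu (cauchy w).
  by rewrite /cint /Rintegral; congr (fine _ +i* fine _)%C; apply: eq_measure_integral => A mA _;
    exact: munu.
rewrite -E in cr' ci'.
pose B := 2 * (complex.Im w * S) ^+ 2.
have S0 : 0 <= S by have := hS 0%N; rewrite big_ord0.
have B0 : 0 <= B by rewrite mulr_ge0// sqr_ge0.
have le1 k : 1 <= sqn (cint (P' (psi k)) (cauchy w) - cint (P (psi k)) (cauchy w)) * B.
  apply: le_trans (htau _ _ (gP' (psi k))) _; rewrite ler_wpM2l ?sqn_ge0//.
  rewrite /B ler_pM2l// !exprMn ler_wpM2l ?sqr_ge0//.
  have h0 : 0 <= \sum_(j < (psi k).+1) sqn (p j).[w^*] by apply: sumr_ge0 => j _; exact: sqn_ge0.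
  by rewrite ler_sqr ?nnegrE.
have c0' : sqn (cint (P' (psi k)) (cauchy w) - cint (P (psi k)) (cauchy w)) * B
    @[k --> \oo] --> (0 : R).
  have -> : 0 = ((complex.Re (cint mu (cauchy w)) - complex.Re (cint mu (cauchy w))) *
      (complex.Re (cint mu (cauchy w)) - complex.Re (cint mu (cauchy w))) +
      (complex.Im (cint mu (cauchy w)) - complex.Im (cint mu (cauchy w))) *
      (complex.Im (cint mu (cauchy w)) - complex.Im (cint mu (cauchy w)))) * B :> R.
    by rewrite !subrr !mul0r addr0 mul0r.
  have hr : complex.Re (cint (P' (psi k)) (cauchy w)) - complex.Re (cint (P (psi k)) (cauchy w))
      @[k --> \oo] --> complex.Re (cint mu (cauchy w)) - complex.Re (cint mu (cauchy w)).
    exact: cvgB cr' cr.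
  have hi : complex.Im (cint (P' (psi k)) (cauchy w)) - complex.Im (cint (P (psi k)) (cauchy w))
      @[k --> \oo] --> complex.Im (cint mu (cauchy w)) - complex.Im (cint mu (cauchy w)).
    exact: cvgB ci' ci.
  have sE (x y : C) : sqn (x - y) = (complex.Re x - complex.Re y) * (complex.Re x - complex.Re y) +
      (complex.Im x - complex.Im y) * (complex.Im x - complex.Im y).
    by rewrite sqnE; case: x => ? ?; case: y => ? ? /=; ring.
  under eq_fun do rewrite sE.
  apply: cvgM; last exact: cvg_cst.
  by apply: cvgD; [exact: (cvgM hr hr)|exact: (cvgM hi hi)].
have : 1 <= (0 : R).
  rewrite -(cvg_lim _ c0')//; apply: limr_ge; first by apply/cvg_ex; exists 0.
  exact: nearW.
by rewrite leNgt ltr01.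
Qed.

End Determinacy.

(** * Measures on the plane and on a line *)

Section BorelPlane.
Variable R : realType.
Local Notation C := R[i].
Local Notation RT := (measurableTypeR R).
Local Notation BC := (borelC R).

Lemma normE (z : C) : `|z| = (cmod z)%:C. Proof. by []. Qed.

Lemma cmod_real (t : R) : cmod t%:C = `|t|.
Proof. by rewrite /= expr0n/= addr0 sqrtr_sqr. Qed.

Lemma borelC_open (O : set C) : @open R[i]^o O -> measurable (O : set BC).
Proof. exact: sub_sigma_algebra. Qed.

Lemma cmod_ge_Re (z : C) : `|complex.Re z| <= cmod z.
Proof. by rewrite -lecR -normE; exact: normc_ge_Re. Qed.

Lemma cmod_ge_Im (z : C) : `|complex.Im z| <= cmod z.
Proof.
rewrite -sqrtr_sqr; case: z => x y /=; rewrite ler_wsqrtr// lerDr; exact: sqr_ge0.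
Qed.

Lemma lipschitz_measurable (f : C -> R) : (forall x y, `|f x - f y| <= cmod (x - y)) ->
  measurable_fun [set: BC] (f : BC -> RT).
Proof.
move=> lf; apply: (measurability _ (RGenInftyO.measurableE R)).
move=> _ [_ [al ->] <-]; rewrite setTI; apply: borelC_open.
rewrite openE => z /=; rewrite in_itv/= => fz.
apply/nbhs_ballP; exists (al - f z)%:C; first by rewrite /= ltcR subr_gt0.
move=> y; rewrite -ball_normE /= in_itv/= normE ltcR => zy.
have := le_lt_trans (lf z y) zy; rewrite ltr_norml => /andP[? ?]; lra.
Qed.

Lemma measurable_Re : measurable_fun [set: BC] (@complex.Re R : BC -> RT).
Proof. by apply: lipschitz_measurable => x y; rewrite -raddfB; exact: cmod_ge_Re. Qed.

Lemma measurable_Im : measurable_fun [set: BC] (@complex.Im R : BC -> RT).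
Proof. by apply: lipschitz_measurable => x y; rewrite -raddfB; exact: cmod_ge_Im. Qed.

Lemma continuous_chorner (q : {poly C}) : continuous (horner q : R[i]^o -> R[i]^o).
Proof.
elim/poly_ind: q => [|q k ih] x.
  have -> : horner 0 = (fun=> 0) :> (R[i]^o -> R[i]^o) by apply/funext => z; rewrite horner0.
  exact: cst_continuous.
have -> : horner (q * 'X + k%:P) = (fun z => q.[z] * z + k) :> (R[i]^o -> R[i]^o).
  by apply/funext => z; rewrite hornerMXaddC.
have h1 := @continuousM R[i] R[i]^o (horner q) id x (ih x) (@cvg_id _ _).
have h2 : {for x, continuous ((fun=> k) : R[i]^o -> R[i]^o)} by exact: cst_continuous.
exact: (@continuousD _ _ _ _ _ _ h1 h2).
Qed.

Lemma measurable_chorner (q : {poly C}) : measurable_fun [set: BC] (horner q : BC -> BC).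
Proof.
refine (@measurability _ _ BC BC setT (horner q) (@open R[i]^o) erefl _).
move=> _ [U oU <-]; rewrite setTI; apply: borelC_open.
by move/continuousP: (@continuous_chorner q); apply.
Qed.

Section Line.
Variables a b : C.
Hypothesis a1 : `|a| = 1.

Definition on_line (t : R) : C := b + a * t%:C.
Definition line_coord (z : C) : R := complex.Re ((z - b) * a^-1).

Let a0 : a != 0. Proof. exact: norm1_neq0. Qed.

Lemma line_coordK t : line_coord (on_line t) = t.
Proof. by rewrite /line_coord /on_line addrC addKr mulrAC mulfV// mul1r. Qed.

Lemma lineP z : line a b z <-> complex.Im ((z - b) * a^-1) = 0.
Proof.
split => [[t _ <-]|h]; first by rewrite addrC addKr mulrAC mulfV// mul1r.
exists (line_coord z) => //; rewrite /line_coord.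
have -> : (complex.Re ((z - b) * a^-1))%:C = (z - b) * a^-1 by apply: complexP => //=.
by rewrite mulrC divfK// addrC subrK.
Qed.

Lemma line_coord_on z : line a b z -> on_line (line_coord z) = z.
Proof. by move=> [t _ <-]; rewrite -/(on_line t) line_coordK. Qed.

Lemma measurable_on_line : measurable_fun [set: RT] (on_line : RT -> BC).
Proof.
refine (@measurability _ _ RT BC setT on_line (@open R[i]^o) erefl _).
move=> _ [U oU <-]; rewrite setTI; apply: open_measurable.
rewrite openE => t /=; move: oU; rewrite openE => /(_ (on_line t)) h Ot.
have /nbhs_ballP[eps /= eps0 hb] := h Ot.
have epsE : eps = (complex.Re eps)%:C by rewrite RRe_real// gtr0_real.
rewrite epsE ltcR in eps0.
apply/nbhs_ballP; exists (complex.Re eps) => // s; rewrite -ball_normE /= => ts.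
apply: hb; rewrite -ball_normE /=.
have -> : on_line t - on_line s = a * (t - s)%:C.
  by rewrite /on_line rmorphB/=; ring.
by rewrite normrM a1 mul1r epsE normE cmod_real ltcR.
Qed.

Lemma measurable_affine_part (g : C -> R) : measurable_fun [set: BC] (g : BC -> RT) ->
  measurable_fun [set: BC] ((fun z => g ((z - b) * a^-1)) : BC -> RT).
Proof.
move=> mg; apply: (measurableT_comp mg).
rewrite (_ : (fun z => _) = horner (('X - b%:P) * (a^-1)%:P)); first exact: measurable_chorner.
by apply/funext => z; rewrite hornerM hornerXsubC hornerC.
Qed.

Lemma measurable_line_coord : measurable_fun [set: BC] (line_coord : BC -> RT).
Proof. exact: (measurable_affine_part measurable_Re). Qed.

Lemma measurable_line : measurable (line a b : set BC).
Proof.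
have := measurable_affine_part measurable_Im measurableT (measurable_set1 (0 : RT)).
by rewrite setTI; congr measurable; apply/seteqP; split => z /= /lineP.
Qed.

End Line.

Section Bridge.
Variable mu : {measure set BC -> \bar R}.

(** The components are continuous, so Borel measurability into the plane implies that of
    the components. The converse is used only for polynomials and conjugation, which are
    continuous. *)
Lemma inL2_L2 f : inL2 mu f -> L2 mu (f : BC -> C).
Proof.
move=> [mf f2].
have cf : cmeas (f : BC -> C).
  by split; apply: (measurableT_comp _ mf); [exact: measurable_Re|exact: measurable_Im].
split => //; apply/integrableP; split; first by apply/measurable_EFinP; exact: cmeas_sqn.
by under eq_integral do rewrite gee0_abs ?lee_fin ?sqn_ge0//; exact: f2.
Qed.

Lemma L2_inL2 f : measurable_fun [set: BC] (f : BC -> BC) -> L2 mu (f : BC -> C) -> inL2 mu f.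
Proof.
move=> mf fL; split => //; rewrite -[ltLHS]/(\int[mu]_x (sqn (f x))%:E)%E.
by rewrite -norm2E// ltry.
Qed.

Lemma orthonormal2P P : orthonormal2 mu P <->
  (forall n, L2 mu (horner (P n) : BC -> C)) /\
  forall m n, ip mu (horner (P m) : BC -> C) (horner (P n)) = (m == n)%:R.
Proof.
split => -[sL sO]; split => // n; first exact/inL2_L2/sL.
by apply: L2_inL2 => //; exact: measurable_chorner.
Qed.

End Bridge.
End BorelPlane.

Section PushL2.
Context d1 d2 (T1 : measurableType d1) (T2 : measurableType d2) (R : realType).
Variables (mu : {measure set T1 -> \bar R}) (phi : T1 -> T2).
Hypothesis mphi : measurable_fun [set: T1] phi.
Local Notation C := R[i].
Local Notation nu := (pushm mu mphi).

Lemma cmeas_comp (f : T2 -> C) : cmeas f -> cmeas (f \o phi).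
Proof. by move=> [m1 m2]; split; [exact: measurableT_comp m1 mphi|exact: measurableT_comp m2 mphi]. Qed.

Lemma pushm_integrable (f : T2 -> R) : measurable_fun [set: T2] f ->
  (nu.-integrable [set: T2] (fun x => (f x)%:E) <->
   mu.-integrable [set: T1] (fun x => (f (phi x))%:E)).
Proof.
move=> mf; have mEf : measurable_fun [set: T2] (EFin \o f) by apply/measurable_EFinP.
have E : (\int[nu]_x `|(f x)%:E| = \int[mu]_x `|(f (phi x))%:E|)%E.
  rewrite (@ge0_integral_pushforward _ _ _ _ _ phi mphi mu setT (fun x => `|(f x)%:E|)%E)//.
  exact: measurableT_comp.
split => /integrableP[m1 i1]; apply/integrableP; split => //; rewrite ?E// -?E//.
by apply/measurable_EFinP; exact: measurableT_comp.
Qed.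

Lemma pushm_L2 (f : T2 -> C) : cmeas f -> L2 nu f <-> L2 mu (f \o phi).
Proof.
move=> mf; have h := pushm_integrable (cmeas_sqn mf).
split => -[_ fi]; split => //; [exact: cmeas_comp| | ]; exact/h.
Qed.

Lemma pushm_cint (f : T2 -> C) : cmeas f -> cintegrable mu (f \o phi) ->
  cint nu f = cint mu (f \o phi).
Proof.
move=> [m1 m2] [i1 i2]; rewrite /cint /Rintegral; congr (fine _ +i* fine _)%C.
  by rewrite (integral_pushforward mphi)//; apply/measurable_EFinP.
by rewrite (integral_pushforward mphi)//; apply/measurable_EFinP.
Qed.

Lemma pushm_ip (f g : T2 -> C) : cmeas f -> cmeas g ->
  L2 mu (f \o phi) -> L2 mu (g \o phi) -> ip nu f g = ip mu (f \o phi) (g \o phi).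
Proof.
move=> mf mg fL gL; apply: pushm_cint; first by apply: cmeasM => //; exact: cmeas_conj.
exact: L2_ip_integrable fL gL.
Qed.

End PushL2.

Section AeL2.
Context d (T : measurableType d) (R : realType) (mu : {measure set T -> \bar R}).
Local Notation C := R[i].

Lemma ae_weaken (U V : T -> Prop) : (forall x, U x -> V x) ->
  {ae mu, forall x, U x} -> {ae mu, forall x, V x}.
Proof. by move=> UV; apply: filterS. Qed.

Lemma ae_integrable (f g : T -> R) : measurable_fun [set: T] f -> measurable_fun [set: T] g ->
  {ae mu, forall x, f x = g x} -> mu.-integrable [set: T] (fun x => (f x)%:E) ->
  mu.-integrable [set: T] (fun x => (g x)%:E).
Proof.
move=> mf mg fg /integrableP[_ i]; apply/integrableP; split; first exact/measurable_EFinP.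
rewrite -(@ge0_ae_eq_integral _ _ _ mu setT (fun x => `|(f x)%:E|)%E)//.
- by apply: measurableT_comp => //; apply/measurable_EFinP.
- by apply: measurableT_comp => //; apply/measurable_EFinP.
- by apply: filterS fg => x -> _.
Qed.

Lemma ae_L2 (f g : T -> C) : cmeas f -> cmeas g -> {ae mu, forall x, f x = g x} ->
  L2 mu f -> L2 mu g.
Proof.
move=> mf mg fg [_ i]; split => //; apply: ae_integrable i; try exact: cmeas_sqn.
by apply: filterS fg => x ->.
Qed.

Lemma ae_cint (f g : T -> C) : cmeas f -> cmeas g -> {ae mu, forall x, f x = g x} ->
  cint mu f = cint mu g.
Proof.
move=> [f1 f2] [g1 g2] fg; rewrite /cint /Rintegral; congr (fine _ +i* fine _)%C;
  apply: ae_eq_integral => //; try exact/measurable_EFinP;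
  by apply: filterS fg => x -> _.
Qed.

Lemma ae_norm2 (f g : T -> C) : cmeas f -> cmeas g -> {ae mu, forall x, f x = g x} ->
  norm2 mu f = norm2 mu g.
Proof.
move=> mf mg fg; rewrite /norm2 /Rintegral; congr fine; apply: ae_eq_integral => //;
  try by apply/measurable_EFinP; exact: cmeas_sqn.
by apply: filterS fg => x -> _.
Qed.

Lemma ae_ip (f g f' g' : T -> C) : cmeas f -> cmeas g -> cmeas f' -> cmeas g' ->
  {ae mu, forall x, f x = f' x} -> {ae mu, forall x, g x = g' x} -> ip mu f g = ip mu f' g'.
Proof.
move=> mf mg mf' mg' ff gg; apply: ae_cint.
- by apply: cmeasM => //; exact: cmeas_conj.
- by apply: cmeasM => //; exact: cmeas_conj.
- by apply: filterS2 ff gg => x -> ->.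
Qed.

End AeL2.

(** * Recurrences and orthogonality in the plane *)

Section PlaneOrthogonality.
Variable R : realType.
Local Notation C := R[i].
Local Notation RT := (measurableTypeR R).
Local Notation BC := (borelC R).

Lemma affine_substE (P : nat -> {poly C}) a b n (z : C) : (affine_subst P a b n).[z] = (P n).[b + a * z].
Proof. by rewrite horner_comp hornerD hornerC hornerZ hornerX. Qed.

Lemma size_affine (a b : C) : a != 0 -> size (b%:P + a *: 'X) = 2.
Proof.
move=> a0; rewrite addrC size_polyDl size_scale// size_polyX//.
exact: leq_ltn_trans (size_polyC_leq1 _) _.
Qed.

Lemma size_affine_subst (P : nat -> {poly C}) a b : a != 0 -> (forall n, size (P n) = n.+1) ->
  forall n, size (affine_subst P a b n : {poly C}) = n.+1.
Proof. by move=> a0 sP n; rewrite size_comp_poly2 ?size_affine. Qed.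

Lemma affine_subst0 (P : nat -> {poly C}) (a b : C) : P 0%N = 1 -> affine_subst P a b 0%N = 1.
Proof. by move=> P0; rewrite /affine_subst P0 -polyC1 comp_polyC. Qed.

(** Composition with [b + a 'X] turns the difference of the two sides of the first
    recurrence into [a] times that of the second one, and it is injective. *)
Lemma three_term_affine (P : nat -> {poly C}) (a b : C) : a != 0 ->
  three_term P a b <-> symmetric_three_term (affine_subst P a b).
Proof.
move=> a0; pose L : {poly C} := b%:P + a *: 'X.
have key c d n : 'X * P n = (a * (shift_prev c n)^*) *: shift_prev P n
      + (b + a * (d n : R)%:C) *: P n + (a * c n) *: P n.+1 <->
    'X * affine_subst P a b n = (shift_prev c n)^* *: shift_prev (affine_subst P a b) n
      + (d n)%:C *: affine_subst P a b n + c n *: affine_subst P a b n.+1.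
  have LE : ('X * P n - ((a * (shift_prev c n)^*) *: shift_prev P n
      + (b + a * (d n)%:C) *: P n + (a * c n) *: P n.+1)) \Po L =
    a *: ('X * affine_subst P a b n - ((shift_prev c n)^* *: shift_prev (affine_subst P a b) n
      + (d n)%:C *: affine_subst P a b n + c n *: affine_subst P a b n.+1)).
    have -> : shift_prev (affine_subst P a b) n = shift_prev P n \Po L.
      by case: n => [|n] //=; rewrite comp_poly0.
    rewrite comp_polyB comp_polyM comp_polyX !comp_polyD !comp_polyZ /affine_subst -/L.
    rewrite {1}/L -!mul_polyC !(polyCM, polyCD); ring.
  split=> /eqP; rewrite -subr_eq0 => h; apply/eqP; rewrite -subr_eq0.
    by move: h => /eqP h; rewrite h comp_poly0 in LE; move/esym/eqP: LE; rewrite scaler_eq0 (negbTE a0).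
  rewrite -(comp_poly2_eq0 _ (size_affine b a0)) -/L LE.
  by move/eqP : h => ->; rewrite scaler0.
by split=> -[c [d [c0 h]]]; exists c, d; split => // n; apply/key.
Qed.

Lemma three_term_restricted (P : nat -> {poly C}) (a b : C) : three_term P a b -> restricted_recurrence P.
Proof.
move=> [c [d [_ h]]]; exists predn.
exists (fun i n => if i == n then b + a * (d n)%:C else if i == n.+1 then a * c n else a * (c i)^*).
split=> [n|n|].
- exact: leq_trans (leq_pred n) (leqnSn n).
- rewrite h; case: n => [|n] /=.
    by rewrite scaler0 add0r big_nat_recr// big_nat1.
  rewrite (@big_nat_recr _ _ _ n.+2) ?(leqW (leqnSn n))//.
  rewrite (@big_nat_recr _ _ _ n.+1)// big_nat1.
  by rewrite !eqxx (ltn_eqF (ltnSn n)) ?(ltn_eqF (leqW (ltnSn n))) ?(gtn_eqF (ltnSn n.+1)).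
- apply/cvgnyPge => A; by exists A.+1 => // -[|n].
Qed.

(** Multiplication by the variable is symmetric on the line, so its matrix in an
    orthonormal system of polynomials is Hermitian; being Hessenberg it is
    tridiagonal. *)
Lemma solution_symmetric (p : nat -> {poly C}) (rho : {measure set RT -> \bar R}) :
  (forall n, size (p n) = n.+1) -> solution p rho -> symmetric_three_term p.
Proof.
move=> sizep srho; have [sL sO] := srho.
pose al n k := ip rho (evR ('X * p n)) (evR (p k)).
have alC n k : al n k = (al k n)^*.
  rewrite /al -ip_conj; [|exact: (solution_poly sizep)|exact: sL].
  apply: eq_cint => x; rewrite /evR !hornerM !hornerX rmorphM/= [(_%:C)^*]conjE conjc_real.
  by ring.
have szX n : size ('X * p n) = n.+2.
  by rewrite mulrC size_mulX ?sizep// -size_poly_eq0 sizep.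
have span n : exists a : nat -> C, 'X * p n = \sum_(i < n.+2) a i *: p i /\
    forall k, al n k = if (k < n.+2)%N then a k else 0.
  have [|a ha] := @poly_span _ p sizep n.+2 ('X * p n); first by rewrite szX.
  exists a; split => // k; rewrite /al ha.
  have -> : evR (\sum_(i < n.+2) a i *: p i) = fun x => \sum_(i < n.+2) a i * evR (p i) x.
    by apply/funext => x; rewrite evR_sum.
  rewrite (@ip_sum _ _ _ rho n.+2 a (fun i => evR (p i)))//.
  under eq_bigr do rewrite sO.
  case: ifPn => kn.
    rewrite (bigD1 (Ordinal kn))//= eqxx mulr1 big1 ?addr0// => i ik.
    by rewrite (_ : (i == k :> nat) = false) ?mulr0//; apply/eqP => h; move/eqP: ik; apply; apply: val_inj.
  rewrite big1// => i _; rewrite (_ : (i == k :> nat) = false) ?mulr0//.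
  by apply/eqP => h; move: kn; rewrite -h ltn_ord.
have Xp n : 'X * p n = \sum_(i < n.+2) al n i *: p i.
  have [a [-> h]] := span n; apply: eq_bigr => i _; by rewrite h ltn_ord.
exists (fun n => al n n.+1), (fun n => complex.Re (al n n)); split => n.
  apply: contraTneq (leqnn n.+2) => h.
  rewrite -{2}(szX n) Xp big_ord_recr/= h scale0r addr0 -ltnNge ltnS.
  apply: leq_trans (size_sum _ _ _) _; apply/bigmax_leqP => i _.
  by apply: leq_trans (size_scale_leq _ _) _; rewrite sizep ltn_ord.
have -> : (complex.Re (al n n))%:C = al n n.
  have := alC n n; rewrite conjE; case: (al n n) => x y /= -[h]; congr (_ +i* _)%C.
  lra.
rewrite Xp !big_ord_recr/=; congr (_ + _ + _).
case: n => [|n] /=; first by rewrite big_ord0 scaler0.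
rewrite big_ord_recr/= -alC big1 ?add0r// => i _.
rewrite alC; have [a [_ ->]] := span i.
by rewrite !ltnS leqNgt ltn_ord/= rmorph0 scale0r.
Qed.

Lemma cmeas_chorner (q : {poly C}) : cmeas (horner q : BC -> C).
Proof.
split; apply: (measurableT_comp _ (measurable_chorner q)); first exact: measurable_Re.
exact: measurable_Im.
Qed.

Section OnLine.
Variables (a b : C).
Hypothesis a1 : `|a| = 1.
Variable P : nat -> {poly C}.
Hypothesis sizeP : forall n, size (P n) = n.+1.
Local Notation p := (affine_subst P a b).

Lemma horner_on_line q : (horner q : BC -> C) \o on_line a b = evR (q \Po (b%:P + a *: 'X)).
Proof.
by apply/funext => t; rewrite /= /on_line /evR horner_comp hornerD hornerC hornerZ hornerX.
Qed.

(** Measures on the axis and on the line correspond to each other through the isometry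
    [t |-> b + a t]. *)
Definition to_plane (rho : {measure set RT -> \bar R}) : {measure set BC -> \bar R} :=
  pushm rho (measurable_on_line b a1).

Definition to_axis (mu : {measure set BC -> \bar R}) : {measure set RT -> \bar R} :=
  pushm mu (measurable_line_coord a b).

Lemma to_plane_concentrated rho : concentrated_on (to_plane rho) (line a b).
Proof.
rewrite /concentrated_on -(measure0 rho); congr (rho _); apply/seteqP; split => t //=.
by apply; exists t.
Qed.

Lemma to_plane_orthonormal rho : solution p rho -> orthonormal2 (to_plane rho) P.
Proof.
move=> [sL sO]; apply/orthonormal2P.
have hc q := cmeas_chorner q.
have hL k : L2 rho ((horner (P k) : BC -> C) \o on_line a b) by rewrite horner_on_line; exact: sL.
split=> [n|m n]; first by apply/(pushm_L2 _ _ (hc _)); exact: hL.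
by rewrite (pushm_ip _ (hc _) (hc _) (hL m) (hL n)) !horner_on_line; exact: sO.
Qed.

Lemma to_plane_basis rho : solution p rho -> (forall f, L2 rho f -> clos rho f) ->
  orthonormal_basis2 (to_plane rho) P.
Proof.
move=> srho dens; split; first exact: to_plane_orthonormal.
move=> f /inL2_L2 fL eps eps0.
have mf : cmeas (f : BC -> C) by case: fL.
have fL' := (pushm_L2 rho (measurable_on_line b a1) mf).1 fL.
have [_ /(_ _ eps0)[q hq]] := dens _ fL'.
have a0 : a != 0 by exact: norm1_neq0.
have [k hk] := poly_span (size_affine_subst b a0 sizeP) (leqnn (size q)).
exists (size q), k.
set r := \sum_(i < _) k i *: P i.
have qr : q = r \Po (b%:P + a *: 'X).
  by rewrite {1}hk /r raddf_sum/=; apply: eq_bigr => i _; rewrite comp_polyZ.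
rewrite -[ltLHS]/(\int[to_plane rho]_z (sqn (f z - r.[z]))%:E)%E.
have mfr : cmeas (fun z : BC => f z - r.[z]) by apply: cmeasB => //; exact: cmeas_chorner.
have dL : L2 (to_plane rho) (fun z : BC => f z - r.[z]).
  apply/(pushm_L2 _ _ mfr).
  have rL : L2 rho ((horner r : BC -> C) \o on_line a b).
    by rewrite horner_on_line; apply: (solution_poly (size_affine_subst b a0 sizeP)) srho.
  exact: (L2B fL' rL).
rewrite -norm2E// lte_fin; apply: le_lt_trans hq.
have -> : (fun x => ((f : BC -> C) \o on_line a b) x - evR q x) =
   (fun z : BC => f z - r.[z]) \o on_line a b.
  by apply/funext => t; rewrite qr -horner_on_line.
have dL' := (pushm_L2 rho (measurable_on_line b a1) mfr).1 dL.
rewrite -lecR -!ipff// (pushm_ip _ mfr mfr dL' dL') //.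
Qed.

Section Concentrated.
Variable mu : {measure set BC -> \bar R}.
Hypothesis conc : concentrated_on mu (line a b).

Lemma ae_line : {ae mu, forall z : BC, line a b z}.
Proof.
apply/negligibleP => //; first by apply: measurableC; exact: measurable_line.
Qed.

Lemma to_axis_solution : orthonormal2 mu P -> solution p (to_axis mu).
Proof.
move=> /orthonormal2P[sL sO].
have me n : cmeas (evR (p n) : RT -> C) by exact: cmeas_poly.
have mec n : cmeas (evR (p n) \o line_coord a b : BC -> C).
  exact: (cmeas_comp (measurable_line_coord a b) (me n)).
have E n : {ae mu, forall z : BC, horner (P n) z = (evR (p n) \o line_coord a b) z}.
  apply: ae_weaken ae_line => z lz /=.
  by rewrite /evR affine_substE -/(on_line a b (line_coord a b z)) line_coord_on.
have L n : L2 mu (evR (p n) \o line_coord a b : BC -> C).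
  exact: ae_L2 (cmeas_chorner (P n)) (mec n) (E n) (sL n).
split=> [n|m n]; first by apply/(pushm_L2 _ _ (me n)); exact: L.
rewrite pushm_ip// -sO; apply/esym/ae_ip => //; exact: cmeas_chorner.
Qed.

Lemma to_axisE A : measurable A -> mu A = to_axis mu (on_line a b @^-1` A).
Proof.
move=> mA.
have mB : measurable (line_coord a b @^-1` (on_line a b @^-1` A) : set BC).
  have h := measurable_on_line b a1 measurableT mA; rewrite setTI in h.
  by have := measurable_line_coord a b measurableT h; rewrite setTI.
rewrite -[RHS]/(mu (line_coord a b @^-1` (on_line a b @^-1` A))).
have muE (B : set BC) : measurable B -> mu B = (\int[mu]_x (\1_B x : R)%:E)%E.
  by move=> mB'; rewrite integral_indic// setIT.
rewrite (muE _ mA) (muE _ mB).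
apply: ae_eq_integral => //; try by apply/measurable_EFinP; exact: measurable_indic.
apply: ae_weaken ae_line => z lz _; congr (_%:E); rewrite !indicE; congr ((_ : bool)%:R).
by apply/idP/idP; rewrite !inE /= line_coord_on.
Qed.

End Concentrated.
End OnLine.

Lemma orthonormal_on_line_three_term (P : nat -> {poly C}) (a b : C) : (forall n, size (P n) = n.+1) ->
  `|a| = 1 -> orthonormal_on_line P a b -> three_term P a b.
Proof.
move=> sP a1 [mu [conc orth]]; have a0 := norm1_neq0 a1.
apply/three_term_affine => //.
exact: (solution_symmetric (size_affine_subst b a0 sP) (to_axis_solution a1 conc orth)).
Qed.

Lemma symmetric_basis (P : nat -> {poly C}) (a b : C) :
  (forall n, size (P n) = n.+1) -> P 0%N = 1 -> `|a| = 1 ->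
  symmetric_three_term (affine_subst P a b) ->
  exists mu : {measure set BC -> \bar R},
    concentrated_on mu (line a b) /\ orthonormal_basis2 mu P.
Proof.
move=> sP P0 a1 [c [d [c0 rec]]]; have a0 := norm1_neq0 a1.
have [rho [srho dens]] := dense_solution (size_affine_subst b a0 sP) (affine_subst0 a b P0) c0 rec.
exists (to_plane b a1 rho); split; first exact: to_plane_concentrated.
exact: to_plane_basis.
Qed.

(** With [w = (z - b) / a], the recurrence computes [int w^2] and [int |w|^2] from the
    orthonormality of three polynomials, and both are equal; hence [w] is real almost everywhere. *)
Lemma orthonormal_concentrated (P : nat -> {poly C}) (a b : C) (mu : {measure set BC -> \bar R}) :
  P 0%N = 1 -> `|a| = 1 -> three_term P a b -> orthonormal2 mu P ->
  concentrated_on mu (line a b).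
Proof.
move=> P0 a1 [c [d [c0 rec]]] /orthonormal2P[sL sO].
have a0 := norm1_neq0 a1.
pose e n : BC -> C := horner (P n).
pose W (z : BC) : C := (z - b) * a^-1.
have e0 z : e 0%N z = 1 by rewrite /e P0 -polyC1 hornerC.
have We n z : W z * e n z = (shift_prev c n)^* * (shift_prev P n).[z] + (d n)%:C * e n z + c n * e n.+1 z.
  have := congr1 (horner ^~ z) (rec n); rewrite !hornerE -/(e n z) -/(e n.+1 z) => h.
  rewrite /W mulrAC mulrBl h; field.
  exact: a0.
have WE z : W z = \sum_(i < 2) (if i == 0 :> nat then (d 0%N)%:C else c 0%N) * e i z.
  by rewrite !big_ord_recr big_ord0/= add0r -[LHS]mulr1 -(e0 z) We /= rmorph0 mul0r add0r e0.
have WWE z : W z * W z = \sum_(i < 3) (if i == 0 :> nat then (d 0%N)%:C ^+ 2 + c 0%N * (c 0%N)^* else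
    if i == 1 :> nat then c 0%N * ((d 0%N)%:C + (d 1%N)%:C) else c 0%N * c 1%N) * e i z.
  have h0 := We 0%N z; have h1 := We 1%N z.
  rewrite /= rmorph0 mul0r add0r e0 mulr1 in h0; rewrite /= -/(e 0%N z) e0 in h1.
  rewrite !big_ord_recr big_ord0/= e0 {2}h0 mulrDr mulr1 [W z * (_ * _)]mulrCA h1 h0.
  by ring.
have WL : L2 mu W.
  have := @L2_sum _ _ _ mu 2 (fun i z => (if i == 0 :> nat then (d 0%N)%:C else c 0%N) * e i z)
    (fun i _ => L2Z _ (sL i)).
  by congr L2; apply/funext => z; rewrite WE.
have nW : norm2 mu W = sqn (d 0%N)%:C + sqn (c 0%N).
  have := @norm2_orthonormal_sum _ _ _ mu e 2 (fun i => if i == 0 :> nat then (d 0%N)%:C else c 0%N)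
    (fun i _ => sL i) (fun i j _ _ => sO i j).
  rewrite !big_ord_recr big_ord0/= add0r => <-; congr norm2; apply/funext => z; by rewrite WE.
have cWW : cint mu (fun z => W z * W z) = (sqn (d 0%N)%:C + sqn (c 0%N))%:C.
  have := @ip_sum _ _ _ mu 3 (fun i => if i == 0 :> nat then (d 0%N)%:C ^+ 2 + c 0%N * (c 0%N)^* else
    if i == 1 :> nat then c 0%N * ((d 0%N)%:C + (d 1%N)%:C) else c 0%N * c 1%N) e (e 0%N)
    (fun i _ => sL i) (sL 0%N).
  rewrite !big_ord_recr big_ord0/= !sO/= !mulr0 !addr0 add0r mulr1 => h.
  transitivity ((d 0%N)%:C ^+ 2 + c 0%N * (c 0%N)^*); last first.
    by rewrite sqn_real mul_conj -rmorphXn -rmorphD.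
  by rewrite -h; apply: eq_cint => z; rewrite e0 rmorph1 mulr1 -WWE.
have WcL : L2 mu (fun z => (W z)^*).
  case: WL => mW iW; split; first exact: cmeas_conj.
  by under eq_fun do rewrite sqn_conj.
have NL : L2 mu (fun z => (-1) * W z) by exact: L2Z.
have z0 : norm2 mu (fun z => (W z)^* + (-1) * W z) = 0.
  rewrite norm2D_eq// norm2Z// sqnN sqn1 mul1r.
  have -> : norm2 mu (fun z => (W z)^*) = norm2 mu W.
    by rewrite /norm2; apply: eq_Rintegral => z _; rewrite sqn_conj.
  have -> : ip mu (fun z => (W z)^*) (fun z => -1 * W z) = - (sqn (d 0%N)%:C + sqn (c 0%N))%:C.
    rewrite -cWW.
    have iWW : cintegrable mu (fun z => W z * W z).
      have := L2_ip_integrable WL WcL; congr cintegrable; apply/funext => z; by rewrite conjCK.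
    transitivity (cint mu (fun z => -1 * (W z * W z)^*)).
      by apply: eq_cint => z; rewrite !rmorphM/= rmorphN rmorph1; ring.
    rewrite cintZ; last exact: cintegrable_conj.
    by rewrite cint_conj// mulN1r cWW conjE conjc_real.
  rewrite nW /=; ring.
have ae := norm2_eq0 (L2D WcL NL) z0.
apply/negligibleP; first by apply: measurableC; exact: (measurable_line b a1).
apply: ae_weaken ae => z h; apply/(lineP b a1); rewrite -/(W z).
move: h; rewrite mulN1r conjE; case: (W z) => x y /= -[_ h]; lra.
Qed.

Lemma norm2_0 d (T : measurableType d) (mu : {measure set T -> \bar R}) :
  norm2 mu (fun=> 0 : C) = 0.
Proof. by rewrite /norm2; under eq_Rintegral do rewrite sqn0; rewrite /Rintegral integral0. Qed.

Lemma measurable_cconj : measurable_fun [set: BC] ((fun z : C => z^*) : BC -> BC).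
Proof.
refine (@measurability _ _ BC BC setT (fun z : C => z^*) (@open R[i]^o) erefl _).
move=> _ [U oU <-]; rewrite setTI; apply: borelC_open.
rewrite openE => z /=; move: oU; rewrite openE => /(_ z^*) h Uz.
have /nbhs_ballP[eps /= eps0 hb] := h Uz.
apply/nbhs_ballP; exists eps => // y; rewrite -ball_normE /= => zy.
by apply: hb; rewrite -ball_normE /= -rmorphB norm_conjC.
Qed.

(** The coefficients of [conj z] in the basis are conjugates of [<z P_n, 1>], which
    vanish for large [n]; hence [conj z] coincides almost everywhere with a polynomial [q],
    and iterating, [z] with the polynomial [conj q (q z)], which forces [q] to have degree one. *)
Lemma basis_on_line (P : nat -> {poly C}) (mu : {measure set BC -> \bar R}) :
  (forall n, size (P n) = n.+1) -> P 0%N = 1 -> restricted_recurrence P ->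
  orthonormal_basis2 mu P -> exists a b, `|a| = 1 /\ concentrated_on mu (line a b).
Proof.
move=> sP P0 [r [d [rn rec rinf]]] [/orthonormal2P[sL sO] dens].
pose e n : BC -> C := horner (P n).
have esum N (k : nat -> C) : (horner (\sum_(i < N) k i *: P i) : BC -> C) =
    fun z => \sum_(i < N) k i * e i z.
  by apply/funext => z; rewrite horner_sum; apply: eq_bigr => i _; rewrite hornerZ.
have pL q : L2 mu (horner q : BC -> C).
  have [k ->] := poly_span sP (leqnn (size q)).
  by rewrite esum; apply: (@L2_sum _ _ _ mu (size q) (fun i z => k i * e i z)) => i _; exact/L2Z/sL.
pose Z (z : BC) : C := z^*.
have ZL : L2 mu Z.
  have [mX iX] := pL 'X.
  have -> : Z = fun z : BC => (('X : {poly C}).[z])^* by apply/funext => z; rewrite hornerX.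
  split; first exact: cmeas_conj.
  by under eq_fun do rewrite sqn_conj.
pose al n := ip mu Z (e n).
(* [conj <conj z, P_n> = <z P_n, P_0>] is a coefficient of the recurrence. *)
have al0 n : (0 < r n)%N -> al n = 0.
  move=> r0.
  have : ip mu (horner ('X * P n) : BC -> C) (e 0%N) = 0.
    rewrite rec big_geq_mkord big_mkcond/=.
    have -> : \sum_(i < n.+2) (if (r n <= i)%N then d i n *: P i else 0) =
      \sum_(i < n.+2) (if (r n <= i)%N then d i n else 0) *: P i.
      by apply: eq_bigr => i _; case: ifP => // _; rewrite scale0r.
    rewrite (esum n.+2 (fun i => if (r n <= i)%N then d i n else 0)).
    rewrite (@ip_sum _ _ _ mu n.+2 (fun i => if (r n <= i)%N then d i n else 0) e _ (fun i _ => sL i) (sL 0%N)).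
    apply: big1 => i _; rewrite sO; case: ifPn => [ri|]; last by rewrite mul0r.
    by rewrite gtn_eqF ?mulr0// (leq_trans r0).
  move=> h; rewrite -[LHS]conjCK -[RHS](rmorph0 (@Num.conj C)) -h; congr (_^*).
  rewrite /al -cint_conj; last exact: L2_ip_integrable ZL (sL n).
  by apply: eq_cint => z; rewrite /e P0 -polyC1 hornerC rmorph1 mulr1 hornerM hornerX rmorphM/= !conjCK.
have [N0 hN0] : exists N0, forall n, (N0 <= n)%N -> al n = 0.
  by move/cvgnyPgt : rinf => /(_ 0%N)[N0 _ h]; exists N0 => n /h /al0.
pose q := \sum_(i < N0) al i *: P i.
(* The right-hand side is the full sum, as the later coefficients vanish. *)
have sal N : \sum_(i < N) sqn (al i) <= \sum_(i < N0) sqn (al i).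
  elim: N => [|N ih]; first by rewrite big_ord0; apply: sumr_ge0 => i _; exact: sqn_ge0.
  have [NN0|NN0] := leqP N0 N; first by rewrite big_ord_recr/= hN0// sqn0 addr0.
  rewrite -!(big_mkord xpredT (fun i => sqn (al i))) [leRHS](@big_cat_nat _ _ _ N.+1)//=.
  by rewrite lerDl; apply: sumr_ge0 => i _; exact: sqn_ge0.
have nq : norm2 mu (fun z => Z z - horner q z) = 0.
  rewrite esum.
  apply/eqP; rewrite eq_le norm2_ge0 andbT; apply/ler_addgt0Pr => eps eps0; rewrite add0r.
  have ZL2 : inL2 mu (fun z : C => z^*) by apply: L2_inL2 => //; exact: measurable_cconj.
  have [N [k hk]] := dens _ ZL2 _ eps0.
  have {hk} : norm2 mu (fun z => Z z - \sum_(i < N) k i * e i z) < eps.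
    have L : L2 mu (fun z => Z z - (\sum_(i < N) k i *: P i).[z]) by apply: L2B => //; exact: pL.
    have -> : (fun z => Z z - \sum_(i < N) k i * e i z) =
        fun z => Z z - (\sum_(i < N) k i *: P i).[z].
      by apply/funext => z; rewrite -[_.[z]]/(horner _ z) esum.
    by rewrite -lte_fin norm2E.
  rewrite (@norm2_sub_orthonormal _ _ _ mu e Z N k (fun n _ => sL n) (fun m n _ _ => sO m n) ZL).
  rewrite (@norm2_sub_orthonormal _ _ _ mu e Z N0 al (fun n _ => sL n) (fun m n _ _ => sO m n) ZL).
  rewrite [X in _ -> _ - _ + X <= _]big1 => [|i _]; last by rewrite subrr sqn0.
  have : 0 <= \sum_(n < N) sqn (ip mu Z (e n) - k n) by apply: sumr_ge0 => i _; exact: sqn_ge0.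
  by have := sal N; rewrite /al; lra.
have zq : {ae mu, forall z : BC, z^* = q.[z]}.
  apply: ae_weaken (norm2_eq0 (L2B ZL (pL q)) nq) => z /eqP; rewrite subr_eq0 => /eqP; exact.
pose qb := map_poly (@Num.conj C) q.
have qqX : qb \Po q = 'X.
  apply/eqP; rewrite -subr_eq0; set s := _ - _.
  have sae : {ae mu, forall z : BC, s.[z] = 0}.
    apply: ae_weaken zq => z hz; rewrite /s hornerD hornerN horner_comp hornerX -hz.
    by rewrite /qb horner_map/= -hz conjCK subrr.
  have := ae_norm2 (cmeas_chorner s) (cmeas_cst BC 0) sae; rewrite norm2_0.
  have [k ->] := poly_span sP (leqnn (size s)).
  rewrite esum (@norm2_orthonormal_sum _ _ _ mu e _ k (fun n _ => sL n) (fun m n _ _ => sO m n)).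
  move=> /eqP; rewrite psumr_eq0 => [/allP h|i _]; last exact: sqn_ge0.
  apply/eqP/big1 => i _; have := h i (mem_index_enum _); rewrite /= sqn_eq0 => /eqP ->.
  by rewrite scale0r.
have sq : size q = 2.
  have := congr1 (fun p : {poly C} => (size p).-1) qqX.
  rewrite size_comp_poly size_polyX /= size_map_poly => h.
  by move: h; case: (size q) => [|[|[|n]]].
pose A := q`_1; pose B := q`_0.
have qE z : q.[z] = B + A * z.
  by rewrite horner_coef sq !big_ord_recr big_ord0/= add0r expr0 mulr1 expr1.
have qbE z : qb.[z] = B^* + A^* * z.
  have sqb : size qb = 2 by rewrite size_map_poly.
  by rewrite horner_coef sqb !big_ord_recr big_ord0/= add0r expr0 mulr1 expr1 !coef_map.
have qq z : B^* + A^* * (B + A * z) = z.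
  by rewrite -qE -qbE -horner_comp qqX hornerX.
have AB : B^* + A^* * B = 0 by have := qq 0; rewrite mulr0 addr0.
have AA : A^* * A = 1 by have := qq 1; rewrite mulr1 mulrDr addrA AB add0r.
have A1 : `|A| = 1.
  apply/eqP; rewrite -(@sqrp_eq1 _ `|A|)// normCK mulrC AA//.
(* From [conj z = A z + B]: a direction [a] with [conj a = A a], and a point [b] fixed by
   [z |-> conj (A z + B)]. *)
pose a : C := sqrtC A^*.
have a2 : a ^+ 2 = A^* by exact: sqrtCK.
have a1 : `|a| = 1.
  by apply/eqP; rewrite -(@sqrp_eq1 _ `|a|)// -normrX a2 norm_conjC A1.
have a0 := norm1_neq0 a1.
have ac : a^* = A * a.
  by apply: (mulfI a0); rewrite norm1_mul_conj// mulrCA -expr2 a2 mulrC AA.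
pose b : C := 2^-1 * B^*.
have Bb : b^* = A * b + B.
  (* [A] times the identity [AB], simplified with [|A| = 1]. *)
  have AB' : A * B^* = - B.
    by apply/eqP; rewrite -addr_eq0 -[X in _ + X]mul1r -AA mulrAC [_ * A]mulrC -mulrDr AB mulr0.
  rewrite /b rmorphM/= conjCK fmorphV rmorph_nat mulrCA AB'.
  by field.
exists a, b; split => //.
apply/negligibleP; first by apply: measurableC; exact: (measurable_line b a1).
apply: ae_weaken zq => z hz; apply/(lineP b a1).
have : ((z - b) * a^-1)^* = (z - b) * a^-1.
  rewrite rmorphM/= fmorphV rmorphB/= hz qE ac Bb invfM.
  have A0 : A != 0 by exact: norm1_neq0.
  by field; rewrite a0 A0.
rewrite conjE; case: ((z - b) * a^-1) => x y /= -[h]; lra.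
Qed.

End PlaneOrthogonality.

(** * Uniqueness of the orthonormalizing measure and the characterization *)

Section Uniqueness.
Variable R : realType.
Local Notation C := R[i].
Local Notation RT := (measurableTypeR R).
Local Notation BC := (borelC R).

Lemma sum_sq_bounded (P : nat -> {poly C}) (z : C) : sum_sq P z = +oo%E <-> ~ bounded_at P z.
Proof.
have part N : (\sum_(0 <= k < N) (sqn (P k).[z])%:E = (\sum_(k < N) sqn (P k).[z])%:E)%E.
  by rewrite big_mkord sumEFin.
have ge0 k : (0 <= k)%N -> true -> (0 <= (sqn (P k).[z])%:E)%E by rewrite lee_fin sqn_ge0.
split=> [soo [S hS]|nb].
  suff : (sum_sq P z <= S%:E)%E by rewrite soo leye_eq.
  apply: lime_le; first exact: is_cvg_nneseries.
  by apply: nearW => N; rewrite part lee_fin.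
apply: contrapT => soo; apply: nb.
have s0 : (0 <= sum_sq P z)%E by apply: nneseries_ge0 => k _ _; exact: ge0.
have fs : sum_sq P z \is a fin_num by rewrite ge0_fin_numE// ltey; apply/eqP.
exists (fine (sum_sq P z)) => N; rewrite -lee_fin fineK// -part.
exact: nneseries_lim_ge.
Qed.

Variables (a b : C) (P : nat -> {poly C}).
Hypothesis a1 : `|a| = 1.
Hypothesis sizeP : forall n, size (P n) = n.+1.
Hypothesis P0 : P 0%N = 1.
Hypothesis tP : three_term P a b.
Local Notation p := (affine_subst P a b).
Let a0 : a != 0. Proof. exact: norm1_neq0. Qed.

Lemma sum_sq_affine (z : C) : sum_sq P z = sum_sq p ((z - b) * a^-1).
Proof.
rewrite /sum_sq; congr (limn _); apply/funext => N; apply: eq_bigr => k _.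
by rewrite affine_substE [a * _]mulrC divfK// addrC subrK.
Qed.

Lemma off_line (z : C) : ~ line a b z <-> complex.Im ((z - b) * a^-1) != 0.
Proof. by split => [h|/eqP h /(lineP b a1)//]; apply/eqP => /(lineP b a1). Qed.

(** Every orthonormalizing measure is concentrated on the line, so uniqueness reduces to
    that of the moment problem on the axis. *)
Lemma divergent_unique (z : C) : ~ line a b z -> sum_sq P z = +oo%E ->
  unique_orthonormality_measure P.
Proof.
move=> /off_line z0; rewrite sum_sq_affine => /sum_sq_bounded nb.
have sp := size_affine_subst b a0 sizeP; have p0 := affine_subst0 a b P0.
have [mu [conc [mu_orth _]]] := symmetric_basis sizeP P0 a1 ((three_term_affine P b a0).1 tP).
exists mu; split => // nu nu_orth A mA.
have nconc := orthonormal_concentrated P0 a1 tP nu_orth.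
rewrite (to_axisE a1 nconc mA) (to_axisE a1 conc mA).
have mB := measurable_on_line b a1 measurableT mA; rewrite setTI in mB.
exact: (solution_unique sp p0 z0 nb (to_axis_solution a1 nconc nu_orth)
  (to_axis_solution a1 conc mu_orth) mB).
Qed.

Lemma unique_divergent : unique_orthonormality_measure P ->
  forall z, ~ line a b z -> sum_sq P z = +oo%E.
Proof.
move=> [mu [_ uniq]] z /off_line z0; rewrite sum_sq_affine.
have sp := size_affine_subst b a0 sizeP; have p0 := affine_subst0 a b P0.
have [c [d [c0 rec]]] := (three_term_affine P b a0).1 tP.
apply/sum_sq_bounded => bnd.
have [r1 [r2 [s1 s2 [A mA]]]] := solution_nonunique sp p0 c0 rec z0 bnd; apply.
have mB : measurable (line_coord a b @^-1` A : set BC).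
  by have := measurable_line_coord a b measurableT mA; rewrite setTI.
have AE (rho : {measure set RT -> \bar R}) :
    rho A = to_plane b a1 rho (line_coord a b @^-1` A).
  rewrite -[RHS]/(rho (on_line a b @^-1` (line_coord a b @^-1` A))); congr (rho _).
  by apply/seteqP; split => t /=; rewrite line_coordK.
rewrite !AE (uniq _ (to_plane_orthonormal a1 s1) _ mB).
by rewrite (uniq _ (to_plane_orthonormal a1 s2) _ mB).
Qed.

End Uniqueness.

Local Open Scope complex_scope.

Theorem corollary3p2 (R : realType) (P : nat -> {poly R[i]})
    (degP : forall n, size (P n) = n.+1) (P0 : P 0%N = 1) :
  [/\ [<-> restricted_recurrence P /\
             (exists mu : {measure set (borelC R) -> \bar R},
                orthonormal_basis2 mu P);
           exists a b : R[i], `|a| = 1 /\ three_term P a b;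
           exists a b : R[i],
             `|a| = 1 /\ symmetric_three_term (affine_subst P a b);
           exists a b : R[i], `|a| = 1 /\ orthonormal_on_line P a b],
      (forall a b : R[i], `|a| = 1 ->
         symmetric_three_term (affine_subst P a b) ->
         exists nu : {measure set (borelC R) -> \bar R},
           concentrated_on nu (@real_line R) /\
           orthonormal_basis2 nu (affine_subst P a b)),
      (forall a b : R[i], `|a| = 1 ->
         [<-> three_term P a b;
              symmetric_three_term (affine_subst P a b);
              orthonormal_on_line P a b])
    & (forall a b : R[i], `|a| = 1 -> three_term P a b ->
         [/\ forall mu : {measure set (borelC R) -> \bar R},
               orthonormal2 mu P -> concentrated_on mu (line a b),
             unique_orthonormality_measure P <->
               (exists z : R[i], ~ line a b z /\ sum_sq P z = +oo%E)
           & (exists z : R[i], ~ line a b z /\ sum_sq P z = +oo%E) ->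
             forall z : R[i], ~ line a b z -> sum_sq P z = +oo%E])].
Proof.
have sym_on_line a b : `|a| = 1 -> symmetric_three_term (affine_subst P a b) ->
    orthonormal_on_line P a b.
  by move=> a1 /(symmetric_basis degP P0 a1)[mu [conc [orth _]]]; exists mu.
split.
- tfae.
  + move=> [rr [mu basis]]; have [a [b [a1 conc]]] := basis_on_line degP P0 rr basis.
    exists a, b; split => //; apply: orthonormal_on_line_three_term => //.
    by exists mu; split => //; case: basis.
  + move=> [a [b [a1 h]]]; exists a, b; split => //.
    exact/(three_term_affine P b (norm1_neq0 a1)).
  + by move=> [a [b [a1 h]]]; exists a, b; split => //; exact: sym_on_line.
  + move=> [a [b [a1 /(orthonormal_on_line_three_term degP a1) t]]]; split.
      exact: three_term_restricted t.
    have [mu [_ h]] := symmetric_basis degP P0 a1 ((three_term_affine P b (norm1_neq0 a1)).1 t).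
    by exists mu.
- move=> a b a1 sym; have a0 := norm1_neq0 a1.
  have idp : affine_subst (affine_subst P a b) 1 0 = affine_subst P a b.
    by apply/funext => n; rewrite {1}/affine_subst add0r scale1r comp_polyXr.
  have [|nu [conc basis]] := @symmetric_basis _ (affine_subst P a b) 1 0
    (size_affine_subst b a0 degP) (affine_subst0 a b P0) (normr1 _).
    by rewrite idp.
  exists nu; split => //; move: conc; rewrite /concentrated_on.
  congr (nu (~` _) = _); apply/seteqP; split => z [t _ <-]; exists t => //;
    by rewrite add0r mul1r.
- move=> a b a1; have a0 := norm1_neq0 a1; tfae.
  + by move=> h; apply/(three_term_affine P b a0).
  + exact: sym_on_line.
  + exact: orthonormal_on_line_three_term.
- move=> a b a1 t; split.
  + by move=> mu; exact: orthonormal_concentrated.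
  + split=> [uniq|[z [zl zoo]]]; last exact: (divergent_unique a1 degP P0 t zl zoo).
    (* Any point off the line would do. *)
    have il : ~ line a b (b + a * 'i%C).
      apply/(off_line b a1); rewrite addrC addKr mulrAC mulfV ?norm1_neq0// mul1r /=.
      exact: oner_neq0.
    by exists (b + a * 'i%C); split => //; exact: (unique_divergent a1 degP P0 t uniq).
  + move=> [z [zl zoo]]; apply: (unique_divergent a1 degP P0 t).
    exact: (divergent_unique a1 degP P0 t zl zoo).
Qed.
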